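(* Let $E\subseteq\mathbb{R}^d$ be compact, let $\mathrm{H}=\{f\in L^2(\mathbb{R}^d):\operatorname{supp}(f)\subseteq E\}$, let $\mathrm{T}\subseteq\mathrm{H}$ be a finite-dimensional subspace, and let $\Omega_N=\{\omega_n\}_{n=1}^N\subseteq\hat{\mathbb{R}}^d$ be a finite set of distinct points. (I) Let $|\cdot|_*$ be an arbitrary norm on $\mathbb{R}^d$, let $c^*>0$ be the smallest constant such that $|\cdot|\le c^*|\cdot|_*$, where $|\cdot|$ is the Euclidean norm, and let $m_E=\sup_{x\in E}|x|$. Let $\Omega_N$ be $(K,\delta_* )$-dense with respect to $Y$ with $$\delta_*<\frac{\log 2}{2\pi m_Ec^*},$$ and let $\epsilon\in\Bigl(0,\sqrt{\exp(2\pi m_E\delta_*c^* )\bigl(2-\exp(2\pi m_E\delta_*c^* )\bigr)}\Bigr)$. If $K>0$ is large enough so that $R_K(\mathrm{T})\le\epsilon$, then for every $f\in\mathrm{H}$ the NUGS reconstruction $$F(f)=\tilde f=\underset{g\in\mathrm{T}}{\operatorname{argmin}}\sum_{n=1}^N\mu_{\omega_n}|\hat f(\omega_n)-\hat g(\omega_n)|^2,$$ with weights $\mu_{\omega_n}$ equal to the Lebesgue measures of the Voronoi regions of the points of $\Omega_N$ with respect to $|\cdot|_*$ in the domain $Y_K=KY$, exists uniquely, and $$\forall f,h\in\mathrm{H},\quad\|f-F(f+h)\|\le C(\Omega_N,\mathrm{T})\bigl(\|f-\mathcal{P}_{\mathrm{T}}f\|+\|h\|\bigr)$$ holds with $$C(\Omega_N,\mathrm{T})\le\frac{2}{\sqrt{1-\epsilon^2}+1-\exp(2\pi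 m_E\delta_*c^* )} .$$ (II) Let $E$ be also convex and symmetric, and let $\Omega_N$ be $(K,\delta_{E^\circ})$-dense with respect to $Y$ with $$\delta_{E^\circ}<\tfrac14 .$$ Let $A$ denote the lower frame bound of the weighted Fourier frame arising from $\Omega=\{\omega_n\}_{n\in\mathbb{N}}$, $\Omega_N\subseteq\Omega$, and let $\epsilon\in(0,\sqrt A)$. If $K>0$ is large enough so that $\tilde R_K(\Omega_N,\mathrm{T})\le\epsilon$, then for every $f\in\mathrm{H}$ the NUGS reconstruction $$F(f)=\tilde f=\underset{g\in\mathrm{T}}{\operatorname{argmin}}\sum_{n=1}^N\mu_{\omega_n}|\hat f(\omega_n)-\hat g(\omega_n)|^2,$$ with weights $\mu_{\omega_n}$ equal to the Lebesgue measures of the Voronoi regions of the points of $\Omega_N$ with respect to $|\cdot|_{E^\circ}$ in the domain $Y_K$, exists uniquely, and $$\forall f,h\in\mathrm{H},\quad\|f-F(f+h)\|\le C(\Omega_N,\mathrm{T})\bigl(\|f-\mathcal{P}_{\mathrm{T}}f\|+\|h\|\bigr)$$ holds with $$C(\Omega_N,\mathrm{T})\le\frac{\exp\bigl(\tfrac12\pi m_Ec^\circ\bigr)}{\sqrt{A-\epsilon^2}},$$ where $c^\circ>0$ is the smallest constant such that $|\cdot|\le c^\circ|\cdot|_{E^\circ}$ and $m_E=\sup_{x\in E}|x|$.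
   Context: $\hat{\mathbb{R}}^d$ is $\mathbb{R}^d$ regarded as the frequency domain; $\|\cdot\|$ is the $L^2$-norm and $\|\cdot\|_S$ the $L^2$-norm over a set $S\subseteq\hat{\mathbb{R}}^d$; $\hat f(\omega)=\int_E f(x)e^{-2\pi i\,\omega\cdot x}\,dx$; $e_\omega(x)=e^{2\pi i\,\omega\cdot x}\mathbf{1}_E(x)$; $\mathcal{P}_{\mathrm{T}}$ is the orthogonal projection onto $\mathrm{T}$. Norms: for compact, convex, symmetric $E$ ($E=-E$), $|x|_E=\inf\{a>0:x\in aE\}$, which is taken to be a norm (so $E$ is understood to have nonempty interior in part (II)). The polar set is $E^\circ=\{\hat y\in\hat{\mathbb{R}}^d:\forall x\in E,\ x\cdot\hat y\le1\}$, the unit ball of the norm $|\cdot|_{E^\circ}$. Density: for a norm $|\cdot|_*$ and $\delta_*>0$, a set $\Omega$ contained in a closed simply connected set $Z\subseteq\hat{\mathbb{R}}^d$ with $0$ in its interior is $\delta_*$-dense in the domain $Z$ if $\delta_*=\sup_{\hat y\in Z}\inf_{\omega\in\Omega}|\omega-\hat y|_*$ (written $\delta_{E^\circ}$ when $|\cdot|_*=|\cdot|_{E^\circ}$). $(K,\delta_* )$-density: let $K>0$ and let $Y\subseteq\hat{\mathbb{R}}^d$ be a closed, simply connected set with $0$ in its interior and $\max_{\hat y\in Y}|\hat y|_\infty=1$. A set $\Omega$ is $(K,\delta_* )$-dense with respect to $Y$ if $\Omega\subseteq Y_K:=KY$ and $\Omega$ is $\delta_*$-dense in the domain $Y_K$.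 Voronoi region: for a set $\Omega$ of distinct points in $Z$, the Voronoi region at $\omega\in\Omega$ with respect to $|\cdot|_*$ in the domain $Z$ is $V^*_\omega=\{\hat y\in Z:\forall\lambda\in\Omega,\ \lambda\ne\omega,\ |\omega-\hat y|_*\le|\lambda-\hat y|_*\}$. Weighted Fourier frame: $\{\sqrt{\mu_\omega}e_\omega\}_{\omega\in\Omega}$ with weights $\mu_\omega>0$ is a weighted Fourier frame for $\mathrm{H}$ with lower and upper bounds $A,B>0$ if $A\|f\|^2\le\sum_{\omega\in\Omega}\mu_\omega|\hat f(\omega)|^2\le B\|f\|^2$ for all $f\in\mathrm{H}$. Residuals: the $K$-residual of $\mathrm{T}$ is $$R_K(\mathrm{T})=\sup_{f\in\mathrm{T},\,\|f\|=1}\|\hat f\|_{\hat{\mathbb{R}}^d\setminus Y_K}.$$ For part (II), $\Omega=\{\omega_n\}_{n\in\mathbb{N}}\supseteq\Omega_N$ is a countable set extending $\Omega_N=\{\omega_n\}_{n=1}^N$ that yields a weighted Fourier frame for $\mathrm{H}$, with weights $\mu_\omega$, $\omega\in\Omega$, the Lebesgue measures of the Voronoi regions of the points of $\Omega$ with respect to $|\cdot|_{E^\circ}$ in the domain $\hat{\mathbb{R}}^d$, and, with these weights, $$\tilde R_K(\Omega_N,\mathrm{T})=\sup_{f\in\mathrm{T},\,\|f\|=1}\sqrt{\sum_{\omega\in\Omega\cap S_K}\mu_\omega|\hat f(\omega)|^2},\qquad S_K=\hat{\mathbb{R}}^d\setminus E^\circ_{r(K)-1/2},$$ where $E^\circ_\rho$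 denotes the ball of radius $\rho$ centred at $0$ with respect to $|\cdot|_{E^\circ}$ and $E^\circ_{r(K)}$ is the largest such ball contained in $Y_K$.
   Formalization: Added because the claim fails otherwise: in (I) and (II) the Voronoi regions of the points of Ω_N in Y_K overlap only in null sets (automatic for strictly convex norms); in (II) the points of Ω not in Ω_N lie in S_K. In (II) also T ≠ {0}, a degenerate case. *)

(* Defs.v *)
From HB Require Import structures.
From mathcomp Require Import all_boot all_order all_algebra.
From mathcomp Require Import all_classical all_reals all_analysis.
From mathcomp.real_closed Require Import complex.
Set Implicit Arguments. Unset Strict Implicit. Unset Printing Implicit Defensive.
Import Order.TTheory GRing.Theory Num.Theory.
Import numFieldNormedType.Exports.
Local Open Scope classical_set_scope.
Local Open Scope ring_scope.

(* R^n is 'rV[R]_n, with the product (= Borel) sigma-algebra generated by the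
   coordinates, as for n.-tuple in the library. *)
Fact rv_display : measure_display -> measure_display. Proof. exact. Qed.

Section rv_measurable.
Context {R : realType} {n : nat}.
Let coord (i : 'I_n) (x : 'rV[R]_n) : measurableTypeR R := x ord0 i.
Let rv_set0 : g_sigma_preimage coord set0. Proof. exact: sigma_algebra0. Qed.
Let rv_setC A : g_sigma_preimage coord A -> g_sigma_preimage coord (~` A).
Proof. exact: sigma_algebraC. Qed.
Let rv_bigcup (F : _^nat) : (forall i, g_sigma_preimage coord (F i)) ->
  g_sigma_preimage coord (\bigcup_i F i).
Proof. exact: sigma_algebra_bigcup. Qed.
HB.instance Definition _ := @isMeasurable.Build (rv_display (R.-ocitv.-measurable).-sigma)
  'rV[R]_n (g_sigma_preimage coord) rv_set0 rv_setC rv_bigcup.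
End rv_measurable.

Section lebesgue_rv.
Context {R : realType}.
Local Open Scope ereal_scope.

Definition rv_cons n (p : measurableTypeR R * 'rV[R]_n) : 'rV[R]_n.+1 :=
  row_mx (p.1%:M : 'rV_1) p.2.

Lemma measurable_rv_coord n (i : 'I_n) :
  measurable_fun setT (fun x : 'rV[R]_n => x ord0 i : measurableTypeR R).
Proof.
move=> _ Y mY; rewrite setTI; apply: sub_sigma_algebra => /=.
rewrite -bigcup_seq/=; exists i => /=; first by rewrite mem_index_enum.
by exists Y => //; rewrite setTI.
Qed.

Lemma measurable_rv_cons n : measurable_fun setT (@rv_cons n).
Proof.
move=> _ Y mY; rewrite setTI.
pose G := [set A | measurable (@rv_cons n @^-1` A)].
suff: measurable `<=` G by exact.
apply: smallest_sub.
  split.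
  - by rewrite /G/= preimage_set0.
  - by move=> A; rewrite /G/= setTD preimage_setC; exact: measurableC.
  - by move=> F mF; rewrite /G/= preimage_bigcup; exact: bigcupT_measurable.
move=> A; rewrite -bigcup_seq/= => -[i _ [B mB <-{A}]].
rewrite /G/= setTI -comp_preimage.
have [j ij|j ij] := splitP (i : 'I_(1 + n)).
- have -> : (fun x : 'rV[R]_n.+1 => x ord0 i : measurableTypeR R) \o @rv_cons n = fst.
    apply/funext => p /=; rewrite /rv_cons.
    have -> : i = lshift n j by exact/val_inj.
    by rewrite (@row_mxEl _ 1 1 n) (ord1 j) mxE eqxx.
  by rewrite -[X in measurable X]setTI; exact: measurable_fst.
- have -> : (fun x : 'rV[R]_n.+1 => x ord0 i : measurableTypeR R) \o @rv_cons n =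
      (fun x : 'rV[R]_n => x ord0 j : measurableTypeR R) \o snd.
    apply/funext => p /=; rewrite /rv_cons.
    have -> : i = rshift 1 j by exact/val_inj.
    by rewrite (@row_mxEr _ 1 1 n).
  rewrite -[X in measurable X]setTI.
  apply: (measurableT_comp (measurable_rv_coord j)) => //.
Qed.

Section step.
Context n (m : {sigma_finite_measure set 'rV[R]_n -> \bar R}).

Definition lebesgue_rv_step : set 'rV[R]_n.+1 -> \bar R :=
  pushforward (@lebesgue_measure R \x m) (@rv_cons n).

Let step0 : lebesgue_rv_step set0 = 0.
Proof. by rewrite /lebesgue_rv_step /pushforward preimage_set0 measure0. Qed.

Let step_ge0 A : 0 <= lebesgue_rv_step A.
Proof. by rewrite /lebesgue_rv_step /pushforward. Qed.

Let step_sigma_additive : semi_sigma_additive lebesgue_rv_step.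
Proof.
move=> F mF tF mUF; rewrite /lebesgue_rv_step /pushforward preimage_bigcup.
apply: measure_semi_sigma_additive.
- by move=> k; rewrite -[X in measurable X]setTI; exact: measurable_rv_cons.
- apply/trivIsetP => /= i j _ _ ij; rewrite -preimage_setI.
  by move/trivIsetP : tF => /(_ _ _ _ _ ij) ->//; rewrite preimage_set0.
- by rewrite -preimage_bigcup -[X in measurable X]setTI; exact: measurable_rv_cons.
Qed.

HB.instance Definition _ := isMeasure.Build _ _ _ lebesgue_rv_step
  step0 step_ge0 step_sigma_additive.

Let step_sigma_finite : sigma_finite setT lebesgue_rv_step.
Proof.
have /sigma_finiteP[F [TF ndF Foo]] := sigma_finiteT (@lebesgue_measure R).
have /sigma_finiteP[G [TG ndG Goo]] := sigma_finiteT m.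
pose H k := (fun x : 'rV[R]_n.+1 => x ord0 ord0 : measurableTypeR R) @^-1` F k
  `&` (fun x : 'rV[R]_n.+1 => rsubmx (x : 'rV_(1 + n))) @^-1` G k.
have HE k : @rv_cons n @^-1` H k = F k `*` G k.
  rewrite predeqE => -[a b]; rewrite /H /rv_cons/= row_mxKr.
  have -> // : row_mx (a%:M : 'rV_1) b ord0 ord0 = a :> R.
  have -> : ord0 = lshift n ord0 :> 'I_(1 + n) by exact/val_inj.
  by rewrite (@row_mxEl _ 1 1 n) mxE eqxx.
have mrsub : measurable_fun setT (fun x : 'rV[R]_n.+1 => rsubmx (x : 'rV_(1 + n))).
  move=> _ Y mY; rewrite setTI.
  pose D := [set A | measurable
    ((fun x : 'rV[R]_n.+1 => rsubmx (x : 'rV_(1 + n))) @^-1` A)].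
  suff: measurable `<=` D by exact.
  apply: smallest_sub.
    split.
    - by rewrite /D/= preimage_set0.
    - by move=> A; rewrite /D/= setTD preimage_setC; exact: measurableC.
    - by move=> E mE; rewrite /D/= preimage_bigcup; exact: bigcupT_measurable.
  move=> A; rewrite -bigcup_seq/= => -[i _ [B mB <-{A}]].
  rewrite /D/= setTI -comp_preimage.
  have -> : (fun x : 'rV[R]_n => x ord0 i : measurableTypeR R) \o
      (fun x : 'rV[R]_n.+1 => rsubmx (x : 'rV_(1 + n))) =
      (fun x : 'rV[R]_n.+1 => x ord0 (rshift 1 i) : measurableTypeR R).
    by apply/funext => x /=; rewrite mxE.
  by rewrite -[X in measurable X]setTI; exact: measurable_rv_coord.
exists H.
  rewrite predeqE => x; split => // _.
  have : [set: measurableTypeR R] (x ord0 ord0) by [].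
  have : [set: 'rV[R]_n] (rsubmx (x : 'rV_(1 + n))) by [].
  rewrite {1}TF {1}TG => -[k _ Gk] [l _ Fl]; exists (maxn k l) => //; split.
  - have /subsetPset sF := ndF _ _ (leq_maxr k l); exact: sF.
  - have /subsetPset sG := ndG _ _ (leq_maxl k l); exact: sG.
move=> k; have [mF Fk] := Foo k; have [mG Gk] := Goo k; split.
  apply: measurableI.
  - by rewrite -[X in measurable X]setTI; exact: measurable_rv_coord.
  - by rewrite -[X in measurable X]setTI; exact: mrsub.
rewrite /lebesgue_rv_step /pushforward HE product_measure1E//.
by rewrite lte_mul_pinfty// ge0_fin_numE.
Qed.

HB.instance Definition _ := Measure_isSigmaFinite.Build _ _ _ lebesgue_rv_step
  step_sigma_finite.

End step.

(* Lebesgue measure on the Borel sets of R^n: the n-fold product of the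
   one-dimensional Lebesgue measure. *)
Fixpoint lebesgue_rv n : {sigma_finite_measure set 'rV[R]_n -> \bar R} :=
  if n is k.+1 return {sigma_finite_measure set 'rV[R]_n -> \bar R}
  then lebesgue_rv_step (lebesgue_rv k) else dirac (0%R : 'rV[R]_0).

End lebesgue_rv.

Section geometry.
Context {R : realType} {d : nat}.
Implicit Types (x y w : 'rV[R]_d) (A E Om Z Y : set 'rV[R]_d)
  (N : 'rV[R]_d -> R).

Definition dot x y : R := \sum_(i < d) x ord0 i * y ord0 i.
Definition enorm x : R := Num.sqrt (dot x x).

Definition is_norm N : Prop :=
  [/\ forall x y, N (x + y) <= N x + N y,
      forall (a : R) x, N (a *: x) = `|a| * N x
    & forall x, N x = 0 -> x = 0].

Definition smallest_const N (c : R) : Prop :=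
  [/\ 0 < c, forall x, enorm x <= c * N x
    & forall c', 0 < c' -> (forall x, enorm x <= c' * N x) -> c <= c'].

(* The constant m_E of a compact set E; it is 0 when E is empty. *)
Definition sup_enorm E : R := sup [set enorm x | x in E].

Definition dilate (a : R) A : set 'rV[R]_d := [set a *: x | x in A].

Definition symmetric_set A : Prop := forall x, A x -> A (- x).

Definition gauge A x : R := inf [set a : R | 0 < a /\ dilate a A x].

Definition polar E : set 'rV[R]_d := [set y | forall x, E x -> dot x y <= 1].

(* closed ball centred at 0; empty when rho < 0 *)
Definition norm_ball N (rho : R) : set 'rV[R]_d := [set y | N y <= rho].

Definition inradius N Z : R := sup [set r : R | 0 <= r /\ norm_ball N r `<=` Z].

Definition path_in A (g : R -> 'rV[R]_d) : Prop :=
  {within `[0, 1], continuous g} /\ (forall t, t \in `[0, 1] -> A (g t)).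

Definition simply_connected A : Prop :=
  (forall x y, A x -> A y -> exists g, [/\ path_in A g, g 0 = x & g 1 = y]) /\
  (forall g, path_in A g -> g 0 = g 1 ->
     exists h : R * R -> 'rV[R]_d,
       [/\ {within `[0, 1]%classic `*` `[0, 1]%classic, continuous h},
           forall s t, s \in `[0, 1] -> t \in `[0, 1] -> A (h (s, t)),
           forall t, t \in `[0, 1] -> h (0, t) = g t,
           forall t, t \in `[0, 1] -> h (1, t) = g 0
         & forall s, s \in `[0, 1] -> h (s, 0) = g 0 /\ h (s, 1) = g 0]).

Definition density_domain Z : Prop :=
  [/\ closed Z, simply_connected Z & Z° 0].

(* The value is taken in \bar R, so that a real delta is attained only if all
   the suprema and infima involved are finite (in particular Om is nonempty). *)
Definition dense_in N Om Z (delta : R) : Prop :=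
  [/\ 0 < delta, Om `<=` Z &
  ereal_sup [set ereal_inf [set (N (w - y))%:E | w in Om] | y in Z]
    = delta%:E].

(* On 'rV[R]_d the library norm `|y| is the max norm |y|_oo. *)
Definition K_dense N Om Y (K delta : R) : Prop :=
  [/\ 0 < K, density_domain Y,
      (forall y, Y y -> `|y| <= 1) /\ (exists2 y, Y y & `|y| = 1)
    & dense_in N Om (dilate K Y) delta].

Definition voronoi N Om Z w : set 'rV[R]_d :=
  [set y | Z y /\ forall l, Om l -> l != w -> N (w - y) <= N (l - y)].

Definition voronoi_weight N Om Z w : \bar R := lebesgue_rv d (voronoi N Om Z w).

(* The bisectors of a norm that is not strictly convex (such as |.|_1) may
   contain open sets, so this is a genuine condition on N and Om; it always
   holds for strictly convex norms. *)
Definition voronoi_tessellation N Om Z : Prop :=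
  forall w l, Om w -> Om l -> w != l ->
    lebesgue_rv d (voronoi N Om Z w `&` voronoi N Om Z l) = 0%E.

End geometry.

Section fourier_frames.
Context {R : realType} {d : nat}.
Implicit Types (f g h p : 'rV[R]_d -> R[i]) (E S Om Z Y : set 'rV[R]_d)
  (N : 'rV[R]_d -> R) (T : set ('rV[R]_d -> R[i])).

Definition sqmod (z : R[i]) : R := complex.Re z ^+ 2 + complex.Im z ^+ 2.

Definition expi (t : R) : R[i] := Complex (cos t) (sin t).

Definition integralC S f : R[i] :=
  Complex (\int[lebesgue_rv d]_(x in S) complex.Re (f x))
          (\int[lebesgue_rv d]_(x in S) complex.Im (f x)).

Definition L2norm S f : \bar R :=
  sqrte (\int[lebesgue_rv d]_(x in S) (sqmod (f x))%:E)%E.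

Definition inner f g : R[i] := integralC setT (fun x => f x * conjc (g x)).

(* Elements of L^2 are represented by functions, equal when they agree a.e. *)
Definition Hspace E : set ('rV[R]_d -> R[i]) :=
  [set f | [/\ measurable_fun setT (fun x => complex.Re (f x)),
               measurable_fun setT (fun x => complex.Im (f x)),
               (L2norm setT f < +oo)%E
             & {ae lebesgue_rv d, forall x, ~ E x -> f x = 0}]].

(* T is closed under a.e. equality: it is the set of all representatives of
   the elements of a finite-dimensional subspace of H. *)
Definition fin_dim_subspace E T : Prop :=
  exists m (phi : 'I_m -> 'rV[R]_d -> R[i]),
    (forall i, Hspace E (phi i)) /\
    T = [set g | Hspace E g /\ exists c : 'I_m -> R[i],
          {ae lebesgue_rv d, forall x, g x = \sum_(i < m) c i * phi i x}].

Definition fourier E f (w : 'rV[R]_d) : R[i] :=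
  integralC E (fun x => f x * expi (- (2 * pi * dot w x))).

Definition orth_proj T f : 'rV[R]_d -> R[i] :=
  xget (fun=> 0) [set p | T p /\ forall g, T g ->
                            inner (fun x => f x - p x) g = 0].

Definition weighted_energy E (mu : 'rV[R]_d -> \bar R) Om f : \bar R :=
  (\esum_(w in Om) (mu w * (sqmod (fourier E f w))%:E))%E.

Definition weighted_fourier_frame E mu Om (A B : R) : Prop :=
  [/\ forall w, Om w -> (0 < mu w < +oo)%E, 0 < A, 0 < B
    & forall f, Hspace E f ->
        (A%:E * L2norm setT f ^+ 2 <= weighted_energy E mu Om f
                                   <= B%:E * L2norm setT f ^+ 2)%E].

Definition unit_sphere T : set ('rV[R]_d -> R[i]) :=
  [set f | T f /\ L2norm setT f = 1%E].

Definition residual E T Y (K : R) : \bar R :=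
  ereal_sup [set L2norm (~` dilate K Y) (fourier E f) | f in unit_sphere T].

Definition discrete_residual E T mu Om S : \bar R :=
  ereal_sup [set sqrte (weighted_energy E mu (Om `&` S) f)
            | f in unit_sphere T].

(* The set S_K on which the discrete residual is measured. *)
Definition far_region E Y (K : R) : set 'rV[R]_d :=
  let N := gauge (polar E) in
  ~` norm_ball N (inradius N (dilate K Y) - 2^-1).

Definition nugs_residual E mu Om f g : \bar R :=
  (\sum_(w \in Om) (mu w * (sqmod (fourier E f w - fourier E g w))%:E))%E.

Definition nugs_argmin E T mu Om f : set ('rV[R]_d -> R[i]) :=
  [set g | T g /\ forall g', T g' ->
             (nugs_residual E mu Om f g <= nugs_residual E mu Om f g')%E].

Definition exists_unique_ae (P : set ('rV[R]_d -> R[i])) : Prop :=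
  P !=set0 /\
  forall g g', P g -> P g' -> {ae lebesgue_rv d, forall x, g x = g' x}.

Definition nugs E T mu Om f : 'rV[R]_d -> R[i] :=
  xget (fun=> 0) (nugs_argmin E T mu Om f).

End fourier_frames.

(* Main.v *)
From HB Require Import structures.
Require Import Defs.
From mathcomp Require Import all_boot all_order all_algebra.
From mathcomp Require Import all_classical all_reals all_analysis.
From mathcomp.real_closed Require Import complex.
From mathcomp Require Import finmap measurable_realfun ring lra.
Import Order.TTheory GRing.Theory Num.Theory.
Import numFieldNormedType.Exports.
Local Open Scope classical_set_scope.
Local Open Scope ring_scope.
Set Implicit Arguments. Unset Strict Implicit. Unset Printing Implicit Defensive.

(** Why the theorem holds.

    The reconstruction is a least-squares fit, hence the projection onto T
    that is orthogonal for the sampling form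
    s f g = sum_n mu_n Re (f^(w_n) conj (g^(w_n))).
    All that is needed are two comparisons of s with the L^2 norm: s f f <=
    B |f|^2 on H, and s g g >= A |g|^2 on T. The second makes the minimizer
    unique. Together they bound the oblique projection u of f by A |u|^2 <=
    B |f|^2; since a projection and its complement have the same norm, the
    error is at most sqrt (B / A) (|f - P f| + |h|) (least_squares_error,
    nugs_stable).

    Both comparisons rest on the fact that f^ varies slowly, f having compact
    support. In the Voronoi cell of w the point y satisfies |w - y| <=
    c delta, and the Taylor series of f^ at y bounds f^(w) by a weighted sum
    over k of the k-th derivative tensors of f^ at y, whose L^2 norms are at
    most (2 pi m_E)^k |f| by Plancherel's identity. Cauchy-Schwarz with the
    weights of the exponential series, followed by integration over the
    cells, gives with q = exp (2 pi m_E delta c)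
      sum_n mu_n |f^(w_n)|^2 <= q^2 |f|^2,
      sum_n int_(V_n) |f^(y) - f^(w_n)|^2 dy <= (q - 1)^2 |f|^2
    (sampled_energy_le, cell_deviation_le). So B = q^2 will do; in part (II)
    q is at most exp (pi m_E c / 2), because delta < 1/4.

    In part (I), Minkowski's inequality on the cells bounds the L^2 norm of
    f^ over the window by sqrt (s f f) + (q - 1) |f|, while for f in T that
    norm is at least sqrt (1 - eps^2) |f|, by Plancherel and the bound on the
    residual; hence sqrt A = sqrt (1 - eps^2) + 1 - q (sform_ge). In part (II)
    the frame inequality for Omega provides the lower bound up to the far
    samples, which contribute at most eps^2 |f|^2. A sample w whose polar norm
    is at most r(K) - 1/2 is by assumption in Omega_N, and as delta < 1/4 its
    cell in the whole space stays inside the window, so that its weight for Omega is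
    at most its weight for Omega_N (near_cell_subset).

    Plancherel's identity is proved from the definition of the integral. On
    the line, damping the frequency integral by exp (- t w) turns the energy
    of f^ into the quadratic form of the Poisson kernel, an approximate
    identity as t tends to 0. Fubini's theorem yields bounded functions on a
    cube of R^n by induction on n, and truncation of the values yields
    square-integrable ones. *)

(** * Fubini and dominated convergence for real-valued integrals *)

Section fubini_dominated.
Context d1 d2 (T1 : measurableType d1) (T2 : measurableType d2) (R : realType).
Variable m2 : {sigma_finite_measure set T2 -> \bar R}.
Implicit Types F : T1 * T2 -> R.

Lemma measurable_Rintegral_param F : measurable_fun setT F ->
  measurable_fun setT (fun x => \int[m2]_y F (x, y)).
Proof.
move=> mF; apply: (measurableT_comp (f := fine)) => //.
have mEF : measurable_fun setT (EFin \o F) by exact/measurable_EFinP.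
rewrite (_ : (fun x => _) = (fun x => \int[m2]_y (EFin \o F)^\+%E (x, y) -
   \int[m2]_y (EFin \o F)^\-%E (x, y))%E).
  apply: emeasurable_funB.
    exact: (@measurable_fun_fubini_tonelli_F _ _ _ _ _ _ _ (measurable_funepos mEF)).
  exact: (@measurable_fun_fubini_tonelli_F _ _ _ _ _ _ _ (measurable_funeneg mEF)).
apply/funext => x; rewrite integralE; congr (_ - _)%E; apply: eq_integral => y _;
  by rewrite ?funeposE ?funenegE.
Qed.

Variable m1 : {sigma_finite_measure set T1 -> \bar R}.
Variables (F : T1 * T2 -> R) (g1 : T1 -> R) (g2 : T2 -> R).
Hypotheses (mF : measurable_fun setT F)
  (ig1 : m1.-integrable setT (EFin \o g1)) (ig2 : m2.-integrable setT (EFin \o g2))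
  (Fg : forall x y, `|F (x, y)| <= g1 x * g2 y).

Lemma measurable_section1 x : measurable_fun setT (fun y => F (x, y)).
Proof. exact: (measurableT_comp mF). Qed.

Lemma measurable_section2 y : measurable_fun setT (fun x => F (x, y)).
Proof. exact: (measurableT_comp mF). Qed.

Lemma dominated_integrable1 x : m2.-integrable setT (EFin \o (fun y => F (x, y))).
Proof.
apply: (le_integrable _ _ _ (integrableZl _ (g1 x) ig2)) => //.
  exact/measurable_EFinP/measurable_section1.
by move=> y _ /=; rewrite lee_fin (le_trans (Fg x y))// ler_norm.
Qed.

Lemma dominated_integrable2 y : m1.-integrable setT (EFin \o (fun x => F (x, y))).
Proof.
apply: (le_integrable _ _ _ (integrableZl _ (g2 y) ig1)) => //.
  exact/measurable_EFinP/measurable_section2.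
by move=> x _ /=; rewrite lee_fin (le_trans (Fg x y))// mulrC ler_norm.
Qed.

Lemma dominated_integrable_prod : (m1 \x m2)%E.-integrable setT (EFin \o F).
Proof.
apply/integrable12ltyP; first exact/measurable_EFinP.
have ag1 := integrable_norm ig1; have ag2 := integrable_norm ig2.
apply: (@le_lt_trans _ _ (\int[m1]_x (`|g1 x| * \int[m2]_y `|g2 y|)%:E)%E).
  apply: ge0_le_integral => //.
  - by move=> x _; apply: integral_ge0.
  - apply: (@measurable_fun_fubini_tonelli_F _ _ _ _ _ _ (fun z => `|(EFin \o F) z|%E)) => //.
    by apply: measurableT_comp => //; exact/measurable_EFinP.
  - by case/integrableP: (integrableZr measurableT (\int[m2]_y `|g2 y|) ag1).
  move=> x _ /=; rewrite EFinM /Rintegral fineK; last exact: integrable_fin_num ag2.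
  rewrite -ge0_integralZl//; last by case/integrableP: ag2.
  apply: ge0_le_integral => //.
  - by apply/measurable_EFinP; apply: measurableT_comp => //; exact: measurable_section1.
  - by case/integrableP: (integrableZl measurableT `|g1 x| ag2).
  by move=> y _; rewrite -EFinM lee_fin -normrM (le_trans (Fg x y))// ler_norm.
have /integrableP[_] := integrableZr measurableT (\int[m2]_y `|g2 y|) ag1.
apply: le_lt_trans; apply: ge0_le_integral => //.
- by move=> x _; rewrite lee_fin mulr_ge0// Rintegral_ge0.
- by case/integrableP: (integrableZr measurableT (\int[m2]_y `|g2 y|) ag1).
- by apply: measurableT_comp => //; case/integrableP: (integrableZr measurableT (\int[m2]_y `|g2 y|) ag1).
- by move=> x _; exact: lee_abs.
Qed.

(** A product bound g1 (x) g2 (y) with integrable factors gives all the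
    integrability that Fubini requires; the double integrals of signed
    functions below all have one. *)
Lemma dominated_fubini12 :
  \int[m1]_x \int[m2]_y F (x, y) = \int[(m1 \x m2)%E]_z F z.
Proof.
rewrite /Rintegral; congr fine.
rewrite -(integral12_prod_meas1 dominated_integrable_prod).
apply: eq_integral => x _; rewrite fineK//.
exact: integrable_fin_num (dominated_integrable1 x).
Qed.

Lemma dominated_fubini :
  \int[m1]_x \int[m2]_y F (x, y) = \int[m2]_y \int[m1]_x F (x, y).
Proof.
rewrite dominated_fubini12 /Rintegral; congr fine.
rewrite -(integral21_prod_meas1 dominated_integrable_prod).
apply: eq_integral => y _; rewrite fineK//.
exact: integrable_fin_num (dominated_integrable2 y).
Qed.

End fubini_dominated.

Section Rdominated_convergence.
Context d (T : measurableType d) (R : realType).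
Variable mu : {measure set T -> \bar R}.

Lemma Rdominated_convergence (f_ : nat -> T -> R) (f g : T -> R) :
  (forall n, measurable_fun setT (f_ n)) -> measurable_fun setT f ->
  {ae mu, forall x, f_ n x @[n --> \oo] --> f x} ->
  mu.-integrable setT (EFin \o g) ->
  (forall n x, `|f_ n x| <= g x) ->
  \int[mu]_x f_ n x @[n --> \oo] --> \int[mu]_x f x.
Proof.
move=> mf_ mf f_f ig f_g.
have fE : {ae mu, forall x, setT x -> (f_ n x)%:E @[n --> \oo] --> (f x)%:E}.
  by apply: filterS f_f => x fx _; apply: cvg_EFin => //; exact: nearW.
have f_gE : {ae mu, forall x, forall n, setT x -> (`|(f_ n x)%:E| <= (g x)%:E)%E}.
  by apply: aeW => x n _; rewrite lee_fin.
have mE n : measurable_fun setT (fun x => (f_ n x)%:E) by exact/measurable_EFinP.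
have mfE : measurable_fun setT (fun x => (f x)%:E) by exact/measurable_EFinP.
have [If _ cf] := dominated_convergence measurableT mE mfE fE ig f_gE.
apply: fine_cvg; rewrite fineK//; exact: integrable_fin_num If.
Qed.

End Rdominated_convergence.

(** * The Poisson kernel on the line *)

Section poisson_kernel.
Context {R : realType}.
Implicit Types t a x y s : R.
Notation mu := (@lebesgue_measure R).

Lemma cos_le1N (x : R) : `|cos x| <= 1. Proof. by rewrite ler_norml cos_geN1 cos_le1. Qed.
Lemma sin_le1N (x : R) : `|sin x| <= 1. Proof. by rewrite ler_norml sin_geN1 sin_le1. Qed.

Lemma is_derive1_continuous (f : R -> R) (x l : R) :
  is_derive x (1 : R) f l -> {for x, continuous f}.
Proof.
by move=> [df _]; apply: differentiable_continuous; exact/derivable1_diffP.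
Qed.

Definition laplace_cos_primitive t a (w : R) : R :=
  expR (- (t * w)) * (a * sin (a * w) - t * cos (a * w)) / (t ^+ 2 + a ^+ 2).

Lemma is_derive_laplace_cos_primitive t a (w : R) : 0 < t ->
  is_derive w (1 : R) (laplace_cos_primitive t a) (expR (- (t * w)) * cos (a * w)).
Proof.
move=> t0; rewrite /laplace_cos_primitive.
have ? : t ^+ 2 + a ^+ 2 != 0 by nra.
apply: is_derive_eq.
rewrite /GRing.scale/=. by field.
Qed.

Lemma is_derive_expRN t (w : R) : 0 < t ->
  is_derive w (1 : R) (fun w => - expR (- (t * w)) / t) (expR (- (t * w))).
Proof.
move=> t0; apply: is_derive_eq; rewrite /GRing.scale/=.
by field; rewrite gt_eqF.
Qed.

Lemma cvgy_expRN t : 0 < t -> expR (- (t * w)) @[w --> +oo%R] --> 0.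
Proof.
move=> t0; rewrite (_ : (fun w => _) = (fun z => expR (- z)) \o (fun z => t * z))//.
apply: (@cvg_comp _ _ _ _ _ _ (pinfty_nbhs R)); last exact: cvgr_expR.
exact: gt0_cvgMry.
Qed.

Lemma integral_expRN t : 0 < t ->
  (\int[mu]_(w in `[0%R, +oo[) (expR (- (t * w)))%:E = (t^-1)%:E)%E.
Proof.
move=> t0.
have dF w := is_derive_expRN w t0.
rewrite (@ge0_continuous_FTC2y _ _ (fun w => - expR (- (t * w)) / t) _ 0).
- by rewrite mulr0 oppr0 expR0 mulNr mul1r sub0e EFinN oppeK.
- by move=> w _; exact: expR_ge0.
- apply: continuous_subspaceT => w; apply: continuous_comp; last exact: continuous_expR.
  by apply: continuousN; apply: mulrl_continuous.
- rewrite -[X in _ --> X](_ : - 0 / t = 0); last by rewrite oppr0 mul0r.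
  by apply: cvgMl; apply: cvgN; exact: cvgy_expRN.
- by move=> w _; case: (dF w).
- by apply: cvg_at_right_filter; exact: is_derive1_continuous (dF 0).
- by move=> w _; rewrite derive1E; apply: derive_val.
Qed.

Lemma integrable_expRN t : 0 < t ->
  mu.-integrable `[0, +oo[ (EFin \o (fun w => expR (- (t * w)))).
Proof.
move=> t0; apply/integrableP; split.
  apply/measurable_EFinP; apply: measurable_funTS; apply: continuous_measurable_fun.
  move=> w; apply: continuous_comp; last exact: continuous_expR.
  by apply: continuousN; apply: mulrl_continuous.
under eq_integral do rewrite /= ger0_norm ?expR_ge0//.
by rewrite integral_expRN// ltry.
Qed.

Lemma continuous_cosM a : continuous (fun w : R => cos (a * w)).
Proof.
move=> w; apply: continuous_comp; first exact: mulrl_continuous.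
exact: continuous_cos.
Qed.

Lemma continuous_expRN t : continuous (fun w : R => expR (- (t * w))).
Proof.
move=> w; apply: continuous_comp; last exact: continuous_expR.
by apply: continuousN; apply: mulrl_continuous.
Qed.

Lemma integrable_expRN_cos t a : 0 < t ->
  mu.-integrable `[0, +oo[ (EFin \o (fun w => expR (- (t * w)) * cos (a * w))).
Proof.
move=> t0; apply: (le_integrable _ _ _ (integrable_expRN t0)) => //.
  apply/measurable_EFinP; apply: measurable_funTS; apply: continuous_measurable_fun.
  by move=> w; apply: cvgM; [exact: continuous_expRN|exact: continuous_cosM].
move=> w _ /=; rewrite lee_fin normrM ler_piMr//.
by rewrite ler_norml cos_geN1 cos_le1.
Qed.

(** Adding 1 makes the integrand nonnegative, as the fundamental theorem of
    calculus on a half-line requires; the integral of exp (- t w) is then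
    subtracted. *)
Lemma Rintegral_expRN_cos t a : 0 < t ->
  \int[mu]_(w in `[0, +oo[) (expR (- (t * w)) * cos (a * w)) =
  t / (t ^+ 2 + a ^+ 2).
Proof.
move=> t0; have ta : t ^+ 2 + a ^+ 2 != 0 by nra.
pose F w := laplace_cos_primitive t a w - expR (- (t * w)) / t.
have dF w : is_derive w (1 : R) F (expR (- (t * w)) * (1 + cos (a * w))).
  have -> : F = laplace_cos_primitive t a + (fun w : R => - expR (- (t * w)) / t).
    by apply/funext => z; rewrite fctE /F mulNr.
  have := is_deriveD (is_derive_laplace_cos_primitive a w t0) (is_derive_expRN w t0).
  by move=> h; apply: (is_derive_eq h); rewrite mulrDr mulr1 addrC.
have Fy : F w @[w --> +oo%R] --> 0.
  rewrite -(subr0 0).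
  apply: cvgB; last first.
    by rewrite -(mul0r t^-1); apply: cvgMl; exact: cvgy_expRN.
  rewrite -(mul0r (t ^+ 2 + a ^+ 2)^-1); apply: cvgMl.
  apply: (@squeeze_cvgr _ _ _ _ (fun w => - (expR (- (t * w)) * (`|a| + t)))
     (fun w => expR (- (t * w)) * (`|a| + t))).
  - near=> w; rewrite -ler_norml normrM ger0_norm ?expR_ge0// ler_wpM2l ?expR_ge0//.
    rewrite (le_trans (ler_normB _ _))// !normrM (gtr0_norm t0) lerD//.
      by rewrite ler_piMr// ler_norml sin_geN1 sin_le1.
    by rewrite ler_piMr ?(ltW t0)// ler_norml cos_geN1 cos_le1.
  - rewrite -[X in _ --> X](_ : - (0 * (`|a| + t)) = 0); last by rewrite mul0r oppr0.
    by apply: cvgN; apply: cvgMl; exact: cvgy_expRN.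
  - by rewrite -(mul0r (`|a| + t)); apply: cvgMl; exact: cvgy_expRN.
have I1 : \int[mu]_(w in `[0, +oo[) (expR (- (t * w)) * (1 + cos (a * w))) = - F 0.
  rewrite (@Rintegral_ge0_continuous_FTC2y _ _ F _ 0) ?sub0r//.
  - apply: continuous_subspaceT => w; apply: cvgM; first exact: continuous_expRN.
    by apply: cvgD; [exact: cvg_cst|exact: continuous_cosM].
  - by apply: cvg_at_right_filter; exact: is_derive1_continuous (dF 0).
  - by move=> w _; rewrite derive1E; apply: derive_val.
have I2 : \int[mu]_(w in `[0, +oo[) expR (- (t * w)) = t^-1.
  by rewrite /Rintegral integral_expRN.
have := I1; under eq_Rintegral do rewrite mulrDr mulr1.
rewrite RintegralD//; [|exact: integrable_expRN|exact: integrable_expRN_cos].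
rewrite I2 => /(congr1 (fun z => z - t^-1)); rewrite addrAC subrr add0r => ->.
rewrite /F /laplace_cos_primitive !mulr0 oppr0 expR0 sin0 cos0; field.
by rewrite ta gt_eqF.
Unshelve. all: by end_near. Qed.

End poisson_kernel.

Section poisson_approximation.
Context {R : realType}.
Implicit Types t x y s : R.
Notation mu := (@lebesgue_measure R).

(** Twice the Laplace transform at t of cos (2 pi s w); the factor 2 gives the
    kernel total mass 1. *)
Definition poisson t s : R := 2 * t / (t ^+ 2 + (2 * pi * s) ^+ 2).

Lemma poisson_ge0 t s : 0 <= t -> 0 <= poisson t s.
Proof. by move=> t0; rewrite divr_ge0 ?mulr_ge0// addr_ge0 ?sqr_ge0. Qed.

Lemma poisson_le t s : 0 < t -> poisson t s <= 2 / t.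
Proof.
move=> t0; rewrite /poisson (_ : 2 / t = 2 * t / t ^+ 2); last by field; rewrite gt_eqF.
rewrite ler_wpM2l ?mulr_ge0 ?(ltW t0)//.
by rewrite lef_pV2 ?posrE ?exprn_gt0 ?ltr_pwDl ?exprn_gt0 ?sqr_ge0// lerDl sqr_ge0.
Qed.

Lemma continuous_poisson t : 0 < t -> continuous (poisson t).
Proof.
move=> t0 s; apply: cvgMr; apply: cvgV; first by rewrite gt_eqF// ltr_wpDr ?sqr_ge0 ?exprn_gt0.
apply: cvgD; first exact: cvg_cst.
by apply: cvgM; exact: mulrl_continuous.
Qed.

Lemma continuous_poissonB t x : 0 < t -> continuous (fun y => poisson t (x - y)).
Proof.
move=> t0 y; apply: (@continuous_comp _ _ _ (fun y => x - y) (poisson t)).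
  by apply: cvgB; [exact: cvg_cst|exact: cvg_id].
exact: continuous_poisson.
Qed.

Lemma poisson_far t r s : 0 < t -> 0 < r -> r <= `|s| ->
  poisson t s <= 2 * t / (2 * pi * r) ^+ 2.
Proof.
move=> t0 r0 rs; rewrite ler_wpM2l ?mulr_ge0 ?(ltW t0)//.
have pir : 0 < 2 * pi * r by rewrite !mulr_gt0 ?pi_gt0.
rewrite lef_pV2 ?posrE ?exprn_gt0 ?ltr_pwDl ?exprn_gt0 ?sqr_ge0//.
rewrite -(real_normK (num_real (2 * pi * s))) -[leLHS]add0r lerD ?sqr_ge0//.
rewrite lerXn2r ?nnegrE ?(ltW pir)// normrM gtr0_norm ?mulr_gt0 ?pi_gt0//.
by rewrite ler_wpM2l// mulr_ge0 ?pi_ge0.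
Qed.

Definition poisson_primitive t s : R := atan (2 * pi / t * s) / pi.

Lemma is_derive_poisson_primitive t x (y : R) : 0 < t ->
  is_derive y (1 : R) (fun y => poisson_primitive t (y - x)) (poisson t (x - y)).
Proof.
move=> t0; have pi0 := @pi_gt0 R; rewrite /poisson_primitive /poisson.
apply: is_derive_eq; rewrite /GRing.scale/=; move: (@pi R) pi0 => p p0.
have D : 0 < t ^+ 2 + (2 * p * (x - y)) ^+ 2 by rewrite ltr_wpDr ?sqr_ge0 ?exprn_gt0.
by field; rewrite !gt_eqF.
Qed.

Lemma poisson_primitive_bound t s : `|poisson_primitive t s| <= 2^-1.
Proof.
rewrite /poisson_primitive normrM normfV (gtr0_norm (pi_gt0 R)) ler_pdivrMr ?pi_gt0//.
by rewrite ler_norml mulrC ltW ?atan_gtNpi2//= ltW// atan_ltpi2.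
Qed.

Lemma integral_poisson t x (L : R) : 0 < t -> 0 < L ->
  (\int[mu]_(y in `[(- L)%R, L]) (poisson t (x - y))%:E =
   (poisson_primitive t (L - x) - poisson_primitive t (- L - x))%:E)%E.
Proof.
move=> t0 L0.
have cF y : {for y, continuous (fun y => poisson_primitive t (y - x))}.
  exact: is_derive1_continuous (is_derive_poisson_primitive x y t0).
rewrite (@continuous_FTC2 _ _ (fun y => poisson_primitive t (y - x))) ?EFinB//.
- by rewrite -subr_gt0 opprK addr_gt0.
- exact/continuous_subspaceT/continuous_poissonB.
- split.
  + by move=> y _; case: (is_derive_poisson_primitive x y t0).
  + exact/cvg_at_right_filter/cF.
  + exact/cvg_at_left_filter/cF.
- move=> y _; rewrite derive1E; have ? := is_derive_poisson_primitive x y t0.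
  exact: derive_val.
Qed.

End poisson_approximation.

Section poisson_convolution.
Context {R : realType}.
Implicit Types t x y s : R.
Notation mu := (@lebesgue_measure R).
Variables (L : R) (L0 : 0 < L).
Let D : set R := `[(- L), L]%classic.

Let mD : measurable (D : set (measurableTypeR R)).
Proof. exact: measurable_itv. Qed.

Lemma integrable_indic_cc : mu.-integrable setT (EFin \o (\1_D : R -> R)).
Proof.
apply/integrableP; split; first exact/measurable_EFinP.
under eq_integral do rewrite /= ger0_norm//.
rewrite integral_indic// setIT.
suff : (mu `[(- L)%R, L] < +oo)%E by [].
by rewrite lebesgue_measure_itv/=; case: ifPn => _; rewrite ?ltry.
Qed.

Lemma integrable_supported (h : R -> R) M : measurable_fun setT h ->
  (forall x, `|h x| <= M * \1_D x) -> mu.-integrable setT (EFin \o h).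
Proof.
move=> mh hM.
apply: (le_integrable _ _ _ (integrableZl _ M integrable_indic_cc)) => //.
  exact/measurable_EFinP.
by move=> x _; rewrite lee_fin (le_trans (hM x))// ler_norm.
Qed.

Lemma bound_ge0 (h : R -> R) M : (forall x, `|h x| <= M * \1_D x) -> 0 <= M.
Proof.
move=> hM; have := hM 0; rewrite indicE mem_set ?mulr1; first exact: le_trans.
by rewrite /D/= in_itv/= oppr_le0 (ltW L0).
Qed.

Let mpoisson t x : 0 < t -> measurable_fun setT (fun y => poisson t (x - y)).
Proof. by move=> t0; apply: continuous_measurable_fun; exact: continuous_poissonB. Qed.

Lemma Rintegral_indic_poisson t x : 0 < t ->
  \int[mu]_y (\1_D y * poisson t (x - y)) =
  poisson_primitive t (L - x) - poisson_primitive t (- L - x).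
Proof.
move=> t0; rewrite -[RHS]/(fine _%:E) -integral_poisson// -/(Rintegral mu D _).
rewrite [RHS]Rintegral_mkcond; apply: eq_Rintegral => y _.
by rewrite patch_indic /= mulrC.
Qed.

Lemma Rintegral_indic_poisson_le1 t x : 0 < t ->
  \int[mu]_y (\1_D y * poisson t (x - y)) <= 1.
Proof.
move=> t0; rewrite Rintegral_indic_poisson// (le_trans (ler_norm _))//.
rewrite (le_trans (ler_normB _ _))// [1](_ : _ = 2^-1 + 2^-1); last by field.
by rewrite lerD// poisson_primitive_bound.
Qed.

Lemma integrable_mul_poisson (h : R -> R) M t x : 0 < t -> measurable_fun setT h ->
  (forall x, `|h x| <= M * \1_D x) ->
  mu.-integrable setT (EFin \o (fun y => h y * poisson t (x - y))).
Proof.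
move=> t0 mh hM; apply: (@integrable_supported _ (M * (2 / t))).
  by apply: measurable_funM => //; exact: mpoisson.
move=> y; rewrite normrM mulrAC ler_pM// ger0_norm ?poisson_le//.
by rewrite poisson_ge0// ltW.
Qed.

Definition poisson_conv t (h : R -> R) x := \int[mu]_y (h y * poisson t (x - y)).

Lemma poisson_conv_bound (h : R -> R) M t x : 0 < t -> measurable_fun setT h ->
  (forall x, `|h x| <= M * \1_D x) -> `|poisson_conv t h x| <= M.
Proof.
move=> t0 mh hM.
have M0 := bound_ge0 hM.
have i1 := integrable_mul_poisson x t0 mh hM.
have i2 : mu.-integrable setT (EFin \o (fun y => \1_D y * poisson t (x - y))).
  by apply: (@integrable_mul_poisson _ 1) => // y; rewrite mul1r ger0_norm.
rewrite (le_trans (le_normr_Rintegral measurableT i1))//.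
have -> : M = M * 1 by rewrite mulr1.
apply: (le_trans _ (ler_wpM2l M0 (Rintegral_indic_poisson_le1 x t0))).
rewrite -RintegralZl//; apply: le_Rintegral => //.
- exact: integrable_norm i1.
- exact: integrableZl i2.
- move=> y _; rewrite normrM (ger0_norm (poisson_ge0 _ _)) ?(ltW t0)// [leRHS]mulrA.
  by rewrite ler_wpM2r// poisson_ge0// ltW.
Qed.

(** Near x the continuity of h applies, away from x the kernel is O(t); inside
    the interval the kernel has asymptotically total mass 1. *)
Lemma cvg_poisson_conv (h : R -> R) M x : measurable_fun setT h ->
  (forall x, `|h x| <= M * \1_D x) -> - L < x < L -> {for x, continuous h} ->
  poisson_conv n.+1%:R^-1 h x @[n --> \oo] --> h x.
Proof.
move=> mh hM /andP[Lx xL] hx.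
have t0 n : 0 < n.+1%:R^-1 :> R by rewrite invr_gt0.
have M0 := bound_ge0 hM.
have i1 t : 0 < t -> mu.-integrable setT (EFin \o (fun y => \1_D y * poisson t (x - y))).
  by move=> t'; apply: (@integrable_mul_poisson _ 1) => // y; rewrite mul1r ger0_norm.
have hMM y : `|h y| <= M by rewrite (le_trans (hM y))// ler_piMr// indicE lern1 leq_b1.
have mass : \int[mu]_y (\1_D y * poisson n.+1%:R^-1 (x - y)) @[n --> \oo] --> (1 : R).
  have E a : 0 < a -> poisson_primitive n.+1%:R^-1 a @[n --> \oo] --> (2^-1 : R).
    move=> a0; rewrite (_ : 2^-1 = pi / 2 / pi); last by rewrite mulrAC divff ?mul1r // gt_eqF ?pi_gt0.
    apply: cvgMl; apply: (@cvg_comp _ _ _ _ _ _ (pinfty_nbhs R)); last exact: cvgy_atan.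
    rewrite (_ : (fun n => _) = (fun n => (2 * pi * a) * n.+1%:R)); last first.
      by apply/funext => n; rewrite invrK mulrAC.
    have p0 : 0 < 2 * pi * a by rewrite !mulr_gt0 ?pi_gt0.
    have cy : (n.+1%:R : R) @[n --> \oo] --> +oo.
      by have := @cvgr_idn R; rewrite -(cvg_shiftS (fun n => n%:R : R)).
    apply: (cvg_comp _ _ cy); exact: (gt0_cvgMry p0 cvg_id).
  rewrite (_ : (fun n => _) = (fun n => poisson_primitive n.+1%:R^-1 (L - x) -
      poisson_primitive n.+1%:R^-1 (- L - x))); last first.
    by apply/funext => n; rewrite Rintegral_indic_poisson.
  rewrite [X in _ --> X](_ : _ = 2^-1 - (- 2^-1)); last by field.
  apply: cvgB; first by apply: E; rewrite subr_gt0.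
  rewrite (_ : (fun n => _) = (fun n => - poisson_primitive n.+1%:R^-1 (L + x))).
    by apply: cvgN; apply: E; rewrite -(opprK L) addrC subr_gt0.
  by apply/funext => n; rewrite -opprD /poisson_primitive mulrN atanN mulNr.
have mass0 : h x * \int[mu]_y (\1_D y * poisson n.+1%:R^-1 (x - y)) @[n --> \oo] --> h x.
  by rewrite -[X in _ --> X]mulr1; apply: cvgMr.
rewrite -[X in _ --> X]add0r (_ : (fun n => _) = (fun n => (poisson_conv n.+1%:R^-1 h x -
    h x * \int[mu]_y (\1_D y * poisson n.+1%:R^-1 (x - y))) +
    h x * \int[mu]_y (\1_D y * poisson n.+1%:R^-1 (x - y)))); last first.
  by apply/funext => n; rewrite subrK.
apply: cvgD; last exact: mass0.
apply/cvgr0Pnorm_le => e e0.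
have [r /= r0 hr] : exists2 r : R, 0 < r & forall y, `|x - y| < r -> `|h x - h y| <= e / 2.
  have e20 : 0 < e / 2 by rewrite divr_gt0.
  have /cvgrPdist_le/(_ _ e20)/nbhs_ballP[r r0 hr] := hx.
  by exists r => // y xy; exact: hr.
pose C := 2 * M * (2 / (2 * pi * r) ^+ 2) * \int[mu]_y \1_D y.
have Cn : C * n.+1%:R^-1 @[n --> \oo] --> (0 : R).
  by rewrite -[X in _ --> X](mulr0 C); apply: cvgMr; exact: cvg_harmonic.
have /cvgr0Pnorm_le/(_ (e / 2) ltac:(by rewrite divr_gt0)) := Cn.
apply: filterS => n; set t := n.+1%:R^-1 => Ct.
have tn0 : 0 < t := t0 n.
have i2 := integrable_mul_poisson x tn0 mh hM.
rewrite /poisson_conv -RintegralZl//; last exact: i1.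
rewrite -RintegralB//; last exact: integrableZl (i1 _ tn0).
have i3 := integrableB measurableT i2 (integrableZl measurableT (h x) (i1 _ tn0)).
rewrite (le_trans (le_normr_Rintegral measurableT i3))//.
pose G y := (e / 2) * (\1_D y * poisson t (x - y)) +
   2 * M * (2 / (2 * pi * r) ^+ 2) * t * \1_D y.
have iG1 : mu.-integrable setT (EFin \o (fun y => e / 2 * (\1_D y * poisson t (x - y)))).
  exact: integrableZl (i1 _ tn0).
have iG2 : mu.-integrable setT (EFin \o
    (fun y => 2 * M * (2 / (2 * pi * r) ^+ 2) * t * \1_D y)).
  exact: integrableZl integrable_indic_cc.
apply: (@le_trans _ _ (\int[mu]_y G y)).
  apply: le_Rintegral => //; [exact: integrable_norm i3|exact: (integrableD measurableT iG1 iG2)|].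
  move=> y _.
  have -> : h y * poisson t (x - y) - h x * (\1_D y * poisson t (x - y)) =
      (h y - h x) * \1_D y * poisson t (x - y).
    have : h y = h y * \1_D y.
      rewrite indicE; case: (boolP (y \in D)) => /= yD; first by rewrite mulr1.
      by have := hM y; rewrite indicE (negbTE yD)/= mulr0 normr_le0 => /eqP ->; rewrite mul0r.
    by move=> {1}->; ring.
  have P0 : 0 <= poisson t (x - y) by rewrite poisson_ge0// ltW.
  have PF : r <= `|x - y| -> _ := poisson_far tn0 r0.
  have I0 : 0 <= \1_D y :> R by rewrite indicE.
  rewrite /G; move: (poisson t (x - y)) P0 PF (\1_D y) I0 => P P0 PF I I0.
  rewrite !normrM (ger0_norm P0) (ger0_norm I0).
  have [yr|yr] := ltP `|x - y| r.
    rewrite -[leLHS]addr0 lerD//.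
      by rewrite -mulrA ler_wpM2r ?mulr_ge0// distrC hr.
    by rewrite !mulr_ge0// ?(ltW tn0)// invr_ge0 sqr_ge0.
  rewrite -[leLHS]add0r lerD//; first by rewrite !mulr_ge0// ltW// invr_gt0.
  have hhM : `|h y - h x| <= 2 * M.
    by rewrite (le_trans (ler_normB _ _))// mulr2n mulrDl mul1r lerD.
  rewrite mulrAC ler_wpM2r// -[leRHS]mulrA ler_pM//.
  by rewrite -(mulrAC 2); exact: PF.
rewrite /G RintegralD// RintegralZl//; last exact: i1.
rewrite RintegralZl//; last exact: integrable_indic_cc.
rewrite [leRHS](splitr e) lerD//.
  by rewrite ler_piMr ?divr_ge0 ?(ltW e0)// Rintegral_indic_poisson_le1.
by rewrite (le_trans _ Ct)// (le_trans _ (ler_norm _))// /C mulrAC.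
Qed.

End poisson_convolution.

(** * Plancherel's identity on the line *)

Section plancherel_line.
Context {R : realType}.
Implicit Types t x y s w : R.
Notation mu := (@lebesgue_measure R).

Definition fcos (u : R -> R) w := \int[mu]_x (u x * cos (2 * pi * w * x)).
Definition fsin (u : R -> R) w := \int[mu]_x (u x * sin (2 * pi * w * x)).

Lemma measurable_phase (T : R -> R) : continuous T ->
  measurable_fun setT (fun z : measurableTypeR R * measurableTypeR R =>
    T (2 * pi * z.1 * z.2)).
Proof.
move=> cT; apply: (measurableT_comp (continuous_measurable_fun cT)).
by apply: measurable_funM => //; apply: measurable_funM.
Qed.

(** Makes the frequency integral absolutely convergent, which the energy of the
    transform is not yet known to be. *)
Definition damping t w : R := expR (- (t * w)) * \1_(`[0%R, +oo[%classic : set R) w.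

Lemma damping_ge0 t w : 0 <= damping t w.
Proof. by rewrite mulr_ge0 ?expR_ge0// indicE. Qed.

Lemma measurable_damping t : measurable_fun setT (damping t).
Proof.
apply: measurable_funM; first by apply: continuous_measurable_fun; exact: continuous_expRN.
by apply: measurable_indic; exact: measurable_itv.
Qed.

Lemma integrable_damping t : 0 < t -> mu.-integrable setT (EFin \o damping t).
Proof.
move=> t0; have := integrable_expRN t0.
rewrite (@integrable_mkcond _ (measurableTypeR R))//.
by apply: eq_integrable => // w _; rewrite restrict_EFin /= patch_indic.
Qed.

Section real_case.
Variables (L : R) (L0 : 0 < L).
Let D : set R := `[(- L), L]%classic.
Variables (u : R -> R) (M : R).
Hypotheses (mu_ : measurable_fun setT u) (uM : forall x, `|u x| <= M * \1_D x).

Let mD : measurable (D : set (measurableTypeR R)).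
Proof. exact: measurable_itv. Qed.

Let M0 : 0 <= M. Proof. exact: bound_ge0 uM. Qed.

Lemma measurable_mul_phase (T : R -> R) : continuous T ->
  measurable_fun setT (fun z : measurableTypeR R * measurableTypeR R =>
    u z.2 * T (2 * pi * z.1 * z.2)).
Proof.
move=> cT; apply: measurable_funM; last exact: measurable_phase.
exact: (measurableT_comp mu_).
Qed.

Lemma measurable_fcos : measurable_fun setT (fcos u).
Proof.
exact: (@measurable_Rintegral_param _ _ (measurableTypeR R) (measurableTypeR R) _ mu _
  (measurable_mul_phase (@continuous_cos R))).
Qed.

Lemma measurable_fsin : measurable_fun setT (fsin u).
Proof.
exact: (@measurable_Rintegral_param _ _ (measurableTypeR R) (measurableTypeR R) _ mu _
  (measurable_mul_phase (@continuous_sin R))).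
Qed.

Let mphase (T : R -> R) w : continuous T -> measurable_fun setT (fun x => T (2 * pi * w * x)).
Proof.
move=> cT; apply: continuous_measurable_fun => x.
apply: (@continuous_comp _ _ _ (fun x => 2 * pi * w * x) T); last exact: cT.
exact: mulrl_continuous.
Qed.

Lemma integrable_mul_phase (T : R -> R) w : continuous T -> (forall x, `|T x| <= 1) ->
  mu.-integrable setT (EFin \o (fun x => u x * T (2 * pi * w * x))).
Proof.
move=> cT T1; apply: (@integrable_supported _ L _ M).
  by apply: measurable_funM => //; exact: mphase.
by move=> x; rewrite normrM (le_trans _ (uM x))// ler_piMr.
Qed.

Let cos1 (x : R) := cos_le1N x.
Let sin1 (x : R) := sin_le1N x.

Let icos w := integrable_mul_phase w (@continuous_cos R) cos_le1N.
Let isin w := integrable_mul_phase w (@continuous_sin R) sin_le1N.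

Let mass := M * \int[mu]_x \1_D x.

Let transform_bound (T : R -> R) w : continuous T -> (forall x, `|T x| <= 1) ->
  `|\int[mu]_x (u x * T (2 * pi * w * x))| <= mass.
Proof.
move=> cT T1; have i := integrable_mul_phase w cT T1.
rewrite (le_trans (le_normr_Rintegral measurableT i))// /mass -RintegralZl//; last first.
  exact: integrable_indic_cc.
apply: le_Rintegral => //.
- exact: integrable_norm i.
- exact: integrableZl (@integrable_indic_cc _ L).
- by move=> x _; rewrite normrM (le_trans _ (uM x))// ler_piMr.
Qed.

Lemma fcos_bound w : `|fcos u w| <= mass.
Proof. exact: transform_bound (@continuous_cos R) cos_le1N. Qed.

Lemma fsin_bound w : `|fsin u w| <= mass.
Proof. exact: transform_bound (@continuous_sin R) sin_le1N. Qed.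

(** By the addition formula for cos, u (x) u (y) enters the energy only with
    the phase of x - y, so that integrating in w produces the Poisson kernel. *)
Let phase_difference w x : cos (2 * pi * w * x) * fcos u w + sin (2 * pi * w * x) * fsin u w =
  \int[mu]_y (u y * cos (2 * pi * (x - y) * w)).
Proof.
rewrite -RintegralZl// -RintegralZl// -RintegralD//; last 2 first.
- exact: integrableZl (icos w).
- exact: integrableZl (isin w).
apply: eq_Rintegral => y _.
rewrite (_ : 2 * pi * (x - y) * w = 2 * pi * w * x - 2 * pi * w * y); last by ring.
by rewrite cosB; ring.
Qed.

Let mphase_freq (T : R -> R) x : continuous T -> measurable_fun setT (fun w => T (2 * pi * w * x)).
Proof.
move=> cT; apply: continuous_measurable_fun => w.
apply: (@continuous_comp _ _ _ (fun w => 2 * pi * w * x) T); last exact: cT.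
by apply: cvgMl; exact: mulrl_continuous.
Qed.

Let measurable_mul_poisson t : 0 < t ->
  measurable_fun setT (fun z : measurableTypeR R * measurableTypeR R =>
    u z.2 * poisson t (z.1 - z.2)).
Proof.
move=> t0; apply: measurable_funM; first exact: (measurableT_comp mu_).
apply: (measurableT_comp (continuous_measurable_fun (continuous_poisson t0))).
exact: measurable_funB.
Qed.

Lemma measurable_poisson_conv t : 0 < t -> measurable_fun setT (poisson_conv t u).
Proof.
move=> t0; exact: (@measurable_Rintegral_param _ _ (measurableTypeR R) (measurableTypeR R)
  _ mu _ (measurable_mul_poisson t0)).
Qed.

Let damped_inner t x : 0 < t ->
  \int[mu]_w (damping t w * (cos (2 * pi * w * x) * fcos u w + sin (2 * pi * w * x) * fsin u w))
  = 2^-1 * poisson_conv t u x.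
Proof.
move=> t0.
have igm : mu.-integrable setT (EFin \o (fun y => M * \1_D y)).
  exact: integrableZl (@integrable_indic_cc _ L).
pose F (z : measurableTypeR R * measurableTypeR R) := damping t z.1 * (u z.2 * cos (2 * pi * (x - z.2) * z.1)).
have mF : measurable_fun setT F.
  apply: measurable_funM; first exact: (measurableT_comp (measurable_damping t)).
  apply: measurable_funM; first exact: (measurableT_comp mu_).
  apply: (measurableT_comp (continuous_measurable_fun (@continuous_cos R))).
  apply: measurable_funM => //; apply: measurable_funM => //.
  exact: measurable_funB.
have Fg w y : `|F (w, y)| <= damping t w * (M * \1_D y).
  rewrite /F /= normrM (ger0_norm (damping_ge0 _ _)) ler_wpM2l ?damping_ge0// normrM.
  by rewrite (le_trans _ (uM y))// ler_piMr.
transitivity (\int[mu]_w \int[mu]_y F (w, y)).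
  apply: eq_Rintegral => w _; rewrite phase_difference -RintegralZl//.
  apply: (@integrable_supported _ L _ M).
    apply: measurable_funM => //; apply: continuous_measurable_fun => y.
    apply: (@continuous_comp _ _ _ (fun y => 2 * pi * (x - y) * w) cos); last exact: continuous_cos.
    by apply: cvgMl; apply: cvgMr; apply: cvgB; [exact: cvg_cst|exact: cvg_id].
  by move=> y; rewrite normrM (le_trans _ (uM y))// ler_piMr.
rewrite (dominated_fubini mF (integrable_damping t0) igm Fg).
rewrite /poisson_conv -RintegralZl//; last exact: (integrable_mul_poisson _ t0 mu_ uM).
apply: eq_Rintegral => y _.
rewrite /F /= (_ : (fun w => _) = (fun w => u y *
    ((fun w => expR (- (t * w)) * cos (2 * pi * (x - y) * w)) \_ `[0%R, +oo[) w)); last first.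
  by apply/funext => w; rewrite patch_indic /= /damping; ring.
rewrite RintegralZl//; last first.
  have := integrable_expRN_cos (2 * pi * (x - y)) t0.
  rewrite (@integrable_mkcond _ (measurableTypeR R))//.
  by apply: eq_integrable => // w _; rewrite restrict_EFin.
by rewrite -Rintegral_mkcond Rintegral_expRN_cos// /poisson -(mulrA 2 t) (mulrCA (u y) 2) mulKf.
Qed.

Lemma damped_energy t : 0 < t ->
  \int[mu]_w (damping t w * (fcos u w ^+ 2 + fsin u w ^+ 2)) =
  2^-1 * \int[mu]_x (u x * poisson_conv t u x).
Proof.
move=> t0.
have mass0 : 0 <= mass by exact: le_trans (fcos_bound 0).
have igm : mu.-integrable setT (EFin \o (fun y => (mass + mass) * (M * \1_D y))).
  exact: (integrableZl measurableT _ (integrableZl measurableT _ (@integrable_indic_cc _ L))).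
pose F (z : measurableTypeR R * measurableTypeR R) := damping t z.1 * (u z.2 *
  (cos (2 * pi * z.1 * z.2) * fcos u z.1 + sin (2 * pi * z.1 * z.2) * fsin u z.1)).
have mF : measurable_fun setT F.
  apply: measurable_funM; first exact: (measurableT_comp (measurable_damping t)).
  apply: measurable_funM; first exact: (measurableT_comp mu_).
  apply: measurable_funD; apply: measurable_funM.
  - exact: measurable_phase (@continuous_cos R).
  - exact: (measurableT_comp measurable_fcos).
  - exact: measurable_phase (@continuous_sin R).
  - exact: (measurableT_comp measurable_fsin).
have Fg w x : `|F (w, x)| <= damping t w * ((mass + mass) * (M * \1_D x)).
  rewrite /F /= normrM (ger0_norm (damping_ge0 _ _)) ler_wpM2l ?damping_ge0// normrM mulrC.
  rewrite ler_pM// (le_trans (ler_normD _ _))// lerD// normrM.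
    by rewrite (le_trans _ (fcos_bound w))// ler_piMl.
  by rewrite (le_trans _ (fsin_bound w))// ler_piMl.
transitivity (\int[mu]_w \int[mu]_x F (w, x)).
  apply: eq_Rintegral => w _.
  rewrite /F/= [RHS]RintegralZl//.
    congr (_ * _).
    rewrite [RHS](_ : _ = \int[mu]_x (fcos u w * (u x * cos (2 * pi * w * x)) +
        fsin u w * (u x * sin (2 * pi * w * x)))); last first.
      by apply: eq_Rintegral => x _; ring.
    rewrite RintegralD//; [|exact: integrableZl (icos w)|exact: integrableZl (isin w)].
    by rewrite !RintegralZl.
  rewrite (_ : (fun x => _) = (fun x => fcos u w * (u x * cos (2 * pi * w * x)) +
        fsin u w * (u x * sin (2 * pi * w * x)))); last by apply/funext => x; ring.
  exact: integrableD (integrableZl _ _ (icos w)) (integrableZl _ _ (isin w)).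
rewrite (dominated_fubini mF (integrable_damping t0) igm Fg) -RintegralZl//; last first.
  apply: (@integrable_supported _ L _ (M * M)).
    by apply: measurable_funM => //; exact: measurable_poisson_conv.
  move=> x; rewrite normrM mulrAC ler_pM//; exact: (poisson_conv_bound L0).
apply: eq_Rintegral => x _; rewrite mulrCA -damped_inner// -RintegralZl//.
  by apply: eq_Rintegral => w _; rewrite /F /=; ring.
apply: (le_integrable _ _ _ (integrableZl measurableT (mass + mass) (integrable_damping t0))) => //.
  apply/measurable_EFinP; apply: measurable_funM; [exact: measurable_damping|apply: measurable_funD].
    by apply: measurable_funM; [exact: (@mphase_freq cos x (@continuous_cos R))|exact: measurable_fcos].
  by apply: measurable_funM; [exact: (@mphase_freq sin x (@continuous_sin R))|exact: measurable_fsin].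
move=> w _; rewrite lee_fin [leLHS]normrM [leRHS]normrM (ger0_norm (damping_ge0 _ _)) mulrC ler_wpM2r ?damping_ge0//.
rewrite (ger0_norm (addr_ge0 mass0 mass0)) (le_trans (ler_normD _ _))// lerD// normrM.
  by rewrite (le_trans _ (fcos_bound w))// ler_piMl.
by rewrite (le_trans _ (fsin_bound w))// ler_piMl.
Qed.

(** The kernel is even. *)
Lemma Rintegral_poisson_conv_sym (k : R -> R) t Mk : 0 < t -> measurable_fun setT k ->
  (forall x, `|k x| <= Mk * \1_D x) ->
  \int[mu]_x (k x * poisson_conv t u x) = \int[mu]_x (u x * poisson_conv t k x).
Proof.
move=> t0 mk kM.
have igk : mu.-integrable setT (EFin \o (fun y => Mk * \1_D y)).
  exact: (integrableZl measurableT _ (@integrable_indic_cc _ L)).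
have igm : mu.-integrable setT (EFin \o (fun y => (M * (2 / t)) * \1_D y)).
  exact: (integrableZl measurableT _ (@integrable_indic_cc _ L)).
pose F (z : measurableTypeR R * measurableTypeR R) :=
  k z.1 * (u z.2 * poisson t (z.1 - z.2)).
have mF : measurable_fun setT F.
  apply: measurable_funM; first exact: (measurableT_comp mk).
  exact: measurable_mul_poisson.
have Fg x y : `|F (x, y)| <= Mk * \1_D x * ((M * (2 / t)) * \1_D y).
  rewrite /F /= normrM ler_pM// normrM [leRHS]mulrAC ler_pM//.
  by rewrite ger0_norm ?poisson_ge0 ?(ltW t0)// poisson_le.
transitivity (\int[mu]_x \int[mu]_y F (x, y)).
  apply: eq_Rintegral => x _; rewrite /F /= RintegralZl//.
  exact: integrable_mul_poisson uM.
rewrite (dominated_fubini mF igk igm Fg).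
apply: eq_Rintegral => y _.
rewrite /poisson_conv -RintegralZl//; last exact: integrable_mul_poisson kM.
apply: eq_Rintegral => x _; rewrite /F /= mulrCA; congr (_ * (_ * _)).
by rewrite /poisson -(opprB x y) mulrN sqrrN.
Qed.

End real_case.
End plancherel_line.

Section poisson_energy.
Context {R : realType}.
Implicit Types t x y s w : R.
Notation mu := (@lebesgue_measure R).
Variables (L : R) (L0 : 0 < L).
Let D : set R := `[(- L), L]%classic.
Variables (u : R -> R) (M : R).
Hypotheses (mu_ : measurable_fun setT u) (uM : forall x, `|u x| <= M * \1_D x).
Hypothesis usupp : forall x, u x != 0 -> - L < x < L.

Let M0 : 0 <= M. Proof. exact: bound_ge0 uM. Qed.

Let uMM x : `|u x| <= M.
Proof. by rewrite (le_trans (uM x))// ler_piMr// indicE lern1 leq_b1. Qed.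

Let continuous_approx (e : R) : 0 < e -> exists (h : R -> R) (G : R), [/\ measurable_fun setT h,
  forall x, `|h x| <= G * \1_D x, forall x, - L < x < L -> {for x, continuous h} &
  \int[mu]_x `|u x - h x| < e].
Proof.
move=> e0.
have mD : measurable (D : set (measurableTypeR R)) by exact: measurable_itv.
have fD : (mu D < +oo)%E.
  suff : (mu `[(- L)%R, L] < +oo)%E by [].
  by rewrite lebesgue_measure_itv/=; case: ifPn => _; rewrite ?ltry.
have iu : mu.-integrable D (EFin \o u).
  exact: (integrableS measurableT mD (@subsetT _ _) (integrable_supported mu_ uM)).
have [g_ [cg ig cvg]] := approximation_continuous_integrable mD fD iu.
have [g [{}cg {}ig gE]] : exists g, [/\ continuous g, mu.-integrable D (EFin \o g) &
    \int[mu]_(x in D) `|u x - g x| < e].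
  have /fine_cvgP[_ /cvgr0Pnorm_lt/(_ _ e0)[k _ /(_ _ (leqnn _))]] := cvg.
  by move=> /(le_lt_trans (ler_norm _)) kE; exists (g_ k).
have [G gG] : exists G, forall x, D x -> `|g x| <= G.
  have : compact (g @` D).
    apply: continuous_compact; last exact: segment_compact.
    exact: continuous_subspaceT.
  move=> /compact_bounded[G [_ GP]]; exists (G + 1) => x Dx.
  by apply: (GP (G + 1)); [rewrite ltrDl|exists x].
exists (g \_ D), G; split.
- apply/(measurable_restrictT _ mD); apply: measurable_funTS; exact: continuous_measurable_fun.
- move=> x; rewrite patchE indicE; case: ifPn => [/set_mem/gG|]; first by rewrite mulr1.
  by rewrite normr0 mulr0.
- move=> x xL; rewrite /prop_for/= /continuous_at patchE mem_set; last first.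
    by rewrite /D/= in_itv/=; case/andP: xL => /ltW -> /ltW ->.
  apply: (cvg_trans _ (cg x)); apply: near_eq_cvg.
  have : \forall y \near x, y \in `]- L, L[ by exact: near_in_itvoo.
  apply: filterS => y; rewrite in_itv/= => /andP[yL1 yL2].
  by rewrite patchE mem_set// /D/= in_itv/= !ltW.
- rewrite (le_lt_trans _ gE)// le_eqVlt; apply/orP; left; apply/eqP.
  rewrite [RHS]Rintegral_mkcond; apply: eq_Rintegral => x _.
  rewrite !patchE; case: ifPn => // xD; have := uM x; rewrite indicE (negbTE xD) mulr0.
  by rewrite normr_le0 => /eqP ->; rewrite subrr normr0.
Qed.

(** The Poisson means are controlled only at points of continuity. So u is
    replaced by h, continuous inside the interval and close to u in L^1; the
    symmetry of the kernel moves the error k = u - h away from the convolution,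
    whose values are bounded. *)
Lemma cvg_poisson_energy :
  \int[mu]_x (u x * poisson_conv n.+1%:R^-1 u x) @[n --> \oo] --> \int[mu]_x (u x ^+ 2).
Proof.
have t0 n : 0 < n.+1%:R^-1 :> R by rewrite invr_gt0.
apply/cvgrPdist_le => e e0.
pose eta := e / (3 * (M + 1)).
have eta0 : 0 < eta by rewrite divr_gt0// mulr_gt0// ltr_pwDr.
have [h [G [mh hG ch uh]]] := continuous_approx eta0.
have G0 : 0 <= G by exact: bound_ge0 hG.
have hGG x : `|h x| <= G by rewrite (le_trans (hG x))// ler_piMr// indicE lern1 leq_b1.
pose k x := u x - h x.
have mk : measurable_fun setT k by exact: measurable_funB.
have kM x : `|k x| <= (M + G) * \1_D x.
  by rewrite /k (le_trans (ler_normB _ _))// mulrDl lerD.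
have ik := integrable_supported mk kM.
have iuP (v : R -> R) (Mv : R) n : measurable_fun setT v -> (forall x, `|v x| <= Mv * \1_D x) ->
    mu.-integrable setT (EFin \o (fun x => u x * poisson_conv n.+1%:R^-1 v x)).
  move=> mv vM; apply: (@integrable_supported _ L _ (M * Mv)).
    by apply: measurable_funM => //; exact: measurable_poisson_conv.
  by move=> x; rewrite normrM mulrAC ler_pM//; exact: (poisson_conv_bound L0).
have iuv (v : R -> R) (Mv : R) : measurable_fun setT v -> (forall x, `|v x| <= Mv) ->
    mu.-integrable setT (EFin \o (fun x => u x * v x)).
  move=> mv vM; apply: (@integrable_supported _ L _ (M * Mv)).
    exact: measurable_funM.
  by move=> x; rewrite normrM mulrAC ler_pM.
have small (v : R -> R) : measurable_fun setT v -> (forall x, `|v x| <= M) ->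
    `|\int[mu]_x (k x * v x)| <= e / 3.
  move=> mv vM.
  have ikv : mu.-integrable setT (EFin \o (fun x => k x * v x)).
    apply: (@integrable_supported _ L _ ((M + G) * M)).
      exact: measurable_funM.
    by move=> x; rewrite normrM mulrAC ler_pM.
  rewrite (le_trans (le_normr_Rintegral measurableT ikv))//.
  apply: (@le_trans _ _ (M * \int[mu]_x `|k x|)).
    rewrite -RintegralZl//; last exact: integrable_norm ik.
    apply: le_Rintegral => //; first exact: integrable_norm ikv.
      exact: (integrableZl measurableT _ (integrable_norm ik)).
    by move=> x _; rewrite normrM mulrC ler_wpM2r.
  rewrite (le_trans (ler_wpM2l M0 (ltW uh)))// /eta mulrA.
  rewrite ler_pdivrMr ?mulr_gt0 ?ltr_pwDr// mulrA divfK// mulrC.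
  by rewrite ler_wpM2l ?(ltW e0)// lerDl.
have mid : \int[mu]_x (u x * poisson_conv n.+1%:R^-1 h x) @[n --> \oo] -->
    \int[mu]_x (u x * h x).
  apply: (@Rdominated_convergence _ (measurableTypeR R) _ mu
    (fun n x => u x * poisson_conv n.+1%:R^-1 h x) (fun x => u x * h x) (fun x => M * G * \1_D x)).
  - by move=> n; apply: measurable_funM => //; exact: measurable_poisson_conv.
  - exact: measurable_funM.
  - apply: aeW => x; have [->|ux] := eqVneq (u x) 0.
      rewrite mul0r (_ : (fun n => _) = (fun=> 0)); first exact: cvg_cst.
      by apply/funext => n; rewrite mul0r.
    apply: cvgMr; apply: (cvg_poisson_conv L0 mh hG); first exact: usupp.
    by apply: ch; exact: usupp.
  - exact: (integrableZl measurableT _ (@integrable_indic_cc _ L)).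
  - by move=> n x; rewrite normrM mulrAC ler_pM//; exact: (poisson_conv_bound L0).
have e30 : 0 < e / 3 by rewrite divr_gt0.
have /cvgrPdist_le/(_ _ e30) := mid.
apply: filterS => n; set t := n.+1%:R^-1 => mn.
have tn0 : 0 < t := t0 n.
have -> : \int[mu]_x (u x ^+ 2) = \int[mu]_x (u x * h x) + \int[mu]_x (k x * u x).
  rewrite -RintegralD//.
  - by apply: eq_Rintegral => x _; rewrite /k; ring.
  - exact: (@iuv _ G).
  - apply: eq_integrable (iuv k (M + G) mk _) => //.
      by move=> x _ /=; rewrite mulrC.
    by move=> x; rewrite (le_trans (kM x))// ler_piMr ?addr_ge0// indicE lern1 leq_b1.
have -> : \int[mu]_x (u x * poisson_conv t u x) =
    \int[mu]_x (u x * poisson_conv t h x) + \int[mu]_x (k x * poisson_conv t u x).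
  rewrite (Rintegral_poisson_conv_sym mu_ uM tn0 mk kM) -RintegralD//; last 2 first.
  - exact: (iuP _ G).
  - exact: (iuP _ (M + G)).
  apply: eq_Rintegral => x _; rewrite -mulrDr; congr (_ * _).
  rewrite /poisson_conv -RintegralD//; last 2 first.
  - exact: integrable_mul_poisson hG.
  - exact: integrable_mul_poisson kM.
  by apply: eq_Rintegral => y _; rewrite /k; ring.
rewrite opprD addrACA (le_trans (ler_normD _ _))// [leRHS](_ : e = e / 3 + (e / 3 + e / 3)); last by field.
rewrite lerD// (le_trans (ler_normB _ _))// lerD// small//.
  exact: measurable_poisson_conv.
by move=> x; exact: (poisson_conv_bound L0).
Qed.

End poisson_energy.

Section plancherel_half_line.
Context {R : realType}.
Implicit Types t x y s w : R.
Notation mu := (@lebesgue_measure R).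
Variables (L : R) (L0 : 0 < L).
Let D : set R := `[(- L), L]%classic.
Variables (u : R -> R) (M : R).
Hypotheses (mu_ : measurable_fun setT u) (uM : forall x, `|u x| <= M * \1_D x).
Hypothesis usupp : forall x, u x != 0 -> - L < x < L.

(** Let t tend to 0 in the damped energy: it increases to the energy by
    monotone convergence, while the Poisson form tends to the square norm. *)
Lemma plancherel_half_line :
  (\int[mu]_(w in `[0%R, +oo[) (fcos u w ^+ 2 + fsin u w ^+ 2)%:E =
   (2^-1 * \int[mu]_x (u x ^+ 2))%:E)%E.
Proof.
pose En w := fcos u w ^+ 2 + fsin u w ^+ 2.
have mEn : measurable_fun setT En.
  by apply: measurable_funD; apply: measurable_funX;
    [exact: measurable_fcos|exact: measurable_fsin].
have En0 w : 0 <= En w by rewrite addr_ge0 ?sqr_ge0.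
have t0 n : 0 < n.+1%:R^-1 :> R by rewrite invr_gt0.
pose B := M * \int[mu]_x \1_D x.
have EnB w : `|En w| <= B ^+ 2 + B ^+ 2.
  have fB := fcos_bound mu_ uM w; have gB := fsin_bound mu_ uM w.
  rewrite ger0_norm// /En -(real_normK (num_real (fcos u w))).
  rewrite -(real_normK (num_real (fsin u w))).
  by rewrite lerD// lerXn2r ?nnegrE//; exact: le_trans fB.
pose g n w := (damping n.+1%:R^-1 w * En w)%:E.
have ig n : mu.-integrable setT (g n).
  apply: (le_integrable _ _ _ (integrableZl measurableT (B ^+ 2 + B ^+ 2) (integrable_damping (t0 n)))) => //.
    by apply/measurable_EFinP; apply: measurable_funM => //; exact: measurable_damping.
  move=> w _; rewrite lee_fin [leLHS]normrM [leRHS]normrM mulrC ler_wpM2r//.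
  by rewrite (le_trans (EnB w))// ler_norm.
have lim_g : (\int[mu]_w g n w)%E @[n --> \oo] --> (2^-1 * \int[mu]_x (u x ^+ 2))%:E.
  rewrite (_ : (fun n => _) = (fun n => (2^-1 * \int[mu]_x (u x * poisson_conv n.+1%:R^-1 u x))%:E)).
    apply: cvg_EFin; first exact: nearW.
    by apply: cvgMr; exact: (cvg_poisson_energy L0).
  apply/funext => n; rewrite -(damped_energy L0 mu_ uM (t0 n)) /Rintegral fineK//.
  exact: integrable_fin_num (ig n).
have mono : (\int[mu]_w g n w)%E @[n --> \oo] -->
    (\int[mu]_w (limn (g ^~ w)))%E.
  apply: cvg_monotone_convergence => //.
  - by move=> n; case/integrableP: (ig n).
  - by move=> n w _; rewrite lee_fin mulr_ge0// damping_ge0.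
  - move=> w _ n m nm; rewrite lee_fin ler_wpM2r// /damping.
    rewrite indicE; case: (boolP (w \in _)) => /= [/set_mem|]; last by rewrite !mulr0.
    rewrite /= in_itv/= andbT => w0; rewrite !mulr1 ler_expR lerN2 ler_wpM2r//.
    by rewrite lef_pV2 ?posrE// ler_nat.
rewrite -(cvg_unique _ mono lim_g)//.
rewrite integral_mkcond; apply: eq_integral => w _; apply/esym.
apply/cvg_lim => //.
rewrite (_ : patch _ _ _ _ = (\1_`[0%R, +oo[%classic w * En w)%:E)%E; last first.
  by rewrite patchE indicE; case: ifPn => _; rewrite ?mul1r ?mul0r.
apply: cvg_EFin; first exact: nearW.
apply: cvgMl; rewrite -[X in _ --> X]mul1r; apply: cvgMl.
have c0 : - (n.+1%:R^-1 * w) @[n --> \oo] --> (0 : R).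
  by rewrite -[X in _ --> X]oppr0 -(mul0r w); apply: cvgN; apply: cvgMl; exact: cvg_harmonic.
rewrite -[X in _ --> X](@expR0 R).
by apply: (@cvg_comp _ _ _ _ expR _ (nbhs (0 : R))); [exact: c0|exact: continuous_expR].
Qed.

End plancherel_half_line.

Section plancherel_1d.
Context {R : realType}.
Implicit Types t x y s w : R.
Notation mu := (@lebesgue_measure R).

Lemma fcosN (u : R -> R) w : fcos u (- w) = fcos u w.
Proof. by apply: eq_Rintegral => x _; rewrite mulrN mulNr cosN. Qed.

Lemma fsinN (u : R -> R) w : mu.-integrable setT (EFin \o (fun x => u x * sin (2 * pi * w * x))) ->
  fsin u (- w) = - fsin u w.
Proof.
move=> iu; rewrite -[RHS]mulN1r /fsin -RintegralZl//; apply: eq_Rintegral => x _.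
by rewrite mulrN mulNr sinN mulrN mulN1r.
Qed.

Variables (L : R) (L0 : 0 < L).
Let D : set R := `[(- L), L]%classic.
Variables (u v : R -> R) (M : R).
Hypotheses (mu_ : measurable_fun setT u) (uM : forall x, `|u x| <= M * \1_D x).
Hypotheses (mv_ : measurable_fun setT v) (vM : forall x, `|v x| <= M * \1_D x).

Let M0 : 0 <= M. Proof. exact: bound_ge0 uM. Qed.

(** fcos is even and fsin is odd in the frequency, so the cross terms of the
    energy of u + i v at w and - w cancel, leaving twice the half-line
    energies. *)
Lemma plancherel_1d :
  (\int[mu]_w ((fcos u w + fsin v w) ^+ 2 + (fcos v w - fsin u w) ^+ 2)%:E =
   (\int[mu]_x (u x ^+ 2 + v x ^+ 2))%:E)%E.
Proof.
(* A larger interval, as the half-line identity needs the support in its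
    interior. *)
have L10 : 0 < L + 1 by rewrite addr_gt0.
have enlarge (h : R -> R) : (forall x, `|h x| <= M * \1_D x) ->
    (forall x, `|h x| <= M * \1_(`[(- (L + 1)), L + 1]%classic) x) /\
    (forall x, h x != 0 -> - (L + 1) < x < L + 1).
  move=> hM; have h0 x : h x != 0 -> - (L + 1) < x < L + 1.
    have := hM x; rewrite indicE; case: (boolP (x \in D)) => [/set_mem|_]; last first.
      by rewrite mulr0 normr_le0 => ->.
    rewrite /D/= in_itv/= => /andP[x1 x2] _ _.
    by rewrite (lt_le_trans _ x1) ?ltrN2 ?ltrDl//= (le_lt_trans x2)// ltrDl.
  split=> // x; have [hx|/h0/andP[x1 x2]] := eqVneq (h x) 0.
    by rewrite hx normr0 mulr_ge0// indicE.
  rewrite indicE mem_set ?mulr1; last by rewrite /= in_itv/= !ltW.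
  by rewrite (le_trans (hM x))// ler_piMr// indicE lern1 leq_b1.
have [uM1 us] := enlarge _ uM; have [vM1 vs] := enlarge _ vM.
have Pu := plancherel_half_line L10 mu_ uM1 us.
have Pv := plancherel_half_line L10 mv_ vM1 vs.
have iu w := integrable_mul_phase mu_ uM w (@continuous_sin R) sin_le1N.
have iv w := integrable_mul_phase mv_ vM w (@continuous_sin R) sin_le1N.
pose f w := (fcos u w + fsin v w) ^+ 2 + (fcos v w - fsin u w) ^+ 2.
have f0 w : 0 <= f w by rewrite addr_ge0 ?sqr_ge0.
have mf : measurable_fun setT f.
  apply: measurable_funD; apply: measurable_funX;
    [apply: measurable_funD|apply: measurable_funB];
    by [exact: measurable_fcos|exact: measurable_fsin].
have mE (h : R -> R) : measurable_fun setT h ->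
   measurable_fun (`[0%R, +oo[ : set (measurableTypeR R)) (fun w => (h w)%:E).
  by move=> mh; apply: measurable_funTS; exact/measurable_EFinP.
have sq (h : R -> R) : measurable_fun setT h ->
   measurable_fun setT (fun w => fcos h w ^+ 2 + fsin h w ^+ 2).
  by move=> mh; apply: measurable_funD; apply: measurable_funX;
    [exact: measurable_fcos|exact: measurable_fsin].
have half : (\int[mu]_w (f w)%:E = \int[mu]_(w in `[0%R, +oo[) ((f w)%:E + (f (- w))%:E))%E.
  rewrite ge0_integralD//; last 4 first.
  - by move=> w _; rewrite lee_fin.
  - exact: mE.
  - by move=> w _; rewrite lee_fin.
  - by apply: mE; exact: (measurableT_comp mf).
  have -> : (\int[mu]_(w in `[0%R, +oo[) (f (- w))%:E = \int[mu]_(w in `]-oo, 0%R]) (f w)%:E)%E.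
    rewrite (@ge0_integration_by_substitution0 _ (fun w => (f (- w))%:E)).
    - by apply: eq_integral => w _; rewrite opprK.
    - by apply/measurable_EFinP; exact: (measurableT_comp mf).
    - by move=> w; rewrite lee_fin.
  rewrite -(@integral_itv_obnd_cbnd _ (0 : R) +oo%O); last first.
    by apply: measurable_funTS; exact/measurable_EFinP.
  rewrite -ge0_integral_setU//.
  - congr (integral _ _ _); apply/seteqP; split => // w _ /=.
    by rewrite !in_itv/= andbT; case: (ltP 0 w) => /=; [left|right].
  - by apply: measurable_funTS; exact/measurable_EFinP.
  - by move=> w _; rewrite lee_fin.
  - apply/disj_setPS => w [] /=; rewrite !in_itv/= andbT => w1 w2.
    by move: (lt_le_trans w1 w2); rewrite ltxx.
rewrite -/f half.
transitivity (\int[mu]_(w in `[0%R, +oo[) ((2 * (fcos u w ^+ 2 + fsin u w ^+ 2))%:E +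
    (2 * (fcos v w ^+ 2 + fsin v w ^+ 2))%:E))%E.
  apply: eq_integral => w _; rewrite -!EFinD; congr EFin; rewrite /f !fcosN !fsinN//.
  by ring.
rewrite ge0_integralD//; last 4 first.
- by move=> w _; rewrite lee_fin mulr_ge0// addr_ge0 ?sqr_ge0.
- by apply: mE; apply: measurable_funM => //; exact: sq.
- by move=> w _; rewrite lee_fin mulr_ge0// addr_ge0 ?sqr_ge0.
- by apply: mE; apply: measurable_funM => //; exact: sq.
under eq_integral do rewrite EFinM.
under [X in (_ + X)%E]eq_integral do rewrite EFinM.
rewrite !ge0_integralZl//; last 4 first.
- by apply: mE; exact: sq.
- by move=> w _; rewrite lee_fin addr_ge0 ?sqr_ge0.
- by apply: mE; exact: sq.
- by move=> w _; rewrite lee_fin addr_ge0 ?sqr_ge0.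
rewrite Pu Pv -!EFinM -EFinD; congr EFin.
have isq (h : R -> R) : measurable_fun setT h -> (forall x, `|h x| <= M * \1_D x) ->
    mu.-integrable setT (EFin \o (fun x => h x ^+ 2)).
  move=> mh hM; apply: (@integrable_supported _ L _ (M * M)).
    exact: measurable_funX.
  move=> x; rewrite expr2 normrM mulrAC ler_pM// (le_trans (hM x))// ler_piMr//.
rewrite RintegralD//; [by field|exact: isq|exact: isq].
Qed.

End plancherel_1d.

(** * Plancherel's identity in R^n for bounded functions on a cube *)

Section rv_integral.
Context {R : realType}.
Notation mu := (@lebesgue_measure R).
Notation leb := (@lebesgue_rv R).

Lemma rv_cons0 n (a : R) (x : 'rV[R]_n) : rv_cons (a, x) ord0 ord0 = a.
Proof.
rewrite /rv_cons/=; have -> : ord0 = lshift n ord0 :> 'I_(1 + n) by exact/val_inj.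
by rewrite (@row_mxEl _ 1 1 n) mxE eqxx.
Qed.

Lemma rv_cons_lift n (a : R) (x : 'rV[R]_n) (i : 'I_n) :
  rv_cons (a, x) ord0 (lift ord0 i) = x ord0 i.
Proof.
rewrite /rv_cons/=; have -> : lift ord0 i = rshift 1 i :> 'I_(1 + n) by exact/val_inj.
by rewrite (@row_mxEr _ 1 1 n).
Qed.

Lemma dot_rv_cons n (a b : R) (x y : 'rV[R]_n) :
  dot (rv_cons (a, x)) (rv_cons (b, y)) = a * b + dot x y.
Proof.
rewrite /dot big_ord_recl !rv_cons0; congr (_ + _).
by apply: eq_bigr => i _; rewrite !rv_cons_lift.
Qed.

Lemma ge0_integral_rv_cons n (f : 'rV[R]_n.+1 -> \bar R) :
  measurable_fun setT f -> (forall x, (0 <= f x)%E) ->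
  (\int[leb n.+1]_x f x = \int[(mu \x leb n)]_p f (rv_cons p))%E.
Proof.
move=> mf f0; rewrite /= /lebesgue_rv_step ge0_integral_pushforward//=.
exact: measurable_rv_cons.
Qed.

Lemma Rintegral_rv_cons n (f : 'rV[R]_n.+1 -> R) :
  measurable_fun setT f ->
  \int[leb n.+1]_x f x = \int[(mu \x leb n)%E]_p f (rv_cons p).
Proof.
move=> mf; rewrite /Rintegral; congr fine; rewrite integralE [RHS]integralE.
have mE : measurable_fun setT (fun x => (f x)%:E) by exact/measurable_EFinP.
rewrite !ge0_integral_rv_cons//; [|exact: measurable_funeneg|exact: measurable_funepos].
by congr (_ - _)%E; apply: eq_integral => p _; rewrite ?funeposE ?funenegE.
Qed.

Lemma measurable_rv (d' : measure_display) (T : measurableType d') n (h : T -> 'rV[R]_n) :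
  (forall i, measurable_fun setT (fun t => h t ord0 i : measurableTypeR R)) -> measurable_fun setT h.
Proof.
move=> mh _ Y mY; rewrite setTI.
pose G := [set A | measurable (h @^-1` A)].
suff: measurable `<=` G by exact.
apply: smallest_sub.
  split.
  - by rewrite /G/= preimage_set0.
  - by move=> A; rewrite /G/= setTD preimage_setC; exact: measurableC.
  - by move=> F mF; rewrite /G/= preimage_bigcup; exact: bigcupT_measurable.
move=> A; rewrite -bigcup_seq/= => -[i _ [B mB <-{A}]].
rewrite /G/= setTI -comp_preimage -[X in measurable X]setTI.
exact: mh.
Qed.

Lemma measurable_dot (d' : measure_display) (T : measurableType d') n (g h : T -> 'rV[R]_n) :
  measurable_fun setT g -> measurable_fun setT h ->
  measurable_fun setT (fun t => dot (g t) (h t)).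
Proof.
move=> mg mh; apply: measurable_sum => i; apply: measurable_funM.
  exact: (measurableT_comp (measurable_rv_coord i) mg).
exact: (measurableT_comp (measurable_rv_coord i) mh).
Qed.

(** The indicator of the cube [-L, L]^n, as a product so that it factors along
    the decomposition R^(n+1) = R x R^n. *)
Definition box_indic (L : R) n (x : 'rV[R]_n) : R :=
  \prod_(i < n) \1_(`[(- L), L]%classic) (x ord0 i).

Lemma box_indic_ge0 L n (x : 'rV[R]_n) : 0 <= box_indic L x.
Proof. by apply: prodr_ge0 => i _; rewrite indicE. Qed.

Lemma box_indic_cons L n (a : R) (x : 'rV[R]_n) :
  box_indic L (rv_cons (a, x)) = \1_(`[(- L), L]%classic) a * box_indic L x.
Proof.
rewrite /box_indic big_ord_recl rv_cons0; congr (_ * _).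
by apply: eq_bigr => i _; rewrite rv_cons_lift.
Qed.

Lemma measurable_box_indic L n : measurable_fun setT (@box_indic L n).
Proof.
apply: measurable_prod => i _; apply: (measurableT_comp _ (measurable_rv_coord i)).
by apply: measurable_indic; exact: measurable_itv.
Qed.

Lemma integrable_box_indic L n : (leb n).-integrable setT (EFin \o @box_indic L n).
Proof.
elim: n => [|n IH].
  apply: (@measurable_bounded_integrable _ _ _ (leb 0) _ setT) => //=.
  - by rewrite diracT ltry.
  - exact: measurable_box_indic.
  - exists 1; split => // x x1 y _ /=; rewrite /box_indic big_ord0 normr1 ltW//.
have mE : measurable_fun setT (fun x : 'rV[R]_n.+1 => (box_indic L x)%:E).
  by apply/measurable_EFinP; exact: measurable_box_indic.
apply/integrableP; split => //.
under eq_integral do rewrite /= ger0_norm ?box_indic_ge0//.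
rewrite ge0_integral_rv_cons//; last by move=> x; rewrite lee_fin box_indic_ge0.
have i1 := @integrable_indic_cc _ L.
pose F (p : measurableTypeR R * 'rV[R]_n) := box_indic L (rv_cons p).
have mF : measurable_fun setT F.
  exact: (measurableT_comp (@measurable_box_indic L n.+1) (@measurable_rv_cons _ n)).
have Fg x y : `|F (x, y)| <= \1_(`[(- L), L]%classic) x * box_indic L y.
  by rewrite /F box_indic_cons ger0_norm// mulr_ge0 ?box_indic_ge0// indicE.
have /integrableP[_] := dominated_integrable_prod mF i1 IH Fg.
by under eq_integral do rewrite /= ger0_norm ?box_indic_ge0//.
Qed.

End rv_integral.

Section plancherel_boxed.
Context {R : realType}.
Notation mu := (@lebesgue_measure R).
Notation leb := (@lebesgue_rv R).

(** The real part of the Fourier transform of u + i v; its imaginary part is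
    the same expression with (v, - u) for (u, v). *)
Definition fre n (u v : 'rV[R]_n -> R) (w : 'rV[R]_n) : R :=
  \int[leb n]_x (u x * cos (2 * pi * dot w x) + v x * sin (2 * pi * dot w x)).

Lemma measurable_trig_dot d' (T : measurableType d') n (h : R -> R) (f g : T -> 'rV[R]_n) :
  continuous h -> measurable_fun setT f -> measurable_fun setT g ->
  measurable_fun setT (fun t => h (2 * pi * dot (f t) (g t))).
Proof.
move=> ch mf mg; apply: (measurableT_comp (continuous_measurable_fun ch)).
by apply: measurable_funM => //; exact: measurable_dot.
Qed.

Lemma measurable_fre n (u v : 'rV[R]_n -> R) :
  measurable_fun setT u -> measurable_fun setT v -> measurable_fun setT (fre u v).
Proof.
move=> mu_ mv_.
pose F (z : 'rV[R]_n * 'rV[R]_n) :=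
  u z.2 * cos (2 * pi * dot z.1 z.2) + v z.2 * sin (2 * pi * dot z.1 z.2).
apply: (@measurable_Rintegral_param _ _ _ _ _ (leb n) F).
apply: measurable_funD; apply: measurable_funM.
- exact: (measurableT_comp mu_).
- exact: (measurable_trig_dot (@continuous_cos R)).
- exact: (measurableT_comp mv_).
- exact: (measurable_trig_dot (@continuous_sin R)).
Qed.

Lemma fsinNl (h : R -> R) s : mu.-integrable setT (EFin \o (fun x => h x * sin (2 * pi * s * x))) ->
  fsin (\- h) s = - fsin h s.
Proof.
move=> ih; rewrite -[RHS]mulN1r /fsin -RintegralZl//; apply: eq_Rintegral => x _.
by rewrite mulNr mulN1r.
Qed.

Lemma fcosNl (h : R -> R) s : mu.-integrable setT (EFin \o (fun x => h x * cos (2 * pi * s * x))) ->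
  fcos (\- h) s = - fcos h s.
Proof.
move=> ih; rewrite -[RHS]mulN1r /fcos -RintegralZl//; apply: eq_Rintegral => x _.
by rewrite mulNr mulN1r.
Qed.

(** Induction on n. For fixed remaining variables the identity on the line
    handles the first variable; the partial transforms A and B are again
    bounded and supported in the cube, so the induction hypothesis handles the
    others. *)
Theorem plancherel_boxed n (L M : R) (u v : 'rV[R]_n -> R) : 0 < L ->
  measurable_fun setT u -> measurable_fun setT v ->
  (forall x, `|u x| <= M * box_indic L x) -> (forall x, `|v x| <= M * box_indic L x) ->
  (\int[leb n]_w (fre u v w ^+ 2 + fre v (\- u) w ^+ 2)%:E =
   \int[leb n]_x (u x ^+ 2 + v x ^+ 2)%:E)%E.
Proof.
move=> L0; elim: n M u v => [|n IH] M u v mu_ mv_ uM vM.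
  have fE (p q : 'rV[R]_0 -> R) w : measurable_fun setT p -> measurable_fun setT q -> fre p q w = p 0.
    move=> mp mq; rewrite /fre /Rintegral integral_dirac//.
      by rewrite diracT mul1e /= /dot big_ord0 mulr0 cos0 sin0 mulr1 mulr0 addr0.
    apply/measurable_EFinP; apply: measurable_funD; apply: measurable_funM => //.
      exact: (measurable_trig_dot (@continuous_cos R)).
    exact: (measurable_trig_dot (@continuous_sin R)).
  have mNu : measurable_fun setT (\- u) by exact: measurable_funN.
  rewrite !integral_dirac//; last 2 first.
  - by apply/measurable_EFinP; apply: measurable_funD; exact: measurable_funX.
  - apply/measurable_EFinP; apply: measurable_funD; apply: measurable_funX; exact: measurable_fre.
  by rewrite !fE.
pose D : set R := `[(- L), L]%classic.
pose U (x' : 'rV[R]_n) a := u (rv_cons (a, x')).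
pose V (x' : 'rV[R]_n) a := v (rv_cons (a, x')).
have mcons (x' : 'rV[R]_n) : measurable_fun setT (fun a : measurableTypeR R => rv_cons (a, x')).
  by apply: (measurableT_comp (@measurable_rv_cons _ n)); exact: measurable_fun_pair.
have mU x' : measurable_fun setT (U x') by exact: (measurableT_comp mu_ (mcons x')).
have mV x' : measurable_fun setT (V x') by exact: (measurableT_comp mv_ (mcons x')).
have UM x' a : `|U x' a| <= (M * box_indic L x') * \1_D a.
  by rewrite (le_trans (uM _))// box_indic_cons mulrA mulrAC.
have VM x' a : `|V x' a| <= (M * box_indic L x') * \1_D a.
  by rewrite (le_trans (vM _))// box_indic_cons mulrA mulrAC.
pose A (s : R) (x' : 'rV[R]_n) := fcos (U x') s + fsin (V x') s.
pose B (s : R) (x' : 'rV[R]_n) := fcos (V x') s - fsin (U x') s.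
pose m1 := \int[mu]_x \1_D x.
have mjoint (h : R -> R) (w : 'rV[R]_n.+1 -> R) : continuous h -> measurable_fun setT w ->
    measurable_fun setT (fun z : measurableTypeR R * 'rV[R]_n =>
      \int[mu]_a (w (rv_cons (a, z.2)) * h (2 * pi * z.1 * a))).
  move=> ch mw.
  apply: (@measurable_Rintegral_param _ _ _ (measurableTypeR R) _ mu
    (fun q : (measurableTypeR R * 'rV[R]_n) * measurableTypeR R =>
      w (rv_cons (q.2, q.1.2)) * h (2 * pi * q.1.1 * q.2))).
  apply: measurable_funM.
    apply: (measurableT_comp mw); apply: (measurableT_comp (@measurable_rv_cons _ n)).
    by apply: measurable_fun_pair => //; exact: measurableT_comp.
  apply: (measurableT_comp (continuous_measurable_fun ch)).
  by apply: measurable_funM => //; apply: measurable_funM => //; exact: measurableT_comp.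
have mA2 : measurable_fun setT (fun z : measurableTypeR R * 'rV[R]_n => A z.1 z.2).
  by apply: measurable_funD;
    [exact: (mjoint _ _ (@continuous_cos R))|exact: (mjoint _ _ (@continuous_sin R))].
have mB2 : measurable_fun setT (fun z : measurableTypeR R * 'rV[R]_n => B z.1 z.2).
  by apply: measurable_funB;
    [exact: (mjoint _ _ (@continuous_cos R))|exact: (mjoint _ _ (@continuous_sin R))].
have mA s : measurable_fun setT (A s) by exact: (measurable_section1 mA2 s).
have mB s : measurable_fun setT (B s) by exact: (measurable_section1 mB2 s).
pose M' := M * m1 + M * m1.
have AM s x' : `|A s x'| <= M' * box_indic L x'.
  rewrite (le_trans (ler_normD _ _))// /M' mulrDl (mulrAC M m1) lerD//.
    exact: (fcos_bound (mU x') (UM x')).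
  exact: (fsin_bound (mV x') (VM x')).
have BM s x' : `|B s x'| <= M' * box_indic L x'.
  rewrite (le_trans (ler_normB _ _))// /M' mulrDl (mulrAC M m1) lerD//.
    exact: (fcos_bound (mV x') (VM x')).
  exact: (fsin_bound (mU x') (UM x')).
have igM : (leb n).-integrable setT (EFin \o (fun x => (M + M) * box_indic L x)).
  exact: (integrableZl measurableT _ (@integrable_box_indic _ L n)).
(* The transform is a partial transform in the first variable, followed by a
   transform in the others. *)
have split_transform (p q : 'rV[R]_n.+1 -> R) s (w' : 'rV[R]_n) :
   measurable_fun setT p -> measurable_fun setT q ->
   (forall x, `|p x| <= M * box_indic L x) -> (forall x, `|q x| <= M * box_indic L x) ->
   fre p q (rv_cons (s, w')) =
   fre (fun x' => fcos (fun a => p (rv_cons (a, x'))) s + fsin (fun a => q (rv_cons (a, x'))) s)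
       (fun x' => fcos (fun a => q (rv_cons (a, x'))) s - fsin (fun a => p (rv_cons (a, x'))) s) w'.
  move=> mp mq pM qM.
  have ph x' a : `|p (rv_cons (a, x'))| <= (M * box_indic L x') * \1_D a.
    by rewrite (le_trans (pM _))// box_indic_cons mulrA mulrAC.
  have qh x' a : `|q (rv_cons (a, x'))| <= (M * box_indic L x') * \1_D a.
    by rewrite (le_trans (qM _))// box_indic_cons mulrA mulrAC.
  have mph x' := measurableT_comp mp (mcons x').
  have mqh x' := measurableT_comp mq (mcons x').
  pose G x := p x * cos (2 * pi * dot (rv_cons (s, w')) x) + q x * sin (2 * pi * dot (rv_cons (s, w')) x).
  have mG : measurable_fun setT G.
    apply: measurable_funD; apply: measurable_funM => //.
      exact: (measurable_trig_dot (@continuous_cos R)).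
    exact: (measurable_trig_dot (@continuous_sin R)).
  pose F (z : measurableTypeR R * 'rV[R]_n) := G (rv_cons z).
  have mF : measurable_fun setT F by exact: (measurableT_comp mG (@measurable_rv_cons _ n)).
  have Fg a x' : `|F (a, x')| <= \1_D a * ((M + M) * box_indic L x').
    rewrite /F /G (le_trans (ler_normD _ _))// [leRHS]mulrC !mulrDl lerD// normrM.
      by rewrite (le_trans _ (ph x' a))// ler_piMr// cos_le1N.
    by rewrite (le_trans _ (qh x' a))// ler_piMr// sin_le1N.
  rewrite {1}/fre Rintegral_rv_cons// -/G -(dominated_fubini12 mF (@integrable_indic_cc _ L) igM Fg).
  rewrite (dominated_fubini mF (@integrable_indic_cc _ L) igM Fg).
  apply: eq_Rintegral => x' _.
  have ipc := integrable_mul_phase (mph x') (ph x') s (@continuous_cos R) cos_le1N.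
  have ips := integrable_mul_phase (mph x') (ph x') s (@continuous_sin R) sin_le1N.
  have iqc := integrable_mul_phase (mqh x') (qh x') s (@continuous_cos R) cos_le1N.
  have iqs := integrable_mul_phase (mqh x') (qh x') s (@continuous_sin R) sin_le1N.
  rewrite /fcos /fsin -RintegralD// -RintegralB// -!RintegralZr//; last 2 first.
  - exact: (integrableB measurableT iqc ips).
  - exact: (integrableD measurableT ipc iqs).
  rewrite -RintegralD//; last 2 first.
  - exact: (integrableZr measurableT _ (integrableD measurableT ipc iqs)).
  - exact: (integrableZr measurableT _ (integrableB measurableT iqc ips)).
  apply: eq_Rintegral => a _; rewrite /F /G dot_rv_cons mulrDr mulrA cosD sinD /=.
  by ring.
have mNu : measurable_fun setT (\- u) by exact: measurable_funN.
have NuM x : `|(\- u) x| <= M * box_indic L x by rewrite normrN.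
pose H w := fre u v w ^+ 2 + fre v (\- u) w ^+ 2.
have mH : measurable_fun setT H.
  by apply: measurable_funD; apply: measurable_funX; exact: measurable_fre.
have mHc : measurable_fun setT (fun z => (H (rv_cons z))%:E).
  by apply/measurable_EFinP; exact: (measurableT_comp mH (@measurable_rv_cons _ n)).
rewrite ge0_integral_rv_cons//; last 2 first.
- exact/measurable_EFinP.
- by move=> w; rewrite lee_fin addr_ge0 ?sqr_ge0.
rewrite (fubini_tonelli1 (fun z => (H (rv_cons z))%:E))//; last first.
  by move=> w; rewrite lee_fin addr_ge0 ?sqr_ge0.
transitivity (\int[mu]_s \int[leb n]_x' (A s x' ^+ 2 + B s x' ^+ 2)%:E)%E.
  apply: eq_integral => s _; rewrite -(IH M')//.
  apply: eq_integral => w' _; rewrite /H /= !split_transform//.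
  congr (EFin (_ + _ ^+ 2)).
  apply: eq_Rintegral => x' _; congr (_ * _ + _ * _).
  - rewrite /B; congr (_ + _).
    exact: (fsinNl (integrable_mul_phase (mU x') (UM x') s (@continuous_sin R) sin_le1N)).
  - rewrite /= /A opprD; congr (_ - _).
    exact: (fcosNl (integrable_mul_phase (mU x') (UM x') s (@continuous_cos R) cos_le1N)).
rewrite (fubini_tonelli (fun z : measurableTypeR R * _ => (A z.1 z.2 ^+ 2 + B z.1 z.2 ^+ 2)%:E)); last 2 first.
- by apply/measurable_EFinP; apply: measurable_funD; exact: measurable_funX.
- by move=> w; rewrite lee_fin addr_ge0 ?sqr_ge0.
have mK : measurable_fun setT (fun x : 'rV[R]_n.+1 => (u x ^+ 2 + v x ^+ 2)%:E).
  by apply/measurable_EFinP; apply: measurable_funD; exact: measurable_funX.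
have mKc : measurable_fun setT (fun z => (u (rv_cons z) ^+ 2 + v (rv_cons z) ^+ 2)%:E).
  exact: (measurableT_comp mK (@measurable_rv_cons _ n)).
rewrite ge0_integral_rv_cons//; last first.
  by move=> w; rewrite lee_fin addr_ge0 ?sqr_ge0.
rewrite (fubini_tonelli2 (fun z => (u (rv_cons z) ^+ 2 + v (rv_cons z) ^+ 2)%:E))//; last first.
  by move=> w; rewrite lee_fin addr_ge0 ?sqr_ge0.
apply: eq_integral => x' _.
rewrite (plancherel_1d L0 (mU x') (UM x') (mV x') (VM x')) /Rintegral fineK//.
apply: integrable_fin_num => //.
have sq (h : R -> R) : measurable_fun setT h -> (forall a, `|h a| <= (M * box_indic L x') * \1_D a) ->
    mu.-integrable setT (EFin \o (fun a => h a ^+ 2)).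
  move=> mh hM; apply: (@integrable_supported _ L _ ((M * box_indic L x') * (M * box_indic L x'))).
    exact: measurable_funX.
  have I1 a : \1_D a <= 1 :> R by rewrite indicE lern1 leq_b1.
  have I0 a : 0 <= \1_D a :> R by rewrite indicE.
  move=> a; have := hM a; rewrite expr2 normrM.
  move: `|h a| (normr_ge0 (h a)) (M * box_indic L x') (\1_D a) (I1 a) (I0 a) => z z0 b i i1 i0 zb.
  rewrite (le_trans (ler_pM z0 z0 zb zb))// mulrACA ler_wpM2l -?expr2 ?sqr_ge0//.
  by rewrite expr2 ler_piMr.
exact: (integrableD measurableT (sq _ (mU x') (UM x')) (sq _ (mV x') (VM x'))).
Qed.

End plancherel_boxed.

(** * Borel sets of R^n *)

Section rv_topology.
Context {R : realType} {n : nat}.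
Implicit Types x y : 'rV[R]_n.

Lemma ball_rvP x e y : 0 < e -> ball x e y <-> forall i, `|x ord0 i - y ord0 i| < e.
Proof.
move=> e0; split=> [[_ xy] i|xy]; first exact: xy.
by split=> // i j; rewrite (ord1 i); exact: xy.
Qed.

Lemma coord_le_norm x i : `|x ord0 i| <= `|x|.
Proof. by rewrite [leRHS]/Num.norm /= mx_normrE; apply/bigmax_geP; right => /=; exists (ord0, i). Qed.

Lemma measurable_rv_ball x e : 0 < e -> measurable (ball x e).
Proof.
move=> e0; rewrite (_ : ball x e = \bigcap_(i in [set: 'I_n])
    ((fun y => y ord0 i : measurableTypeR R) @^-1` `](x ord0 i - e), (x ord0 i + e)[)).
  apply: fin_bigcap_measurable => // i _; rewrite -[X in measurable X]setTI.
  by apply: (measurable_rv_coord i) => //; exact: measurable_itv.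
apply/seteqP; split=> [y /(ball_rvP _ _ e0) xy i _ /=|y xy].
  by rewrite in_itv/=; have := xy i; rewrite ltr_distlC.
apply/(ball_rvP _ _ e0) => i.
by have := xy i I; rewrite /= in_itv/= ltr_distlC.
Qed.

(** Balls of the max norm are boxes, hence measurable, and an open set is a
    countable union of balls with rational centres. *)
Lemma open_measurable_rv (A : set 'rV[R]_n) : open A -> measurable A.
Proof.
move=> oA.
pose c (q : 'rV[rat]_n) : 'rV[R]_n := map_mx ratr q.
pose P (qk : 'rV[rat]_n * nat) := ball (c qk.1) qk.2.+1%:R^-1 `<=` A.
rewrite (_ : A = \bigcup_qk (if pselect (P qk) then ball (c qk.1) qk.2.+1%:R^-1 else set0)).
  apply: countable_bigcupT_measurable; first exact: countableP.
  move=> qk; case: pselect => [Pqk|nP] /=; last exact: measurable0.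
  by apply: measurable_rv_ball; rewrite invr_gt0.
apply/seteqP; split=> [x Ax|x [qk _]]; last by case: pselect => [Pqk|//]; exact: Pqk.
have /nbhs_ballP[e /= e0 xeA] := open_nbhs_nbhs (conj oA Ax).
have [k ke] : exists k : nat, k.+1%:R^-1 < e / 2.
  have e2 : 0 < e / 2 by rewrite divr_gt0.
  have /cvgr0Pnorm_lt/(_ _ e2)[k _ /(_ _ (leqnn k))] := @cvg_harmonic R.
  by rewrite /harmonic/= ger0_norm ?invr_ge0//; exists k.
have k0 : 0 < k.+1%:R^-1 :> R by rewrite invr_gt0.
have near_q i : exists q : rat, `|ratr q - x ord0 i| < k.+1%:R^-1.
  have /rat_in_itvoo[q] : x ord0 i - k.+1%:R^-1 < x ord0 i + k.+1%:R^-1.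
    by rewrite ltrD2l gtrN.
  by rewrite in_itv/= => qi; exists q; rewrite ltr_distl.
have /choice[q qP] := near_q.
exists ((\row_i q i), k) => //.
have xb : ball (c (\row_i q i)) k.+1%:R^-1 x.
  by apply/(ball_rvP _ _ k0) => i; rewrite !mxE.
case: pselect => // -[] y yb; apply: xeA.
apply: (@le_ball _ _ _ (k.+1%:R^-1 + k.+1%:R^-1)); first by rewrite (splitr e) ltW// ltrD.
by apply: ball_triangle yb; exact: ball_sym.
Qed.

Lemma closed_measurable_rv (A : set 'rV[R]_n) : closed A -> measurable A.
Proof.
by move=> cA; rewrite -(setCK A); apply: measurableC; apply: open_measurable_rv; exact: closed_openC.
Qed.

Lemma continuous_measurable_rv (f : 'rV[R]_n -> R) : continuous f -> measurable_fun setT f.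
Proof.
move=> /continuousP cf; apply: (measurability _ (RGenOpens.measurableE R)).
move=> _ [_ [a [b ->] <-]]; rewrite setTI; apply: open_measurable_rv.
exact/cf/interval_open.
Qed.

Lemma compact_measurable_rv (E : set 'rV[R]_n) : compact E -> measurable E.
Proof. by move=> cE; apply: closed_measurable_rv; exact: compact_closed (@norm_hausdorff _ _) cE. Qed.

Lemma compact_sub_box (E : set 'rV[R]_n) : compact E ->
  exists2 L : R, 0 < L & forall x, E x -> box_indic L x = 1.
Proof.
move=> /compact_bounded[M [_ ME]].
exists (`|M| + 1); first by rewrite ltr_pwDr.
move=> x Ex; rewrite /box_indic big1// => i _; rewrite indicE mem_set//=.
rewrite in_itv/= -ler_norml (le_trans (coord_le_norm x i))//.
by apply: ME Ex; rewrite (le_lt_trans (ler_norm M))// ltrDl.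
Qed.

End rv_topology.

(** * Plancherel's identity for square-integrable functions on a cube *)

Section fatou_bound.
Context d (T : measurableType d) (R : realType) (mu : {measure set T -> \bar R}).

Lemma fatou_bound (f_ : nat -> T -> R) (f : T -> R) (B : \bar R) :
  (forall n, measurable_fun setT (f_ n)) -> (forall n x, 0 <= f_ n x) ->
  (forall x, f_ n x @[n --> \oo] --> f x) ->
  (forall n, (\int[mu]_x (f_ n x)%:E <= B)%E) -> (\int[mu]_x (f x)%:E <= B)%E.
Proof.
move=> mf f0 ff fB.
have mE n : measurable_fun setT (fun x => (f_ n x)%:E) by exact/measurable_EFinP.
have := fatou mu measurableT mE (fun n x _ => _ : (0 <= (f_ n x)%:E)%E).
rewrite (_ : (\int[mu]_x limn_einf _)%E = (\int[mu]_x (f x)%:E)%E); last first.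
  apply: eq_integral => x _; have : (f_ n x)%:E @[n --> \oo] --> (f x)%:E.
    by apply: cvg_EFin; [exact: nearW|exact: ff].
  by move=> /cvg_limn_einf_sup[].
move=> H; apply: (le_trans (H _)); first by move=> n x; rewrite lee_fin.
rewrite limn_einf_lim; apply: lime_le; first exact: is_cvg_einfs.
by apply: nearW => n; apply: (le_trans _ (fB n)); apply: ereal_inf_lbound; exists n => /=.
Qed.

End fatou_bound.

Section plancherel_l2.
Context {R : realType} {n : nat}.
Notation leb := (@lebesgue_rv R n).
Variables (L : R) (L0 : 0 < L).
Implicit Types (u v : 'rV[R]_n -> R).

Definition box_supported u := forall x, u x != 0 -> box_indic L x = 1.

(** The squared modulus of the Fourier transform of u + i v. *)
Definition fenergy u v w := fre u v w ^+ 2 + fre v (\- u) w ^+ 2.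

Lemma fenergy_ge0 u v w : 0 <= fenergy u v w.
Proof. by rewrite addr_ge0 ?sqr_ge0. Qed.

Lemma measurable_fenergy u v : measurable_fun setT u -> measurable_fun setT v ->
  measurable_fun setT (fenergy u v).
Proof.
move=> mu_ mv_; have mNu : measurable_fun setT (\- u) by exact: measurable_funN.
by apply: measurable_funD; apply: measurable_funX; exact: measurable_fre.
Qed.

(** Large values are sent to 0 instead of k, so that z and 2 clip z - z have
    the same modulus. *)
Definition clip (k z : R) : R := z * \1_(`[(- k), k]%classic) z.

Lemma measurable_clip k u : measurable_fun setT u -> measurable_fun setT (clip k \o u).
Proof.
move=> mu_; apply: measurableT_comp => //; apply: measurable_funM => //.
Qed.

Lemma clip_bound k z : 0 <= k -> `|clip k z| <= k.
Proof.
move=> k0; rewrite /clip indicE; case: (boolP (z \in _)) => [/set_mem|_].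
  by rewrite /= in_itv/= mulr1 ler_norml.
by rewrite mulr0 normr0.
Qed.

Lemma clip_id k z : `|z| <= k -> clip k z = z.
Proof. by move=> zk; rewrite /clip indicE mem_set ?mulr1//= in_itv/= -ler_norml. Qed.

Lemma clip_le k z : `|clip k z| <= `|z|.
Proof. by rewrite /clip normrM ler_piMr// indicE; case: (_ \in _); rewrite ?normr1 ?normr0. Qed.

Lemma clip_residual_le k z : `|z - clip k z| <= `|z|.
Proof.
rewrite /clip indicE; case: (_ \in _) => /=; rewrite ?mulr1 ?mulr0 ?subrr ?subr0//.
by rewrite normr0.
Qed.

Lemma cvg_clip z : clip k%:R z @[k --> \oo] --> z.
Proof.
apply: cvg_near_cst.
near=> k; rewrite clip_id//; near: k; exact: nbhs_infty_ger.
Unshelve. all: by end_near. Qed.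

Lemma integrable_of_sqr u : measurable_fun setT u -> box_supported u ->
  leb.-integrable setT (EFin \o (fun x => u x ^+ 2)) -> leb.-integrable setT (EFin \o u).
Proof.
move=> mu_ su iu.
apply: (le_integrable _ _ _ (integrableD measurableT (@integrable_box_indic R L n) iu)) => //.
  exact/measurable_EFinP.
move=> x _; rewrite /= lee_fin [leRHS]ger0_norm ?addr_ge0 ?sqr_ge0 ?box_indic_ge0//.
have [->|/su ->] := eqVneq (u x) 0; first by rewrite normr0 addr_ge0 ?sqr_ge0 ?box_indic_ge0.
by rewrite -(real_normK (num_real (u x))); nra.
Qed.

Lemma integrable_fre u v w : leb.-integrable setT (EFin \o u) -> leb.-integrable setT (EFin \o v) ->
  leb.-integrable setT (EFin \o (fun x => u x * cos (2 * pi * dot w x) + v x * sin (2 * pi * dot w x))).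
Proof.
have T (h : 'rV[R]_n -> R) (c : R -> R) : continuous c -> (forall x, `|c x| <= 1) ->
    leb.-integrable setT (EFin \o h) -> leb.-integrable setT (EFin \o (fun x => h x * c (2 * pi * dot w x))).
  move=> cc c1 ih; apply: (le_integrable _ _ _ ih) => //.
    apply/measurable_EFinP; apply: measurable_funM; first by case/integrableP: ih => /measurable_EFinP.
    exact: measurable_trig_dot.
  by move=> x _; rewrite lee_fin normrM ler_piMr.
move=> iu iv; apply: (integrableD measurableT (T _ cos _ _ iu) (T _ sin _ _ iv)) => //.
- exact: continuous_cos.
- exact: cos_le1N.
- exact: continuous_sin.
- exact: sin_le1N.
Qed.

Lemma integrable_opp u : leb.-integrable setT (EFin \o u) -> leb.-integrable setT (EFin \o (\- u)).
Proof. by move=> iu; apply: eq_integrable (integrableN iu) => // x _. Qed.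

Lemma freD u1 v1 u2 v2 w :
  leb.-integrable setT (EFin \o u1) -> leb.-integrable setT (EFin \o v1) ->
  leb.-integrable setT (EFin \o u2) -> leb.-integrable setT (EFin \o v2) ->
  fre (u1 \+ u2) (v1 \+ v2) w = fre u1 v1 w + fre u2 v2 w.
Proof.
move=> iu1 iv1 iu2 iv2; rewrite /fre -RintegralD//; last 2 first.
- exact: integrable_fre.
- exact: integrable_fre.
by apply: eq_Rintegral => x _ /=; ring.
Qed.

Section main.
Variables (u v : 'rV[R]_n -> R).
Hypotheses (mu_ : measurable_fun setT u) (mv_ : measurable_fun setT v).
Hypotheses (su : box_supported u) (sv : box_supported v).
Hypotheses (iu : leb.-integrable setT (EFin \o (fun x => u x ^+ 2)))
           (iv : leb.-integrable setT (EFin \o (fun x => v x ^+ 2))).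

Let uk k := clip k%:R \o u.
Let vk k := clip k%:R \o v.

Let muk k : measurable_fun setT (uk k). Proof. exact: measurable_clip. Qed.
Let mvk k : measurable_fun setT (vk k). Proof. exact: measurable_clip. Qed.

Let clip_box h k x : box_supported h -> `|(clip k%:R \o h) x| <= k%:R * box_indic L x.
Proof.
move=> sh; have [hx|/sh ->] := eqVneq (h x) 0.
  by rewrite /= hx /clip mul0r normr0 mulr_ge0 ?box_indic_ge0.
by rewrite mulr1 clip_bound.
Qed.

Let iu1 := integrable_of_sqr mu_ su iu.
Let iv1 := integrable_of_sqr mv_ sv iv.

Let cvg_fre (p q : 'rV[R]_n -> R) w : measurable_fun setT p -> measurable_fun setT q ->
  leb.-integrable setT (EFin \o p) -> leb.-integrable setT (EFin \o q) ->
  fre (clip k%:R \o p) (clip k%:R \o q) w @[k --> \oo] --> fre p q w.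
Proof.
move=> mp mq ip iq.
apply: (@Rdominated_convergence _ _ _ leb
  (fun k x => (clip k%:R \o p) x * cos (2 * pi * dot w x) + (clip k%:R \o q) x * sin (2 * pi * dot w x))
  (fun x => p x * cos (2 * pi * dot w x) + q x * sin (2 * pi * dot w x))
  (fun x => `|p x| + `|q x|)).
- move=> k; apply: measurable_funD; apply: measurable_funM; try exact: measurable_clip.
  + exact: (measurable_trig_dot (@continuous_cos R)).
  + exact: (measurable_trig_dot (@continuous_sin R)).
- apply: measurable_funD; apply: measurable_funM => //.
  + exact: (measurable_trig_dot (@continuous_cos R)).
  + exact: (measurable_trig_dot (@continuous_sin R)).
- by apply: aeW => x; apply: cvgD; apply: cvgMl; exact: cvg_clip.
- exact: (integrableD measurableT (integrable_norm ip) (integrable_norm iq)).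
- move=> k x; rewrite (le_trans (ler_normD _ _))// lerD// normrM.
    by rewrite (le_trans _ (clip_le k%:R (p x)))// ler_piMr// cos_le1N.
  by rewrite (le_trans _ (clip_le k%:R (q x)))// ler_piMr// sin_le1N.
Qed.

Let cvg_fenergy w : fenergy (uk k) (vk k) w @[k --> \oo] --> fenergy u v w.
Proof.
have mNu : measurable_fun setT (\- u) by exact: measurable_funN.
have iNu := integrable_opp iu1.
have c1 := @cvg_fre _ _ w mu_ mv_ iu1 iv1.
have c2 := @cvg_fre _ _ w mv_ mNu iv1 iNu.
have E k : \- uk k = clip k%:R \o (\- u).
  apply/funext => x /=; rewrite /uk /clip /= !indicE mulNr.
  by congr (- (_ * (nat_of_bool _)%:R)); apply/idP/idP => /set_mem /=; rewrite in_itv/= => H;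
    apply/mem_set; rewrite /= in_itv/=; move: H; rewrite -!ler_norml normrN.
rewrite /fenergy; apply: cvgD; apply: cvgM => //; under eq_fun do rewrite E; exact: c2.
Qed.

(** Truncate the values at level k and apply Fatou as k grows. *)
Lemma bessel_l2 :
  (\int[leb]_w (fenergy u v w)%:E <= \int[leb]_x (u x ^+ 2 + v x ^+ 2)%:E)%E.
Proof.
apply: (@fatou_bound _ _ _ _ (fun k => fenergy (uk k) (vk k))).
- by move=> k; exact: measurable_fenergy.
- by move=> k w; exact: fenergy_ge0.
- exact: cvg_fenergy.
move=> k; rewrite (@plancherel_boxed _ _ L k%:R)//; try by move=> x; exact: clip_box.
apply: ge0_le_integral => //.
- by move=> x _; rewrite lee_fin addr_ge0 ?sqr_ge0.
- by apply/measurable_EFinP; apply: measurable_funD; exact: measurable_funX.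
- by apply/measurable_EFinP; apply: measurable_funD; exact: measurable_funX.
move=> x _; rewrite lee_fin -(real_normK (num_real (uk k x))) -(real_normK (num_real (vk k x))).
rewrite -(real_normK (num_real (u x))) -(real_normK (num_real (v x))).
by rewrite lerD// lerXn2r ?nnegrE// clip_le.
Qed.

End main.

Section equality.
Variables (u v : 'rV[R]_n -> R).
Hypotheses (mu_ : measurable_fun setT u) (mv_ : measurable_fun setT v).
Hypotheses (su : box_supported u) (sv : box_supported v).
Hypotheses (iu : leb.-integrable setT (EFin \o (fun x => u x ^+ 2)))
           (iv : leb.-integrable setT (EFin \o (fun x => v x ^+ 2))).

Let uk k := clip k%:R \o u.
Let vk k := clip k%:R \o v.
Let sqr_clip (h g : 'rV[R]_n -> R) : measurable_fun setT g ->
  leb.-integrable setT (EFin \o (fun x => h x ^+ 2)) -> (forall x, `|g x| <= `|h x|) ->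
  leb.-integrable setT (EFin \o (fun x => g x ^+ 2)).
Proof.
move=> mg ih gh; apply: (le_integrable _ _ _ ih) => //.
  by apply/measurable_EFinP; exact: measurable_funX.
by move=> x _; rewrite lee_fin !normrX lerXn2r ?nnegrE.
Qed.

Let supp_le (h g : 'rV[R]_n -> R) : box_supported h -> (forall x, `|g x| <= `|h x|) ->
  box_supported g.
Proof.
move=> sh gh x gx; apply: sh; apply: contraNneq gx => hx.
by have := gh x; rewrite hx normr0 normr_le0.
Qed.

(** The truncation h_k is half the sum of h and its reflection 2 h_k - h, which
    has the norm of h. By convexity of the energy 2 |h_k|^2 <= energy h +
    |h|^2, and |h_k| tends to |h|, so energy h >= |h|^2, the inequality
    opposite to the one of Bessel. *)
Lemma plancherel_l2 :
  (\int[leb]_w (fenergy u v w)%:E = \int[leb]_x (u x ^+ 2 + v x ^+ 2)%:E)%E.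
Proof.
have iuv : leb.-integrable setT (EFin \o (fun x => u x ^+ 2 + v x ^+ 2)).
  exact: (integrableD measurableT iu iv).
have muk k : measurable_fun setT (uk k) by exact: measurable_clip.
have mvk k : measurable_fun setT (vk k) by exact: measurable_clip.
pose ek k := \int[leb]_x (uk k x ^+ 2 + vk k x ^+ 2).
pose e := \int[leb]_x (u x ^+ 2 + v x ^+ 2).
have ecvg : ek k @[k --> \oo] --> e.
  apply: (@Rdominated_convergence _ _ _ leb (fun k x => uk k x ^+ 2 + vk k x ^+ 2)
    (fun x => u x ^+ 2 + v x ^+ 2) (fun x => u x ^+ 2 + v x ^+ 2)) => //.
  - by move=> k; apply: measurable_funD; exact: measurable_funX.
  - by apply: measurable_funD; exact: measurable_funX.
  - by apply: aeW => x; apply: cvgD; apply: cvgM; exact: cvg_clip.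
  - move=> k x; rewrite ger0_norm ?addr_ge0 ?sqr_ge0//.
    rewrite -(real_normK (num_real (uk k x))) -(real_normK (num_real (vk k x))).
    rewrite -(real_normK (num_real (u x))) -(real_normK (num_real (v x))).
    by rewrite lerD// lerXn2r ?nnegrE// clip_le.
have eE : (\int[leb]_x (u x ^+ 2 + v x ^+ 2)%:E = e%:E)%E.
  by rewrite /e /Rintegral fineK//; exact: (integrable_fin_num measurableT iuv).
apply/eqP; rewrite eq_le bessel_l2//= eE.
(* The reflection 2 h_k - h of h in its truncation h_k has the modulus of h. *)
pose refl (h : 'rV[R]_n -> R) k x := 2 * clip k%:R (h x) - h x.
have reflE h k x : `|refl h k x| = `|h x|.
  rewrite /refl /clip indicE; case: (_ \in _) => /=; last by rewrite !mulr0 sub0r normrN.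
  by rewrite mulr1 mulr_natl mulr2n addrK.
have mrefl h k : measurable_fun setT h -> measurable_fun setT (refl h k).
  move=> mh; apply: measurable_funB => //; apply: measurable_funM => //; exact: measurable_clip.
have srefl h k x : refl h k x ^+ 2 = h x ^+ 2.
  by rewrite -(real_normK (num_real (refl h k x))) reflE real_normK ?num_real.
have irefl h k : leb.-integrable setT (EFin \o (fun x => h x ^+ 2)) ->
    leb.-integrable setT (EFin \o (fun x => refl h k x ^+ 2)).
  by move=> ih; apply: eq_integrable ih => // x _; rewrite /= srefl.
have rsupp h k : box_supported h -> box_supported (refl h k).
  by move=> sh x; rewrite -normr_eq0 reflE normr_eq0; exact: sh.
have fin_energy k : (\int[leb]_w (fenergy (uk k) (vk k) w)%:E = (ek k)%:E)%E.
  have box h x : box_supported h -> `|(clip k%:R \o h) x| <= k%:R * box_indic L x.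
    move=> sh; have [hx|/sh ->] := eqVneq (h x) 0.
      by rewrite /= hx /clip mul0r normr0 mulr_ge0 ?box_indic_ge0.
    by rewrite mulr1 clip_bound.
  rewrite (plancherel_boxed L0 (muk k) (mvk k) (fun x => box _ x su) (fun x => box _ x sv)).
  rewrite /ek /Rintegral fineK//; apply: (integrable_fin_num measurableT).
  exact: (integrableD measurableT (sqr_clip (muk k) iu (fun x => clip_le _ _))
    (sqr_clip (mvk k) iv (fun x => clip_le _ _))).
have mF p q : measurable_fun setT p -> measurable_fun setT q ->
    measurable_fun setT (fun w => (fenergy p q w)%:E).
  by move=> mp mq; apply/measurable_EFinP; exact: measurable_fenergy.
have key k : ((2 * ek k - e)%:E <= \int[leb]_w (fenergy u v w)%:E)%E.
  rewrite EFinB leeBlDr// EFinM -fin_energy -ge0_integralZl//; last 2 first.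
  - exact: mF.
  - by move=> w _; rewrite lee_fin fenergy_ge0.
  apply: (@le_trans _ _ (\int[leb]_w ((fenergy u v w)%:E + (fenergy (refl u k) (refl v k) w)%:E))%E).
    apply: ge0_le_integral => //.
    - by move=> w _; rewrite mule_ge0// lee_fin fenergy_ge0.
    - by apply: emeasurable_funM => //; exact: mF.
    - by apply: emeasurable_funD; apply: mF => //; exact: mrefl.
    move=> w _; rewrite lee_fin.
    have L1 p : measurable_fun setT p -> box_supported p ->
        leb.-integrable setT (EFin \o (fun x => p x ^+ 2)) -> leb.-integrable setT (EFin \o p).
      exact: integrable_of_sqr.
    have iu1 := L1 _ mu_ su iu; have iv1 := L1 _ mv_ sv iv.
    have iru := L1 _ (mrefl _ k mu_) (rsupp _ k su) (irefl _ k iu).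
    have irv := L1 _ (mrefl _ k mv_) (rsupp _ k sv) (irefl _ k iv).
    have iuk1 := L1 _ (muk k) (supp_le su (fun x => clip_le _ _)) (sqr_clip (muk k) iu (fun x => clip_le _ _)).
    have ivk1 := L1 _ (mvk k) (supp_le sv (fun x => clip_le _ _)) (sqr_clip (mvk k) iv (fun x => clip_le _ _)).
    have half (a b c : R) : a + b = c + c -> 2 * c ^+ 2 <= a ^+ 2 + b ^+ 2.
      by move=> /(canRL (addKr _)) ->; have := sqr_ge0 (a - c); nra.
    have F1 : fre u v w + fre (refl u k) (refl v k) w = fre (uk k) (vk k) w + fre (uk k) (vk k) w.
      rewrite -!freD//; congr (fre _ _ w); apply/funext => x /=; rewrite /refl /uk /vk /=; ring.
    have F2 : fre v (\- u) w + fre (refl v k) (\- refl u k) w =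
        fre (vk k) (\- uk k) w + fre (vk k) (\- uk k) w.
      rewrite -!freD//; try exact: integrable_opp.
      congr (fre _ _ w); apply/funext => x /=; rewrite /refl /uk /vk /=; ring.
    by have := half _ _ _ F1; have := half _ _ _ F2; rewrite /fenergy; lra.
  rewrite ge0_integralD//; last 4 first.
  - by move=> w _; rewrite lee_fin fenergy_ge0.
  - exact: mF.
  - by move=> w _; rewrite lee_fin fenergy_ge0.
  - by apply: mF; exact: mrefl.
  apply: leeD => //; rewrite -eE.
  apply: le_trans (bessel_l2 (mrefl _ k mu_) (mrefl _ k mv_) (rsupp _ k su) (rsupp _ k sv)
    (irefl _ k iu) (irefl _ k iv)) _.
  by under eq_integral do rewrite !srefl.
have c : (2 * ek k - e)%:E @[k --> \oo] --> e%:E.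
  apply: cvg_EFin; first exact: nearW.
  rewrite [X in _ --> X](_ : e = 2 * e - e); last by ring.
  by apply: cvgB; [exact: cvgMr|exact: cvg_cst].
by apply: (cvge_to_le c); apply: nearW.
Qed.

End equality.
End plancherel_l2.

(** * Semidefinite forms and least squares *)

Section psd_forms.
Context {R : realType} {V : lmodType R}.
Implicit Types (H S : set V) (b : V -> V -> R) (f g h p x y : V).

Definition subspace H := H 0 /\ forall (a : R) x y, H x -> H y -> H (a *: x + y).

(** The identities are required on H only: outside it the forms below are given
    by integrals that may diverge. *)
Definition psd_form H b :=
  [/\ forall (a : R) x y z, H x -> H y -> H z -> b (a *: x + y) z = a * b x z + b y z,
      forall x y, H x -> H y -> b x y = b y x
    & forall x, H x -> 0 <= b x x].

Lemma subspaceZ H a x : subspace H -> H x -> H (a *: x).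
Proof. by move=> [H0 HD] Hx; rewrite -[_ *: _]addr0; exact: HD. Qed.

Lemma subspaceD H x y : subspace H -> H x -> H y -> H (x + y).
Proof. by move=> [H0 HD] Hx Hy; rewrite -[x]scale1r; exact: HD. Qed.

Lemma subspaceB H x y : subspace H -> H x -> H y -> H (x - y).
Proof. by move=> [H0 HD] Hx Hy; rewrite addrC -scaleN1r; exact: HD. Qed.

Lemma subspace_sum H m (psi : nat -> V) (c : nat -> R) : subspace H ->
  (forall i, H (psi i)) -> H (\sum_(i < m) c i *: psi i).
Proof.
move=> sH Hpsi; elim: m => [|m IH]; first by rewrite big_ord0; case: sH.
by rewrite big_ord_recr; apply: subspaceD => //; exact: subspaceZ.
Qed.

Section one_form.
Variables (H : set V) (b : V -> V -> R).
Hypotheses (sH : subspace H) (Hb : psd_form H b).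

Let bl a x y z : H x -> H y -> H z -> b (a *: x + y) z = a * b x z + b y z.
Proof. by case: Hb => + _ _; apply. Qed.
Let bC x y : H x -> H y -> b x y = b y x. Proof. by case: Hb => _ + _; apply. Qed.
Let b0 x : H x -> 0 <= b x x. Proof. by case: Hb => _ _; apply. Qed.

Lemma formDl x y z : H x -> H y -> H z -> b (x + y) z = b x z + b y z.
Proof. by move=> Hx Hy Hz; rewrite -{1}[x]scale1r bl// mul1r. Qed.

Lemma formBl x y z : H x -> H y -> H z -> b (x - y) z = b x z - b y z.
Proof. by move=> Hx Hy Hz; rewrite addrC -scaleN1r bl// mulN1r addrC. Qed.

Lemma form0l z : H z -> b 0 z = 0.
Proof. by move=> Hz; have [H0 _] := sH; rewrite -(subrr 0) formBl// subrr. Qed.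

Lemma formZl a x z : H x -> H z -> b (a *: x) z = a * b x z.
Proof. by move=> Hx Hz; have [H0 _] := sH; rewrite -[_ *: _]addr0 bl// form0l// addr0. Qed.

Lemma formDr x y z : H x -> H y -> H z -> b z (x + y) = b z x + b z y.
Proof. by move=> Hx Hy Hz; rewrite bC ?formDl ?(bC Hz)//; exact: subspaceD. Qed.

Lemma formZr a x z : H x -> H z -> b z (a *: x) = a * b z x.
Proof. by move=> Hx Hz; rewrite bC ?formZl ?(bC Hz)//; exact: subspaceZ. Qed.

Lemma formBr x y z : H x -> H y -> H z -> b z (x - y) = b z x - b z y.
Proof. by move=> Hx Hy Hz; rewrite bC ?formBl ?(bC Hz)//; exact: subspaceB. Qed.

Lemma form_sqrD x y : H x -> H y -> b (x + y) (x + y) = b x x + 2 * b x y + b y y.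
Proof.
move=> Hx Hy; have Hxy := subspaceD sH Hx Hy.
by rewrite formDl// !formDr// (bC Hy Hx); ring.
Qed.

Lemma form_sqrZ a x : H x -> b (a *: x) (a *: x) = a ^+ 2 * b x x.
Proof.
move=> Hx; have Hax := subspaceZ a sH Hx.
by rewrite formZl// formZr//; ring.
Qed.

Lemma form_cauchy_schwarz x y : H x -> H y -> b x y ^+ 2 <= b x x * b y y.
Proof.
move=> Hx Hy.
have Q t : 0 <= t ^+ 2 * b x x + 2 * t * b x y + b y y.
  have Htx := subspaceZ t sH Hx.
  have := b0 (subspaceD sH Htx Hy); rewrite form_sqrD// form_sqrZ// formZl//.
  by rewrite mulrA.
have xx := b0 Hx; have yy := b0 Hy.
have [xx0|xxN0] := eqVneq (b x x) 0; last first.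
  have xxp : 0 < b x x by rewrite lt_neqAle eq_sym xxN0.
  have := Q (- b x y / b x x).
  have -> : (- b x y / b x x) ^+ 2 * b x x + 2 * (- b x y / b x x) * b x y + b y y =
    (b x x * b y y - b x y ^+ 2) / b x x by field.
  by rewrite pmulr_lge0 ?invr_gt0// subr_ge0.
rewrite xx0 mul0r; have [->|xyN0] := eqVneq (b x y) 0; first by rewrite expr0n.
have := Q (- (b y y + 1) / (2 * b x y)).
rewrite xx0 mulr0 add0r (_ : _ + b y y = - 1); last by field.
by rewrite oppr_ge0 ler10.
Qed.

Lemma form_null x y : H x -> H y -> b x x = 0 -> b x y = 0.
Proof.
move=> Hx Hy xx; have := form_cauchy_schwarz Hx Hy; rewrite xx mul0r => le0.
by apply/eqP; rewrite -sqrf_eq0 eq_le le0 sqr_ge0.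
Qed.

Lemma form_triangle x y : H x -> H y ->
  Num.sqrt (b (x + y) (x + y)) <= Num.sqrt (b x x) + Num.sqrt (b y y).
Proof.
move=> Hx Hy; have xx := b0 Hx; have yy := b0 Hy.
rewrite -ler_sqr ?nnegrE ?addr_ge0 ?sqrtr_ge0//.
rewrite sqr_sqrtr ?b0//; last exact: subspaceD.
rewrite form_sqrD// sqrrD !sqr_sqrtr// lerD2r lerD2l -[leRHS]mulr_natl ler_wpM2l//.
rewrite -sqrtrM// (le_trans (ler_norm _))// -sqrtr_sqr ler_wsqrtr//.
exact: form_cauchy_schwarz.
Qed.

Lemma form_sqrB x y : H x -> H y -> b (x - y) (x - y) = b x x - 2 * b x y + b y y.
Proof.
move=> Hx Hy; have Hxy := subspaceB sH Hx Hy.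
by rewrite formBl// !formBr// (bC Hy Hx); ring.
Qed.

(** Gram-Schmidt. When the residual e of the new vector is null, division by
    zero gives it the coefficient 0, the right one by Cauchy-Schwarz. *)
Lemma span_projection m (psi : nat -> V) : (forall i, H (psi i)) ->
  forall f, H f -> exists c : nat -> R, forall j, (j < m)%N ->
    b (f - \sum_(i < m) c i *: psi i) (psi j) = 0.
Proof.
move=> Hpsi; elim: m => [|m IH] f Hf; first by exists (fun=> 0).
have [c cP] := IH _ Hf; have [c' c'P] := IH _ (Hpsi m).
have Hs (k : nat -> R) : H (\sum_(i < m) k i *: psi i) by exact: (@subspace_sum H m psi k sH Hpsi).
pose p := \sum_(i < m) c i *: psi i; pose p' := \sum_(i < m) c' i *: psi i.
pose e := psi m - p'.
have He : H e by apply: subspaceB => //; exact: Hs.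
have Hfp : H (f - p) by apply: subspaceB => //; exact: Hs.
pose t := b (f - p) e / b e e.
exists (fun i => if (i < m)%N then c i - t * c' i else t).
rewrite big_ord_recr /= ltnn.
have -> : f - (\sum_(i < m) (if (i < m)%N then c i - t * c' i else t) *: psi i + t *: psi m) =
    (f - p) - t *: e.
  rewrite (eq_bigr (fun i : 'I_m => c i *: psi i - t *: (c' i *: psi i))); last first.
    by move=> i _; rewrite ltn_ord scalerBl scalerA.
  by rewrite sumrB -scaler_sumr -/p -/p' addrAC -addrA opprD addrA -scalerBr.
have Hte : H (t *: e) by exact: subspaceZ.
have low j : (j < m)%N -> b (f - p - t *: e) (psi j) = 0.
  by move=> jm; rewrite formBl// formZl// cP// c'P// mulr0 subr0.
move=> j; rewrite ltnS leq_eqVlt => /predU1P[->|]; last exact: low.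
have -> : psi m = e + p' by rewrite subrK.
have Hr : H (f - p - t *: e) by exact: subspaceB.
have -> : b (f - p - t *: e) (e + p') = b (f - p - t *: e) e.
  rewrite formDr//; last exact: Hs.
  have sum0 k : (k <= m)%N -> b (f - p - t *: e) (\sum_(i < k) c' i *: psi i) = 0.
    elim: k => [_|k IHk km]; first by rewrite big_ord0 bC ?form0l//; case: sH.
    rewrite big_ord_recr formDr//=; [|exact: (@subspace_sum H k psi c' sH Hpsi)|exact: subspaceZ].
    by rewrite IHk 1?ltnW// formZr// low// mulr0 addr0.
  by rewrite sum0// addr0.
rewrite formBl// formZl// /t; have [e0|eN0] := eqVneq (b e e) 0.
  by rewrite e0 mulr0 subr0 bC// form_null.
by rewrite divfK// subrr.
Qed.

End one_form.

Section oblique_projection.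
Variables (H S : set V) (ip s : V -> V -> R) (A B : R).
Hypotheses (sH : subspace H) (sS : subspace S) (SH : S `<=` H).
Hypotheses (ipP : psd_form H ip) (sP : psd_form H s).
Hypotheses (A0 : 0 < A) (sB : forall f, H f -> s f f <= B * ip f f)
  (sA : forall g, S g -> A * ip g g <= s g g).
Hypothesis projS : forall f, H f -> exists2 p, S p & forall g, S g -> s (f - p) g = 0.

Definition least_squares f : set V :=
  [set g | S g /\ forall g', S g' -> s (f - g) (f - g) <= s (f - g') (f - g')].

Let ip0 x : H x -> 0 <= ip x x. Proof. by case: ipP => _ _; apply. Qed.
Let s0 x : H x -> 0 <= s x x. Proof. by case: sP => _ _; apply. Qed.

Lemma normal_equations_optimal f p g : H f -> S p -> (forall g, S g -> s (f - p) g = 0) -> S g ->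
  s (f - g) (f - g) = s (f - p) (f - p) + s (p - g) (p - g).
Proof.
move=> Hf Sp pP Sg.
have -> : f - g = (f - p) + (p - g) by rewrite addrA subrK.
have Spg : S (p - g) by exact: subspaceB.
have Hfp : H (f - p) by apply: subspaceB => //; exact: SH.
by rewrite (form_sqrD sH sP Hfp (SH Spg)) (pP _ Spg) mulr0 addr0.
Qed.

Lemma least_squares_nonempty f : H f -> least_squares f !=set0.
Proof.
move=> Hf; have [p Sp pP] := projS Hf; exists p; split=> // g Sg.
rewrite (normal_equations_optimal Hf Sp pP Sg) lerDl s0//.
by apply: SH; exact: subspaceB.
Qed.

Let s_null g : S g -> s g g = 0 -> ip g g = 0.
Proof.
move=> Sg sg; apply/eqP; rewrite eq_le ip0 ?andbT; last exact: SH.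
by have := sA Sg; rewrite sg pmulr_rle0.
Qed.

(** A minimizer agrees with the solution of the normal equations up to an
    ip-null vector, which is all that a.e. equality can give. *)
Lemma least_squares_normal f g p : H f -> least_squares f g ->
  S p -> (forall g, S g -> s (f - p) g = 0) -> ip (p - g) (p - g) = 0.
Proof.
move=> Hf [Sg gmin] Sp pP; have Spg : S (p - g) by exact: subspaceB.
apply: s_null => //; apply/eqP; rewrite eq_le s0 ?andbT; last exact: SH.
have := gmin _ Sp; rewrite (normal_equations_optimal Hf Sp pP Sg).
by rewrite gerDl.
Qed.

Lemma ip_null_trans x y z : H x -> H y -> H z ->
  ip (x - y) (x - y) = 0 -> ip (x - z) (x - z) = 0 -> ip (y - z) (y - z) = 0.
Proof.
move=> Hx Hy Hz xy xz.
have Hxy := subspaceB sH Hx Hy; have Hxz := subspaceB sH Hx Hz.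
have -> : y - z = (x - z) - (x - y) by rewrite opprB [RHS]addrC addrA subrK.
by rewrite (form_sqrB sH ipP)// xy xz (form_null sH ipP)// mulr0 subrr add0r.
Qed.

Lemma least_squares_unique f g g' : H f -> least_squares f g -> least_squares f g' ->
  ip (g - g') (g - g') = 0.
Proof.
move=> Hf gf g'f; have [p Sp pP] := projS Hf.
have [Sg _] := gf; have [Sg' _] := g'f.
apply: (@ip_null_trans p); try exact: SH.
  exact: (least_squares_normal Hf gf Sp pP).
exact: (least_squares_normal Hf g'f Sp pP).
Qed.

(** s p p <= s f f, since f - p is orthogonal to p for s. *)
Lemma oblique_bound f p : H f -> S p -> (forall g, S g -> s (f - p) g = 0) ->
  A * ip p p <= B * ip f f.
Proof.
move=> Hf Sp pP; have S0 : S 0 by case: sS.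
apply: (le_trans (sA Sp)); apply: (le_trans _ (sB Hf)).
have := normal_equations_optimal Hf Sp pP S0; rewrite !subr0 => ->.
by rewrite lerDr s0//; apply: subspaceB => //; exact: SH.
Qed.

(** A projection and its complement have the same norm: the bound on the
    projection, applied to a *: u + e, is the bound on e - u when a is the
    ratio of ip e e to ip u u. *)
Lemma oblique_complement_bound e u : A <= B -> H e -> S u -> (forall g, S g -> s (e - u) g = 0) ->
  ip e u = 0 -> A * ip (e - u) (e - u) <= B * ip e e.
Proof.
move=> AB He Su uP eu; have Hu := SH Su.
rewrite (form_sqrB sH ipP)// eu mulr0 subr0.
have ee := ip0 He; have uu := ip0 Hu.
have [u0|uN0] := eqVneq (ip u u) 0; first by rewrite u0 addr0 ler_wpM2r.
have up : 0 < ip u u by rewrite lt_neqAle eq_sym uN0.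
pose a := ip e e / ip u u.
have Hau : H (a *: u) by exact: subspaceZ.
have Hx : H (a *: u + e) by exact: subspaceD.
have Sau : S ((a + 1) *: u) by exact: subspaceZ.
have xP g : S g -> s (a *: u + e - (a + 1) *: u) g = 0.
  by move=> Sg; rewrite scalerDl scale1r opprD addrACA subrr add0r uP.
have := oblique_bound Hx Sau xP.
rewrite (form_sqrD sH ipP)// (form_sqrZ sH ipP)// (form_sqrZ sH ipP)// (formZl sH ipP)//.
have -> : ip u e = 0 by case: ipP => _ + _ => ->.
rewrite !mulr0 addr0.
have -> : A * ((a + 1) ^+ 2 * ip u u) = (a + 1) * (A * (ip e e + ip u u)).
  by rewrite /a; field.
have -> : B * (a ^+ 2 * ip u u + ip e e) = (a + 1) * (B * ip e e).
  by rewrite /a; field.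
by rewrite ler_pM2l// ltr_wpDl// divr_ge0.
Qed.

(** Let e = f - p, and let u and w be the s-projections of e and h. Then p + u
    + w is the s-projection of f + h, so f - g equals (e - u) - w up to a null
    vector; the two terms are bounded by the complementary projection and the
    projection. *)
Theorem least_squares_error f h p g : A <= B -> H f -> H h ->
  S p -> (forall g, S g -> ip (f - p) g = 0) -> least_squares (f + h) g ->
  Num.sqrt (ip (f - g) (f - g)) <=
    Num.sqrt (B / A) * (Num.sqrt (ip (f - p) (f - p)) + Num.sqrt (ip h h)).
Proof.
move=> AB Hf Hh Sp pP gP; have Sg : S g by case: gP.
have Hp := SH Sp; have Hg := SH Sg.
pose e := f - p; have He : H e by exact: subspaceB.
have [u Su uP] := projS He; have [w Sw wP] := projS Hh.
have Hu := SH Su; have Hw := SH Sw.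
have Spu : S (p + u + w) by do 2 apply: subspaceD => //.
have normal g' : S g' -> s (f + h - (p + u + w)) g' = 0.
  move=> Sg'; have -> : f + h - (p + u + w) = (e - u) + (h - w).
    by rewrite /e !opprD !addrA; congr (_ - _); rewrite -!addrA; congr (_ + _); rewrite addrC -addrA.
  rewrite (formDl sP) ?uP ?wP ?addr0//; try exact: subspaceB.
  exact: SH.
have Hfh := subspaceD sH Hf Hh.
have null := least_squares_normal Hfh gP Spu normal.
have decomp : f - g = ((e - u) - w) + (p + u + w - g).
  rewrite /e [RHS]addrA; congr (_ - _).
  by rewrite -[f - p - u]addrA -opprD -[_ - w]addrA -opprD subrK.
have Hz : H (p + u + w - g) by apply: subspaceB => //; exact: SH.
have Heu : H (e - u) by exact: subspaceB.
have Heuw : H (e - u - w) by exact: subspaceB.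
rewrite decomp (le_trans (form_triangle sH ipP Heuw Hz))// null sqrtr0 addr0.
have HNw : H (- w) by rewrite -scaleN1r; exact: subspaceZ.
rewrite (le_trans (form_triangle sH ipP Heu HNw))// mulrDr.
have BA : 0 <= B / A by rewrite divr_ge0// ltW// (lt_le_trans A0).
have tosqrt (x y : R) : 0 <= x -> 0 <= y -> A * x <= B * y -> Num.sqrt x <= Num.sqrt (B / A) * Num.sqrt y.
  by move=> x0 y0 xy; rewrite -sqrtrM// ler_wsqrtr// mulrAC ler_pdivlMr// mulrC.
apply: lerD; apply: tosqrt; rewrite ?ip0//.
  by apply: oblique_complement_bound => //; exact: pP.
rewrite -scaleN1r (form_sqrZ sH ipP)// sqrrN expr1n mul1r.
exact: oblique_bound.
Qed.

End oblique_projection.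
End psd_forms.

(** * The space H and its Fourier transform *)

Section hspace.
Context {R : realType} {d : nat}.
Notation leb := (@lebesgue_rv R d).
Notation V := ('rV[R]_d -> Rcomplex R).
Notation Re := complex.Re.
Notation Im := complex.Im.
Implicit Types (f g h : V) (E : set 'rV[R]_d).

(** Typed so that linear algebra over R applies: Rcomplex R is R[i] as a real
    vector space. *)
Definition hspace E : set V := Hspace E.

Definition re_on E f : 'rV[R]_d -> R := (fun x => Re (f x)) \_ E.
Definition im_on E f : 'rV[R]_d -> R := (fun x => Im (f x)) \_ E.

Lemma fourierE E f w : fourier E f w =
  Complex (fre (re_on E f) (im_on E f) w) (fre (im_on E f) (\- re_on E f) w).
Proof.
rewrite /fourier /integralC; congr Complex; rewrite Rintegral_mkcond;
  apply: eq_Rintegral => x _; rewrite /re_on /im_on /= !patchE; case: ifPn => xE;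
  rewrite ?oppr0 ?mul0r ?addr0//; case: (f x) => a b /=; rewrite cosN sinN; ring.
Qed.

Lemma sqmod_fourier E f w : sqmod (fourier E f w) = fenergy (re_on E f) (im_on E f) w.
Proof. by rewrite fourierE. Qed.

(** The real part of the inner product. As the spaces are stable under
    multiplication by i, orthogonality for it is the complex one. *)
Definition rinner f g : R := \int[leb]_x (Re (f x) * Re (g x) + Im (f x) * Im (g x)).

Lemma sqmod_ge0 (z : R[i]) : 0 <= sqmod z.
Proof. by rewrite addr_ge0 ?sqr_ge0. Qed.

Lemma measurable_sqmod f : measurable_fun setT (fun x => Re (f x)) ->
  measurable_fun setT (fun x => Im (f x)) -> measurable_fun setT (fun x => sqmod (f x)).
Proof. by move=> mr mi; apply: measurable_funD; exact: measurable_funX. Qed.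

Lemma hspace_sqr_integrable E f : Hspace E f -> leb.-integrable setT (EFin \o (fun x => sqmod (f x))).
Proof.
move=> [mr mi fE _]; apply/integrableP; split.
  by apply/measurable_EFinP; exact: measurable_sqmod.
under eq_integral do rewrite /= ger0_norm ?sqmod_ge0//.
move: fE; rewrite /L2norm; set I := (\int[_]_(_ in _) _)%E.
have : (0 <= I)%E by apply: integral_ge0 => x _; rewrite lee_fin sqmod_ge0.
by case: I => //= r _ _; rewrite ltry.
Qed.

Lemma hspace_re_sqr E f : Hspace E f -> leb.-integrable setT (EFin \o (fun x => Re (f x) ^+ 2)).
Proof.
move=> fH; have [mr mi _ _] := fH; apply: (le_integrable _ _ _ (hspace_sqr_integrable fH)) => //.
  by apply/measurable_EFinP; exact: measurable_funX.
by move=> x _; rewrite lee_fin !ger0_norm ?sqr_ge0 ?sqmod_ge0// lerDl sqr_ge0.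
Qed.

Lemma hspace_im_sqr E f : Hspace E f -> leb.-integrable setT (EFin \o (fun x => Im (f x) ^+ 2)).
Proof.
move=> fH; have [mr mi _ _] := fH; apply: (le_integrable _ _ _ (hspace_sqr_integrable fH)) => //.
  by apply/measurable_EFinP; exact: measurable_funX.
by move=> x _; rewrite lee_fin !ger0_norm ?sqr_ge0 ?sqmod_ge0// lerDr sqr_ge0.
Qed.

Lemma hspace_inner_integrable E f g : Hspace E f -> Hspace E g ->
  leb.-integrable setT (EFin \o (fun x => Re (f x) * Re (g x) + Im (f x) * Im (g x))).
Proof.
move=> fH gH; have [mrf mif _ _] := fH; have [mrg mig _ _] := gH.
apply: (le_integrable _ _ _ (integrableD measurableT (hspace_sqr_integrable fH) (hspace_sqr_integrable gH))) => //.
  by apply/measurable_EFinP; apply: measurable_funD; exact: measurable_funM.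
move=> x _; rewrite lee_fin [leRHS]ger0_norm ?addr_ge0 ?sqr_ge0//.
rewrite /sqmod; move: (Re (f x)) (Re (g x)) (Im (f x)) (Im (g x)) => a b c e /=.
have := sqr_ge0 (a + b); have := sqr_ge0 (a - b); have := sqr_ge0 (c + e); have := sqr_ge0 (c - e).
by rewrite ler_norml => *; apply/andP; split; nra.
Qed.

Lemma rinner_sqmod f : rinner f f = \int[leb]_x sqmod (f x).
Proof. by apply: eq_Rintegral => x _; rewrite /sqmod -!expr2. Qed.

Lemma integral_sqmod E f : Hspace E f ->
  (\int[leb]_x (sqmod (f x))%:E = (rinner f f)%:E)%E.
Proof.
move=> fH; rewrite rinner_sqmod /Rintegral fineK//.
exact: (integrable_fin_num measurableT (hspace_sqr_integrable fH)).
Qed.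

Lemma rinner_ge0 f : 0 <= rinner f f.
Proof. by rewrite rinner_sqmod; apply: Rintegral_ge0 => x _; exact: sqmod_ge0. Qed.

Lemma L2norm_rinner E f : Hspace E f -> L2norm setT f = (Num.sqrt (rinner f f))%:E.
Proof. by move=> fH; rewrite /L2norm (integral_sqmod fH). Qed.

Lemma measurable_re_on E f : measurable E -> Hspace E f -> measurable_fun setT (re_on E f).
Proof. by move=> mE [mr _ _ _]; apply/(measurable_restrictT _ mE); exact: measurable_funTS. Qed.

Lemma measurable_im_on E f : measurable E -> Hspace E f -> measurable_fun setT (im_on E f).
Proof. by move=> mE [_ mi _ _]; apply/(measurable_restrictT _ mE); exact: measurable_funTS. Qed.

Lemma restrict_le (p : 'rV[R]_d -> R) E x : (p \_ E) x ^+ 2 <= p x ^+ 2.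
Proof. by rewrite patchE; case: ifPn => // _; rewrite expr0n sqr_ge0. Qed.

Lemma re_on_sqr E f : measurable E -> Hspace E f ->
  leb.-integrable setT (EFin \o (fun x => re_on E f x ^+ 2)).
Proof.
move=> mE fH; apply: (le_integrable _ _ _ (hspace_re_sqr fH)) => //.
  by apply/measurable_EFinP; apply: measurable_funX; exact: measurable_re_on.
by move=> x _; rewrite lee_fin !ger0_norm ?sqr_ge0//; exact: restrict_le.
Qed.

Lemma im_on_sqr E f : measurable E -> Hspace E f ->
  leb.-integrable setT (EFin \o (fun x => im_on E f x ^+ 2)).
Proof.
move=> mE fH; apply: (le_integrable _ _ _ (hspace_im_sqr fH)) => //.
  by apply/measurable_EFinP; apply: measurable_funX; exact: measurable_im_on.
by move=> x _; rewrite lee_fin !ger0_norm ?sqr_ge0//; exact: restrict_le.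
Qed.

Lemma restrict_ae E f : measurable E -> Hspace E f ->
  (\int[leb]_x (re_on E f x ^+ 2 + im_on E f x ^+ 2)%:E = \int[leb]_x (sqmod (f x))%:E)%E.
Proof.
move=> mE fH; have [mr mi _ f0] := fH.
apply: ge0_ae_eq_integral => //.
- by apply/measurable_EFinP; apply: measurable_funD; apply: measurable_funX;
    [exact: measurable_re_on|exact: measurable_im_on].
- by apply/measurable_EFinP; exact: measurable_sqmod.
- by move=> x _; rewrite lee_fin addr_ge0 ?sqr_ge0.
- by move=> x _; rewrite lee_fin sqmod_ge0.
apply: filterS f0 => x fx _; rewrite /re_on /im_on !patchE.
case: ifPn => // /negP xE; rewrite fx//=; last by move=> Ex; apply: xE; exact: mem_set.
Qed.

Section compact_support.
Variables (E : set 'rV[R]_d) (cE : compact E).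

Let mE : measurable E. Proof. exact: compact_measurable_rv. Qed.

Lemma measurable_fourier f : Hspace E f ->
  measurable_fun setT (fun w => Re (fourier E f w)) /\ measurable_fun setT (fun w => Im (fourier E f w)).
Proof.
move=> fH; have mr := measurable_re_on mE fH; have mi := measurable_im_on mE fH.
have mNr : measurable_fun setT (\- re_on E f) by exact: measurable_funN.
split; under eq_fun do rewrite fourierE /=; exact: measurable_fre.
Qed.

Lemma measurable_sqmod_fourier f : Hspace E f ->
  measurable_fun setT (fun y => (sqmod (fourier E f y))%:E).
Proof.
by move=> /measurable_fourier[mr mi]; apply/measurable_EFinP; exact: measurable_sqmod.
Qed.

Lemma measurable_sqmod_fourierB f w : Hspace E f ->
  measurable_fun setT (fun y => (sqmod (fourier E f y - fourier E f w))%:E).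
Proof.
move=> /measurable_fourier[mr mi]; apply/measurable_EFinP; apply: measurable_sqmod.
  rewrite (_ : (fun y => _) = (fun y => Re (fourier E f y) - Re (fourier E f w))).
    exact: measurable_funB.
  by apply/funext => y; case: (fourier _ _ _) (fourier _ _ _) => [? ?] [? ?].
rewrite (_ : (fun y => _) = (fun y => Im (fourier E f y) - Im (fourier E f w))).
  exact: measurable_funB.
by apply/funext => y; case: (fourier _ _ _) (fourier _ _ _) => [? ?] [? ?].
Qed.

(** f vanishes a.e. outside E, hence agrees a.e. with its restriction to E, and
    E lies in a cube. *)
Theorem plancherel f : Hspace E f ->
  (\int[leb]_w (sqmod (fourier E f w))%:E = (rinner f f)%:E)%E.
Proof.
move=> fH; have [L L0 LE] := compact_sub_box cE.
rewrite -(integral_sqmod fH) -(restrict_ae mE fH).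
under eq_integral do rewrite sqmod_fourier.
have sb (p : 'rV[R]_d -> R) : box_supported L (p \_ E).
  by move=> x; rewrite patchE; case: ifPn => [/set_mem/LE//|_]; rewrite eqxx.
apply: (plancherel_l2 L0); [exact: measurable_re_on|exact: measurable_im_on|exact: sb|exact: sb|
  exact: re_on_sqr|exact: im_on_sqr].
Qed.

Lemma integrable_re_on f : Hspace E f -> leb.-integrable setT (EFin \o re_on E f).
Proof.
move=> fH; have [L L0 LE] := compact_sub_box cE.
apply: (integrable_of_sqr (L := L)); [exact: measurable_re_on| |exact: re_on_sqr].
by move=> x; rewrite /re_on patchE; case: ifPn => [/set_mem/LE//|_]; rewrite eqxx.
Qed.

Lemma integrable_im_on f : Hspace E f -> leb.-integrable setT (EFin \o im_on E f).
Proof.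
move=> fH; have [L L0 LE] := compact_sub_box cE.
apply: (integrable_of_sqr (L := L)); [exact: measurable_im_on| |exact: im_on_sqr].
by move=> x; rewrite /im_on patchE; case: ifPn => [/set_mem/LE//|_]; rewrite eqxx.
Qed.

Lemma Re_scaleD (a : R) (z1 z2 : Rcomplex R) : Re (a *: z1 + z2) = a * Re z1 + Re z2.
Proof. by case: z1 z2 => [? ?] [? ?]. Qed.

Lemma Im_scaleD (a : R) (z1 z2 : Rcomplex R) : Im (a *: z1 + z2) = a * Im z1 + Im z2.
Proof. by case: z1 z2 => [? ?] [? ?]. Qed.

Lemma hspace_subspace : subspace (hspace E).
Proof.
split.
  split; [exact: measurable_cst|exact: measurable_cst| |exact: aeW].
  rewrite /L2norm (_ : (\int[_]_(_ in _) _)%E = 0%E) ?sqrte0//.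
  by apply: integral0_eq => x _; rewrite /sqmod /= !expr0n addr0.
move=> a f g fH gH; have [mrf mif _ f0] := fH; have [mrg mig _ g0] := gH.
have mr : measurable_fun setT (fun x => Re ((a *: f + g) x)).
  under eq_fun do rewrite Re_scaleD.
  by apply: measurable_funD => //; apply: measurable_funM.
have mi : measurable_fun setT (fun x => Im ((a *: f + g) x)).
  under eq_fun do rewrite Im_scaleD.
  by apply: measurable_funD => //; apply: measurable_funM.
split => //.
  have ib : leb.-integrable setT (EFin \o (fun x => 2 * a ^+ 2 * sqmod (f x) + 2 * sqmod (g x))).
    by apply: (integrableD measurableT (integrableZl measurableT _ (hspace_sqr_integrable fH))
      (integrableZl measurableT _ (hspace_sqr_integrable gH))).
  have il : leb.-integrable setT (EFin \o (fun x => sqmod ((a *: f + g) x))).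
    apply: (le_integrable _ _ _ ib) => //.
      by apply/measurable_EFinP; exact: measurable_sqmod.
    move=> x _; rewrite lee_fin [leLHS]ger0_norm ?sqmod_ge0// (le_trans _ (ler_norm _))//.
    rewrite /sqmod Re_scaleD Im_scaleD.
    move: (Re (f x)) (Re (g x)) (Im (f x)) (Im (g x)) => p q r t.
    by have := sqr_ge0 (a * p - q); have := sqr_ge0 (a * r - t) => *; nra.
  rewrite /L2norm; have /integrableP[_] := il.
  under eq_integral do rewrite /= ger0_norm ?sqmod_ge0//.
  by case: (\int[_]_(_ in _) _)%E => //= r _; rewrite ltry.
apply: filterS2 f0 g0 => x fx gx xE.
by rewrite -[LHS]/(a *: (f x : Rcomplex R) + g x) fx// gx// scaler0 addr0.
Qed.

Lemma rinner_form : psd_form (hspace E) rinner.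
Proof.
split.
- move=> a f g h fH gH hH; rewrite /rinner -RintegralZl//; last exact: (hspace_inner_integrable fH hH).
  rewrite -RintegralD//; last 2 first.
  + exact: (integrableZl measurableT _ (hspace_inner_integrable fH hH)).
  + exact: (hspace_inner_integrable gH hH).
  by apply: eq_Rintegral => x _; rewrite Re_scaleD Im_scaleD; ring.
- by move=> f g _ _; apply: eq_Rintegral => x _; congr (_ + _); rewrite mulrC.
- by move=> f _; exact: rinner_ge0.
Qed.

Lemma fourier_scaleD a f g w : Hspace E f -> Hspace E g ->
  fourier E (a *: f + g) w = a *: (fourier E f w : Rcomplex R) + fourier E g w.
Proof.
move=> fH gH; rewrite !fourierE.
have lin (p1 q1 p2 q2 : 'rV[R]_d -> R) :
    leb.-integrable setT (EFin \o p1) -> leb.-integrable setT (EFin \o q1) ->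
    leb.-integrable setT (EFin \o p2) -> leb.-integrable setT (EFin \o q2) ->
    fre (fun x => a * p1 x + p2 x) (fun x => a * q1 x + q2 x) w = a * fre p1 q1 w + fre p2 q2 w.
  move=> ip1 iq1 ip2 iq2; rewrite /fre -RintegralZl//; last exact: integrable_fre.
  rewrite -RintegralD//; [|exact: (integrableZl measurableT _ (integrable_fre _ ip1 iq1))|exact: integrable_fre].
  by apply: eq_Rintegral => x _; ring.
have irf := integrable_re_on fH; have iif := integrable_im_on fH.
have irg := integrable_re_on gH; have iig := integrable_im_on gH.
have rE : re_on E (a *: f + g) = (fun x => a * re_on E f x + re_on E g x).
  by apply/funext => x; rewrite /re_on !patchE; case: ifPn => _; rewrite ?Re_scaleD// mulr0 addr0.
have iE : im_on E (a *: f + g) = (fun x => a * im_on E f x + im_on E g x).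
  by apply/funext => x; rewrite /im_on !patchE; case: ifPn => _; rewrite ?Im_scaleD// mulr0 addr0.
have nE : \- re_on E (a *: f + g) = (fun x => a * (\- re_on E f) x + (\- re_on E g) x).
  by apply/funext => x /=; rewrite rE mulrN opprD.
by rewrite nE rE iE !lin//; exact: integrable_opp.
Qed.

End compact_support.
End hspace.

(** * Taylor expansion of the Fourier transform *)

Section cauchy_schwarz_sum.
Context {R : realType}.

Lemma sum_cauchy_schwarz (T : Type) (s : seq T) (x y : T -> R) :
  (\sum_(i <- s) x i * y i) ^+ 2 <= (\sum_(i <- s) x i ^+ 2) * (\sum_(i <- s) y i ^+ 2).
Proof.
pose b (f g : T -> R^o) : R := \sum_(i <- s) f i * g i.
have bP : @psd_form R (T -> R^o) setT b.
  split=> [a f g h _ _ _|f g _ _|f _].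
  - rewrite /b mulr_sumr -big_split; apply: eq_bigr => i _ /=.
    by rewrite mulrDl -mulrA.
  - by apply: eq_bigr => i _; rewrite mulrC.
  - by apply: sumr_ge0 => i _; rewrite -expr2 sqr_ge0.
have sT : @subspace R (T -> R^o) setT by [].
exact: (form_cauchy_schwarz sT bP (I : setT (x : T -> R^o)) (I : setT (y : T -> R^o))).
Qed.

Lemma sum_sqr_weighted (T : Type) (s : seq T) (a alpha : T -> R) : (forall i, 0 < alpha i) ->
  (\sum_(i <- s) a i) ^+ 2 <= (\sum_(i <- s) alpha i) * (\sum_(i <- s) a i ^+ 2 / alpha i).
Proof.
move=> alpha0; have sq i : Num.sqrt (alpha i) != 0 by rewrite gt_eqF// sqrtr_gt0.
have -> : \sum_(i <- s) a i = \sum_(i <- s) Num.sqrt (alpha i) * (a i / Num.sqrt (alpha i)).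
  by apply: eq_bigr => i _; rewrite mulrC divfK.
have -> : \sum_(i <- s) alpha i = \sum_(i <- s) Num.sqrt (alpha i) ^+ 2.
  by apply: eq_bigr => i _; rewrite sqr_sqrtr// ltW.
have -> : \sum_(i <- s) a i ^+ 2 / alpha i = \sum_(i <- s) (a i / Num.sqrt (alpha i)) ^+ 2.
  by apply: eq_bigr => i _; rewrite expr_div_n sqr_sqrtr// ltW.
exact: sum_cauchy_schwarz.
Qed.

End cauchy_schwarz_sum.

Section monomials.
Context {R : realType} {d : nat}.
Implicit Types x v : 'rV[R]_d.

(** Monomials are indexed by the ordered tuples of their variables, so that the
    powers of a dot product expand without multinomial coefficients. *)
Definition mon k (I : {ffun 'I_k -> 'I_d}) x : R := \prod_(j < k) x ord0 (I j).

Lemma dot_expn k v x : dot v x ^+ k = \sum_(I : {ffun 'I_k -> 'I_d}) mon I v * mon I x.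
Proof.
have -> : dot v x ^+ k = \prod_(j < k) dot v x by rewrite prodr_const card_ord.
rewrite bigA_distr_bigA /=; apply: eq_bigr => I _; rewrite big_split //.
Qed.

Lemma sum_mon_sqr k x : \sum_(I : {ffun 'I_k -> 'I_d}) mon I x ^+ 2 = dot x x ^+ k.
Proof. by rewrite dot_expn; apply: eq_bigr => I _; rewrite expr2. Qed.

Lemma dot_ge0 x : 0 <= dot x x.
Proof. by apply: sumr_ge0 => i _; rewrite -expr2 sqr_ge0. Qed.

Lemma sqr_enorm x : enorm x ^+ 2 = dot x x.
Proof. by rewrite sqr_sqrtr// dot_ge0. Qed.

Lemma dot_cauchy_schwarz v x : `|dot v x| <= enorm v * enorm x.
Proof.
rewrite -(ler_sqr (x := `|_|)) ?nnegrE ?mulr_ge0 ?sqrtr_ge0// real_normK ?num_real//.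
rewrite exprMn !sqr_enorm; have := sum_cauchy_schwarz (index_enum 'I_d) (fun i => v ord0 i) (fun i => x ord0 i).
by under [in leRHS]eq_bigr do rewrite expr2.
Qed.

Lemma mon_sqr_le k (I : {ffun 'I_k -> 'I_d}) x m : enorm x <= m -> mon I x ^+ 2 <= (m ^+ k) ^+ 2.
Proof.
move=> xm; apply: (@le_trans _ _ (dot x x ^+ k)).
  by rewrite -sum_mon_sqr (bigD1 I)//= lerDl sumr_ge0// => J _; exact: sqr_ge0.
by rewrite -sqr_enorm exprAC lerXn2r ?nnegrE ?exprn_ge0 ?sqrtr_ge0// ?lerXn2r ?nnegrE ?sqrtr_ge0// (le_trans _ xm) ?sqrtr_ge0.
Qed.

Lemma measurable_mon k (I : {ffun 'I_k -> 'I_d}) : measurable_fun setT (mon I).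
Proof. by apply: measurable_prod => j _; exact: (measurable_rv_coord (I j)). Qed.

End monomials.

Section trigonometric_coefficients.
Context {R : realType}.
Implicit Types a x : R.

(** kappa k - i sigma k = (- i)^k / k!. *)
Definition kappa k : R := cos_coeff 1 k.
Definition sigma k : R := sin_coeff 1 k.

Lemma cos_coeff_kappa x k : cos_coeff x k = kappa k * x ^+ k.
Proof. by rewrite /kappa /cos_coeff /= expr1n mulr1 mulrAC. Qed.

Lemma sin_coeff_sigma x k : sin_coeff x k = sigma k * x ^+ k.
Proof. by rewrite /sigma /sin_coeff /= expr1n mulr1 mulrAC. Qed.

Lemma kappa_sigma k : kappa k ^+ 2 + sigma k ^+ 2 = (k`!%:R^-1) ^+ 2.
Proof.
rewrite /kappa /sigma /cos_coeff /sin_coeff /= !expr1n !mulr1 !exprMn -!exprM.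
rewrite !(mulnC _ 2) !(exprM (-1)) !sqrrN !expr1n !mulr1.
by case: (odd k) => /=; rewrite ?expr1n ?expr0n /= ?mul0r ?mul1r ?addr0 ?add0r.
Qed.

Lemma kappa0 : kappa 0 = 1.
Proof. by rewrite /kappa /cos_coeff /= fact0 divr1 !mulr1. Qed.

Lemma sigma0 : sigma 0 = 0.
Proof. by rewrite /sigma /sin_coeff /= !mul0r. Qed.

Lemma kappa_le k : `|kappa k| <= k`!%:R^-1.
Proof.
rewrite -(ler_sqr (x := `|_|)) ?nnegrE ?invr_ge0// real_normK ?num_real//.
by rewrite -kappa_sigma lerDl sqr_ge0.
Qed.

Lemma sigma_le k : `|sigma k| <= k`!%:R^-1.
Proof.
rewrite -(ler_sqr (x := `|_|)) ?nnegrE ?invr_ge0// real_normK ?num_real//.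
by rewrite -kappa_sigma lerDr sqr_ge0.
Qed.

Lemma cvg_kappa x : \sum_(k < n) kappa k * x ^+ k @[n --> \oo] --> cos x.
Proof.
rewrite (_ : (fun n => _) = series (cos_coeff x)); first by rewrite unlock; exact: is_cvg_series_cos_coeff.
by apply/funext => n; rewrite /series /= big_mkord; apply: eq_bigr => k _; rewrite cos_coeff_kappa.
Qed.

Lemma cvg_sigma x : \sum_(k < n) sigma k * x ^+ k @[n --> \oo] --> sin x.
Proof.
rewrite (_ : (fun n => _) = series (sin_coeff x)); first by rewrite unlock; exact: is_cvg_series_sin_coeff.
by apply/funext => n; rewrite /series /= big_mkord; apply: eq_bigr => k _; rewrite sin_coeff_sigma.
Qed.

Lemma exp_partial_sum_le x n : 0 <= x -> \sum_(k < n) x ^+ k / k`!%:R <= expR x.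
Proof.
move=> x0; rewrite [leLHS](_ : _ = series (exp_coeff x) n); last by rewrite /series/= big_mkord.
apply: nondecreasing_cvgn_le; last exact: is_cvg_series_exp_coeff.
by apply: nondecreasing_series => k _ _; exact: exp_coeff_ge0.
Qed.

Lemma exp_partial_tail_le x n : 0 <= x -> \sum_(k < n) x ^+ k.+1 / k.+1`!%:R <= expR x - 1.
Proof.
move=> x0; rewrite lerBrDl; have := @exp_partial_sum_le x n.+1 x0.
by rewrite big_ord_recl /= expr0 fact0 divr1.
Qed.

Lemma trig_partial_le (c : nat -> R) x b n : (forall k, `|c k| <= k`!%:R^-1) -> `|x| <= b ->
  `|\sum_(k < n) c k * x ^+ k| <= expR b.
Proof.
move=> ck xb; have b0 : 0 <= b by exact: le_trans xb.
rewrite (le_trans _ (exp_partial_sum_le n b0))// (le_trans (ler_norm_sum _ _ _))//.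
apply: ler_sum => k _; rewrite normrM normrX mulrC.
by rewrite ler_pM ?exprn_ge0// lerXn2r ?nnegrE.
Qed.

End trigonometric_coefficients.

Section Rintegral_sum.
Context d (T : measurableType d) (R : realType) (mu : {measure set T -> \bar R}).

Lemma integrable_Rsum (I : Type) (s : seq I) (f : I -> T -> R) :
  (forall i, mu.-integrable setT (EFin \o f i)) ->
  mu.-integrable setT (EFin \o (fun x => \sum_(i <- s) f i x)).
Proof.
move=> fi; elim: s => [|i s IH].
  apply: eq_integrable (integrable0 mu setT) => // x _.
  by rewrite /= big_nil.
by apply: eq_integrable (integrableD measurableT (fi i) IH) => // x _; rewrite /= big_cons EFinD.
Qed.

Lemma Rintegral_sum (I : Type) (s : seq I) (f : I -> T -> R) :
  (forall i, mu.-integrable setT (EFin \o f i)) ->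
  \int[mu]_x (\sum_(i <- s) f i x) = \sum_(i <- s) \int[mu]_x f i x.
Proof.
move=> fi; elim: s => [|i s IH].
  rewrite big_nil; transitivity (\int[mu]_x (0 : R)); last by rewrite /Rintegral integral0.
  by apply: eq_Rintegral => x _; rewrite big_nil.
rewrite big_cons -IH -RintegralD//; last exact: integrable_Rsum.
by apply: eq_Rintegral => x _; rewrite big_cons.
Qed.

End Rintegral_sum.

Section fourier_taylor.
Context {R : realType} {d : nat}.
Notation leb := (@lebesgue_rv R d).
Variables (L m : R) (L0 : 0 < L) (m0 : 0 < m).
Variables (p t : 'rV[R]_d -> R).
Hypotheses (mp : measurable_fun setT p) (mt : measurable_fun setT t).
Hypotheses (sp : box_supported L p) (st : box_supported L t).
Hypotheses (ip2 : leb.-integrable setT (EFin \o (fun x => p x ^+ 2)))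
           (it2 : leb.-integrable setT (EFin \o (fun x => t x ^+ 2))).
Hypotheses (pm : forall x, p x != 0 -> enorm x <= m)
           (tm : forall x, t x != 0 -> enorm x <= m).
Implicit Types (v w x : 'rV[R]_d).

Let ip := integrable_of_sqr mp sp ip2.
Let it := integrable_of_sqr mt st it2.

Definition phase v x : R := 2 * pi * dot v x.

Let phase_le v x : enorm x <= m -> `|phase v x| <= 2 * pi * enorm v * m.
Proof.
move=> xm; have pi2 : 0 <= 2 * pi :> R by rewrite mulr_ge0 ?pi_ge0.
rewrite /phase normrM (ger0_norm pi2) -mulrA ler_wpM2l//.
by rewrite (le_trans (dot_cauchy_schwarz v x))// ler_wpM2l// sqrtr_ge0.
Qed.

Let mphase v : measurable_fun setT (phase v).
Proof. by apply: measurable_funM => //; exact: (measurable_dot (@measurable_cst _ _ _ _ _ v)). Qed.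

Let bounded_mul (a q : 'rV[R]_d -> R) b : measurable_fun setT a -> measurable_fun setT q ->
  (forall x, q x != 0 -> `|a x| <= b) -> leb.-integrable setT (EFin \o q) ->
  leb.-integrable setT (EFin \o (fun x => a x * q x)).
Proof.
move=> ma mq ab iq; apply: (le_integrable _ _ _ (integrableZl measurableT b iq)) => //.
  by apply/measurable_EFinP; exact: measurable_funM.
move=> x _; rewrite lee_fin; have [->|/ab axb] := eqVneq (q x) 0; first by rewrite !mulr0.
by rewrite !normrM ler_wpM2r// (le_trans axb)// ler_norm.
Qed.

(** zr and zi are the real and imaginary parts of the transform Z_k of
    (2 pi v.x)^k f(x); cr and ci are those of (- i)^k / k! Z_k, the k-th term
    of the Taylor series of f^(w + v). *)
Definition zr k v w := fre (fun x => phase v x ^+ k * p x) (fun x => phase v x ^+ k * t x) w.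
Definition zi k v w := fre (fun x => phase v x ^+ k * t x) (fun x => - (phase v x ^+ k * p x)) w.
Definition cr k v w := kappa k * zr k v w + sigma k * zi k v w.
Definition ci k v w := kappa k * zi k v w - sigma k * zr k v w.

Lemma taylor_term_sqr k v w : cr k v w ^+ 2 + ci k v w ^+ 2 =
  (k`!%:R^-1) ^+ 2 * (zr k v w ^+ 2 + zi k v w ^+ 2).
Proof. by rewrite -kappa_sigma /cr /ci; ring. Qed.

Lemma taylor_term0 v w : cr 0 v w = fre p t w /\ ci 0 v w = fre t (\- p) w.
Proof.
rewrite /cr /ci kappa0 sigma0 !mul1r !mul0r addr0 subr0 /zr /zi; split;
  apply: eq_Rintegral => x _; by rewrite !expr0 !mul1r.
Qed.

Let iphase (q : 'rV[R]_d -> R) v k : measurable_fun setT q -> (forall x, q x != 0 -> enorm x <= m) ->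
  leb.-integrable setT (EFin \o q) -> leb.-integrable setT (EFin \o (fun x => phase v x ^+ k * q x)).
Proof.
move=> mq qm iq; apply: (@bounded_mul _ _ ((2 * pi * enorm v * m) ^+ k)) => //.
  exact: measurable_funX.
move=> x /qm/(phase_le v) pb; rewrite normrX lerXn2r ?nnegrE//.
exact: le_trans pb.
Qed.

Let trig_series (c : nat -> R) (a b : R) n :
  a * (\sum_(k < n) c k * b ^+ k) = \sum_(k < n) c k * (b ^+ k * a).
Proof. by rewrite mulr_sumr; apply: eq_bigr => k _; ring. Qed.

Let partial_sums v w n :
  \sum_(k < n) cr k v w = \int[leb]_x
    ((p x * cos (2 * pi * dot w x) + t x * sin (2 * pi * dot w x)) * (\sum_(k < n) kappa k * phase v x ^+ k) +
     (t x * cos (2 * pi * dot w x) - p x * sin (2 * pi * dot w x)) * (\sum_(k < n) sigma k * phase v x ^+ k)) /\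
  \sum_(k < n) ci k v w = \int[leb]_x
    ((t x * cos (2 * pi * dot w x) - p x * sin (2 * pi * dot w x)) * (\sum_(k < n) kappa k * phase v x ^+ k) -
     (p x * cos (2 * pi * dot w x) + t x * sin (2 * pi * dot w x)) * (\sum_(k < n) sigma k * phase v x ^+ k)).
Proof.
have iNp k : leb.-integrable setT (EFin \o (fun x => - (phase v x ^+ k * p x))).
  exact: (integrable_opp (iphase v k mp pm ip)).
have ir k := integrable_fre w (iphase v k mp pm ip) (iphase v k mt tm it).
have ii k := integrable_fre w (iphase v k mt tm it) (iNp k).
split.
  transitivity (\int[leb]_x \sum_(k < n) (kappa k * (phase v x ^+ k * p x * cos (2 * pi * dot w x) +
      phase v x ^+ k * t x * sin (2 * pi * dot w x)) +
      sigma k * (phase v x ^+ k * t x * cos (2 * pi * dot w x) + - (phase v x ^+ k * p x) * sin (2 * pi * dot w x)))).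
    rewrite Rintegral_sum.
      apply: eq_bigr => k _; rewrite RintegralD// ?RintegralZl//.
        exact: (integrableZl measurableT _ (ir k)).
      exact: (integrableZl measurableT _ (ii k)).
    move=> k; exact: (integrableD measurableT (integrableZl measurableT _ (ir k)) (integrableZl measurableT _ (ii k))).
  apply: eq_Rintegral => x _; rewrite !trig_series -big_split; apply: eq_bigr => k _ /=; ring.
transitivity (\int[leb]_x \sum_(k < n) (kappa k * (phase v x ^+ k * t x * cos (2 * pi * dot w x) +
      - (phase v x ^+ k * p x) * sin (2 * pi * dot w x)) -
      sigma k * (phase v x ^+ k * p x * cos (2 * pi * dot w x) + phase v x ^+ k * t x * sin (2 * pi * dot w x)))).
  rewrite Rintegral_sum.
    apply: eq_bigr => k _; rewrite RintegralB// ?RintegralZl//.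
      exact: (integrableZl measurableT _ (ii k)).
    exact: (integrableZl measurableT _ (ir k)).
  move=> k; exact: (integrableB measurableT (integrableZl measurableT _ (ii k)) (integrableZl measurableT _ (ir k))).
apply: eq_Rintegral => x _; rewrite !trig_series -sumrB; apply: eq_bigr => k _ /=; ring.
Qed.

(** Expand exp (- i phase) under the integral: the phase is bounded by b on the
    support, so expR b (|p| + |t|) dominates each half of the partial sums. *)
Lemma taylor_cvg v w :
  \sum_(k < n) cr k v w @[n --> \oo] --> fre p t (w + v) /\
  \sum_(k < n) ci k v w @[n --> \oo] --> fre t (\- p) (w + v).
Proof.
pose b := 2 * pi * enorm v * m.
pose X x := p x * cos (2 * pi * dot w x) + t x * sin (2 * pi * dot w x).
pose Y x := t x * cos (2 * pi * dot w x) - p x * sin (2 * pi * dot w x).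
have mc : measurable_fun setT (fun x => cos (2 * pi * dot w x)).
  by apply: (measurable_trig_dot (@continuous_cos R)) => //; exact: measurable_cst.
have ms : measurable_fun setT (fun x => sin (2 * pi * dot w x)).
  by apply: (measurable_trig_dot (@continuous_sin R)) => //; exact: measurable_cst.
have mX : measurable_fun setT X by apply: measurable_funD; exact: measurable_funM.
have mY : measurable_fun setT Y by apply: measurable_funB; exact: measurable_funM.
have XB x : `|X x| <= `|p x| + `|t x|.
  by rewrite (le_trans (ler_normD _ _))// lerD// normrM ler_piMr// ?cos_le1N ?sin_le1N.
have YB x : `|Y x| <= `|p x| + `|t x|.
  by rewrite addrC (le_trans (ler_normB _ _))// lerD// normrM ler_piMr// ?cos_le1N ?sin_le1N.
have mpoly (c : nat -> R) n : measurable_fun setT (fun x => \sum_(k < n) c k * phase v x ^+ k).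
  by apply: measurable_sum => k; apply: measurable_funM => //; exact: measurable_funX.
have bound (c : nat -> R) x n (Z : R) : (forall k, `|c k| <= k`!%:R^-1) -> `|Z| <= `|p x| + `|t x| ->
    `|Z * \sum_(k < n) c k * phase v x ^+ k| <= expR b * (`|p x| + `|t x|).
  move=> ck Zb; have [p0|/pm xm] := eqVneq (p x) 0; last first.
    by rewrite normrM mulrC ler_pM// (trig_partial_le _ ck (phase_le v xm)).
  have [t0|/tm xm] := eqVneq (t x) 0; last first.
    by rewrite normrM mulrC ler_pM// (trig_partial_le _ ck (phase_le v xm)).
  by move: Zb; rewrite p0 t0 normr0 addr0 normr_le0 => /eqP ->; rewrite mul0r normr0 mulr0.
have ig : leb.-integrable setT (EFin \o (fun x => 2 * expR b * (`|p x| + `|t x|))).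
  exact: (integrableZl measurableT _ (integrableD measurableT (integrable_norm ip) (integrable_norm it))).
have phw x : 2 * pi * dot (w + v) x = 2 * pi * dot w x + phase v x.
  rewrite /phase -mulrDr; congr (_ * _); rewrite /dot -big_split; apply: eq_bigr => i _ /=.
  by rewrite mxE mulrDl.
split.
  rewrite (_ : (fun n => _) = (fun n => \int[leb]_x
    (X x * (\sum_(k < n) kappa k * phase v x ^+ k) + Y x * (\sum_(k < n) sigma k * phase v x ^+ k)))); last first.
    by apply/funext => n; have [-> _] := partial_sums v w n.
  rewrite (_ : fre p t (w + v) = \int[leb]_x (X x * cos (phase v x) + Y x * sin (phase v x))); last first.
    by apply: eq_Rintegral => x _; rewrite phw cosD sinD /X /Y; ring.
  apply: (Rdominated_convergence (mu := leb) _ _ _ ig).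
  - by move=> n; apply: measurable_funD; exact: measurable_funM.
  - apply: measurable_funD; apply: measurable_funM => //;
      apply: measurableT_comp => //; apply: continuous_measurable_fun;
      [exact: continuous_cos|exact: continuous_sin].
  - by apply: aeW => x; apply: cvgD; apply: cvgMr; [exact: cvg_kappa|exact: cvg_sigma].
  - move=> n x; rewrite -mulrA mulr_natl mulr2n (le_trans (ler_normD _ _))// lerD// bound//.
      exact: kappa_le.
    exact: sigma_le.
rewrite (_ : (fun n => _) = (fun n => \int[leb]_x
  (Y x * (\sum_(k < n) kappa k * phase v x ^+ k) - X x * (\sum_(k < n) sigma k * phase v x ^+ k)))); last first.
  by apply/funext => n; have [_ ->] := partial_sums v w n.
rewrite (_ : fre t (\- p) (w + v) = \int[leb]_x (Y x * cos (phase v x) - X x * sin (phase v x))); last first.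
  by apply: eq_Rintegral => x _; rewrite phw cosD sinD /X /Y /=; ring.
apply: (Rdominated_convergence (mu := leb) _ _ _ ig).
- by move=> n; apply: measurable_funB; exact: measurable_funM.
- apply: measurable_funB; apply: measurable_funM => //;
    apply: measurableT_comp => //; apply: continuous_measurable_fun;
    [exact: continuous_cos|exact: continuous_sin].
- by apply: aeW => x; apply: cvgB; apply: cvgMr; [exact: cvg_kappa|exact: cvg_sigma].
- move=> n x; rewrite -mulrA mulr_natl mulr2n (le_trans (ler_normB _ _))// lerD// bound//.
    exact: kappa_le.
  exact: sigma_le.
Qed.

Definition mom k (I : {ffun 'I_k -> 'I_d}) w : R :=
  fenergy (fun x => mon I x * p x) (fun x => mon I x * t x) w.

(** The squared length of the tensor of k-th order derivatives of f^ at w, up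
    to the factor (2 pi)^(2k). *)
Definition moment_sqr k w : R := \sum_(I : {ffun 'I_k -> 'I_d}) mom I w.

Lemma moment_sqr_ge0 k w : 0 <= moment_sqr k w.
Proof. by apply: sumr_ge0 => I _; exact: fenergy_ge0. Qed.

Let mmon (q : 'rV[R]_d -> R) k (I : {ffun 'I_k -> 'I_d}) : measurable_fun setT q ->
  measurable_fun setT (fun x => mon I x * q x).
Proof. by move=> mq; apply: measurable_funM => //; exact: measurable_mon. Qed.

Let imon (q : 'rV[R]_d -> R) k (I : {ffun 'I_k -> 'I_d}) : measurable_fun setT q ->
  (forall x, q x != 0 -> enorm x <= m) ->
  leb.-integrable setT (EFin \o q) -> leb.-integrable setT (EFin \o (fun x => mon I x * q x)).
Proof.
move=> mq qm iq; apply: (@bounded_mul _ _ (m ^+ k)) => //; first exact: measurable_mon.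
move=> x /qm xm; rewrite -(ler_sqr (x := `|_|)) ?nnegrE ?exprn_ge0 ?(ltW m0)//.
by rewrite real_normK ?num_real// mon_sqr_le.
Qed.

Let imon2 (q : 'rV[R]_d -> R) k (I : {ffun 'I_k -> 'I_d}) : measurable_fun setT q ->
  (forall x, q x != 0 -> enorm x <= m) ->
  leb.-integrable setT (EFin \o (fun x => q x ^+ 2)) ->
  leb.-integrable setT (EFin \o (fun x => (mon I x * q x) ^+ 2)).
Proof.
move=> mq qm iq.
have -> : (fun x => (mon I x * q x) ^+ 2) = (fun x => mon I x ^+ 2 * q x ^+ 2).
  by apply/funext => x; rewrite exprMn.
apply: (@bounded_mul _ _ ((m ^+ k) ^+ 2)) => //.
- by apply: measurable_funX; exact: measurable_mon.
- exact: measurable_funX.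
- move=> x; rewrite sqrf_eq0 => /qm xm; rewrite ger0_norm ?sqr_ge0//; exact: mon_sqr_le.
Qed.

Lemma measurable_moment_sqr k : measurable_fun setT (moment_sqr k).
Proof. by apply: measurable_sum => I; apply: measurable_fenergy; exact: mmon. Qed.

Let zr_mon k v w : zr k v w = (2 * pi) ^+ k *
  \sum_(I : {ffun 'I_k -> 'I_d}) mon I v * fre (fun x => mon I x * p x) (fun x => mon I x * t x) w.
Proof.
have i1 (I : {ffun 'I_k -> 'I_d}) := integrable_fre w (imon I mp pm ip) (imon I mt tm it).
under eq_bigr do rewrite -RintegralZl//.
rewrite -Rintegral_sum; last by move=> I; exact: (integrableZl measurableT _ (i1 I)).
rewrite -RintegralZl//; last first.
  by apply: integrable_Rsum => I; exact: (integrableZl measurableT _ (i1 I)).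
apply: eq_Rintegral => x _; rewrite /phase exprMn dot_expn -!mulrA -mulrDr; congr (_ * _).
rewrite !mulr_suml -big_split; apply: eq_bigr => I _ /=; ring.
Qed.

Let zi_mon k v w : zi k v w = (2 * pi) ^+ k *
  \sum_(I : {ffun 'I_k -> 'I_d}) mon I v * fre (fun x => mon I x * t x) (\- (fun x => mon I x * p x)) w.
Proof.
have iN (I : {ffun 'I_k -> 'I_d}) : leb.-integrable setT (EFin \o (\- (fun x => mon I x * p x))).
  exact: (integrable_opp (imon I mp pm ip)).
have i1 (I : {ffun 'I_k -> 'I_d}) := integrable_fre w (imon I mt tm it) (iN I).
under eq_bigr do rewrite -RintegralZl//.
rewrite -Rintegral_sum; last by move=> I; exact: (integrableZl measurableT _ (i1 I)).
rewrite -RintegralZl//; last first.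
  by apply: integrable_Rsum => I; exact: (integrableZl measurableT _ (i1 I)).
apply: eq_Rintegral => x _; rewrite /phase exprMn dot_expn.
set S := \sum_(_ | _) _ * _.
transitivity ((2 * pi) ^+ k * (S * (t x * cos (2 * pi * dot w x) - p x * sin (2 * pi * dot w x)))).
  by ring.
by rewrite mulr_suml; congr (_ * _); apply: eq_bigr => I _ /=; ring.
Qed.

(** The k-th derivative along v contracts the derivative tensor with the k-fold
    tensor power of v; Cauchy-Schwarz over the index tuples. *)
Lemma taylor_moment_le k v w :
  zr k v w ^+ 2 + zi k v w ^+ 2 <= ((2 * pi * enorm v) ^+ k) ^+ 2 * moment_sqr k w.
Proof.
rewrite zr_mon zi_mon; set a := (2 * pi) ^+ k.
have -> : ((2 * pi * enorm v) ^+ k) ^+ 2 = a ^+ 2 * (enorm v ^+ k) ^+ 2 by rewrite [(2 * pi * _) ^+ k]exprMn exprMn.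
set S1 := \sum_(_ | _) _; set S2 := \sum_(_ | _) _.
rewrite (_ : _ + _ = a ^+ 2 * (S1 ^+ 2 + S2 ^+ 2)); last by ring.
rewrite -mulrA ler_wpM2l ?sqr_ge0// /S1 /S2.
have -> : (enorm v ^+ k) ^+ 2 = \sum_(I : {ffun 'I_k -> 'I_d}) mon I v ^+ 2.
  by rewrite sum_mon_sqr -sqr_enorm -!exprM mulnC.
rewrite /moment_sqr /mom /fenergy big_split mulrDr.
by apply: lerD; exact: sum_cauchy_schwarz.
Qed.

Let e2 := \int[leb]_x (p x ^+ 2 + t x ^+ 2).

(** Plancherel for each product of f by a monomial; the squares of the
    monomials of degree k add up to |x|^(2k) <= m^(2k). *)
Lemma integral_moment_le k :
  (\int[leb]_w (moment_sqr k w)%:E <= ((m ^+ k) ^+ 2 * e2)%:E)%E.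
Proof.
have sm (q : 'rV[R]_d -> R) (I : {ffun 'I_k -> 'I_d}) : box_supported L q ->
    box_supported L (fun x => mon I x * q x).
  by move=> sq x; rewrite mulf_eq0 negb_or => /andP[_ /sq].
have B (I : {ffun 'I_k -> 'I_d}) := plancherel_l2 L0 (mmon I mp) (mmon I mt) (sm _ I sp) (sm _ I st)
   (imon2 I mp pm ip2) (imon2 I mt tm it2).
under eq_integral do rewrite -sumEFin.
rewrite ge0_integral_sum//; last 2 first.
- by move=> I; apply/measurable_EFinP; apply: measurable_fenergy; exact: mmon.
- by move=> I x _; rewrite lee_fin; exact: fenergy_ge0.
under eq_bigr do rewrite B.
rewrite -ge0_integral_sum//; last 2 first.
- by move=> I; apply/measurable_EFinP; apply: measurable_funD; apply: measurable_funX; exact: mmon.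
- by move=> I x _; rewrite lee_fin addr_ge0 ?sqr_ge0.
have ie : leb.-integrable setT (EFin \o (fun x => p x ^+ 2 + t x ^+ 2)).
  exact: (integrableD measurableT ip2 it2).
have -> : ((m ^+ k) ^+ 2 * e2)%:E = (\int[leb]_x ((m ^+ k) ^+ 2 * (p x ^+ 2 + t x ^+ 2))%:E)%E.
  under eq_integral do rewrite EFinM.
  rewrite integralZl// EFinM; congr (_ * _)%E; rewrite /e2 /Rintegral fineK//.
  exact: (integrable_fin_num measurableT ie).
apply: ge0_le_integral => //.
- by move=> x _; apply: sume_ge0 => I _; rewrite lee_fin addr_ge0 ?sqr_ge0.
- apply: emeasurable_sum => I; apply/measurable_EFinP; apply: measurable_funD; apply: measurable_funX; exact: mmon.
- by apply/measurable_EFinP; apply: measurable_funM => //; apply: measurable_funD; exact: measurable_funX.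
move=> x _; rewrite sumEFin lee_fin.
have -> : \sum_(I : {ffun 'I_k -> 'I_d}) ((mon I x * p x) ^+ 2 + (mon I x * t x) ^+ 2) =
    dot x x ^+ k * (p x ^+ 2 + t x ^+ 2).
  by rewrite -sum_mon_sqr mulr_suml; apply: eq_bigr => I _; ring.
have le0 : enorm x <= m -> dot x x ^+ k * (p x ^+ 2 + t x ^+ 2) <= (m ^+ k) ^+ 2 * (p x ^+ 2 + t x ^+ 2).
  move=> xm; rewrite ler_wpM2r ?addr_ge0 ?sqr_ge0// -sqr_enorm exprAC.
  rewrite lerXn2r ?nnegrE ?exprn_ge0 ?sqrtr_ge0 ?(ltW m0)// lerXn2r ?nnegrE ?sqrtr_ge0 ?(ltW m0)//.
have [p0|/pm//] := eqVneq (p x) 0; have [t0|/tm//] := eqVneq (t x) 0.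
by rewrite p0 t0 !expr0n addr0 !mulr0.
Qed.

(** The Taylor series without its first s terms: f^ itself for s = 0, the
    increment of f^ for s = 1. *)
Section tail.
Variables (r A : R) (s : nat).
Hypotheses (r0 : 0 < r) (A0 : 0 < A)
  (Ale : forall n, \sum_(k < n) (r * m) ^+ (k + s) / (k + s)`!%:R <= A).

Definition tail_coef k : R := r ^+ (k + s) / m ^+ (k + s) / (k + s)`!%:R.

Lemma tail_coef_ge0 k : 0 <= tail_coef k.
Proof. by rewrite !divr_ge0 ?exprn_ge0 ?(ltW r0) ?(ltW m0). Qed.

(** What Cauchy-Schwarz leaves when the k-th Taylor term gets the weight (r
    m)^k / k!: its k-th term again has an integral of order (r m)^k / k!, so A
    bounds both factors. *)
Definition tail_majorant w : \bar R :=
  (\sum_(k <oo) (tail_coef k * moment_sqr (k + s) w)%:E)%E.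

Let term_ge0 k w : (0 <= (tail_coef k * moment_sqr (k + s) w)%:E)%E.
Proof. by rewrite lee_fin mulr_ge0 ?tail_coef_ge0 ?moment_sqr_ge0. Qed.

Lemma tail_majorant_ge0 w : (0 <= tail_majorant w)%E.
Proof. by apply: nneseries_ge0 => k _ _. Qed.

Lemma measurable_tail_majorant : measurable_fun setT tail_majorant.
Proof.
apply: ge0_emeasurable_sum => [k x _ _|k _]; first exact: term_ge0.
by apply/measurable_EFinP; apply: measurable_funM => //; exact: measurable_moment_sqr.
Qed.

Lemma integral_tail_majorant : (\int[leb]_w tail_majorant w <= (A * e2)%:E)%E.
Proof.
have e20 : 0 <= e2 by apply: Rintegral_ge0 => x _; rewrite addr_ge0 ?sqr_ge0.
have mterm k : measurable_fun setT (fun w => (tail_coef k * moment_sqr (k + s) w)%:E).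
  by apply/measurable_EFinP; apply: measurable_funM => //; exact: measurable_moment_sqr.
rewrite /tail_majorant integral_nneseries//.
apply: lime_le; first by apply: is_cvg_nneseries => k _ _; apply: integral_ge0.
apply: nearW => n; rewrite big_mkord.
apply: (@le_trans _ _ (\sum_(k < n) ((r * m) ^+ (k + s) / (k + s)`!%:R * e2)%:E)%E).
  apply: lee_sum => k _.
  under eq_integral do rewrite EFinM.
  rewrite ge0_integralZl//; last 3 first.
  - by apply/measurable_EFinP; exact: measurable_moment_sqr.
  - by move=> w _; rewrite lee_fin moment_sqr_ge0.
  - by rewrite lee_fin tail_coef_ge0.
  have := integral_moment_le (k + s); move=> H.
  apply: (le_trans (lee_wpmul2l _ H)); first by rewrite lee_fin tail_coef_ge0.
  rewrite -EFinM lee_fin mulrA ler_wpM2r// /tail_coef exprMn.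
  rewrite le_eqVlt; apply/orP; left; apply/eqP; field.
  by rewrite pnatr_eq0 -lt0n fact_gt0 expf_neq0// gt_eqF.
rewrite sumEFin lee_fin -mulr_suml ler_wpM2r//.
Qed.

Lemma taylor_tail_le v w : 2 * pi * enorm v <= r ->
  (((fre p t (w + v) - \sum_(k < s) cr k v w) ^+ 2 + (fre t (\- p) (w + v) - \sum_(k < s) ci k v w) ^+ 2)%:E
   <= A%:E * tail_majorant w)%E.
Proof.
move=> vr; have [c1 c2] := taylor_cvg v w.
pose alpha k : R := (r * m) ^+ (k + s) / (k + s)`!%:R.
have alpha0 k : 0 < alpha k.
  by rewrite divr_gt0 ?exprn_gt0 ?mulr_gt0// ltr0n fact_gt0.
pose S1 n := \sum_(k < n) cr (k + s) v w; pose S2 n := \sum_(k < n) ci (k + s) v w.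
have shift (a : nat -> R) n : \sum_(k < n) a (k + s)%N = \sum_(k < n + s) a k - \sum_(k < s) a k.
  by rewrite (addnC n) big_split_ord /= addrAC subrr add0r; apply: eq_bigr => k _; rewrite addnC.
have c1' : S1 n @[n --> \oo] --> fre p t (w + v) - \sum_(k < s) cr k v w.
  rewrite /S1 (_ : (fun n => _) = (fun n => \sum_(k < n + s) cr k v w - \sum_(k < s) cr k v w)).
    by apply: cvgB; [rewrite (cvg_shiftn s (fun n => \sum_(k < n) cr k v w))|exact: cvg_cst].
  by apply/funext => n; rewrite (shift (fun k => cr k v w)).
have c2' : S2 n @[n --> \oo] --> fre t (\- p) (w + v) - \sum_(k < s) ci k v w.
  rewrite /S2 (_ : (fun n => _) = (fun n => \sum_(k < n + s) ci k v w - \sum_(k < s) ci k v w)).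
    by apply: cvgB; [rewrite (cvg_shiftn s (fun n => \sum_(k < n) ci k v w))|exact: cvg_cst].
  by apply/funext => n; rewrite (shift (fun k => ci k v w)).
have cE : (S1 n ^+ 2 + S2 n ^+ 2)%:E @[n --> \oo] -->
    ((fre p t (w + v) - \sum_(k < s) cr k v w) ^+ 2 + (fre t (\- p) (w + v) - \sum_(k < s) ci k v w) ^+ 2)%:E.
  by apply: cvg_EFin; [exact: nearW|apply: cvgD; apply: cvgM].
apply: (cvge_to_le (f := fun n => (S1 n ^+ 2 + S2 n ^+ 2)%:E) cE).
apply: nearW => n.
have W1 := sum_sqr_weighted (index_enum 'I_n) (fun k : 'I_n => cr (k + s) v w) (fun k => alpha0 k).
have W2 := sum_sqr_weighted (index_enum 'I_n) (fun k : 'I_n => ci (k + s) v w) (fun k => alpha0 k).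
have AD : S1 n ^+ 2 + S2 n ^+ 2 <= A * \sum_(k < n) tail_coef k * moment_sqr (k + s) w.
  apply: (le_trans (lerD W1 W2)); rewrite -mulrDr -big_split /=.
  apply: ler_pM => //.
  - by apply: sumr_ge0 => k _; exact: ltW.
  - by apply: sumr_ge0 => k _; rewrite addr_ge0// divr_ge0 ?sqr_ge0// ltW.
  - exact: Ale.
  apply: ler_sum => k _; rewrite -mulrDl taylor_term_sqr ler_pdivrMr//.
  have := taylor_moment_le (k + s) v w.
  have rk : ((2 * pi * enorm v) ^+ (k + s)) ^+ 2 <= (r ^+ (k + s)) ^+ 2.
    have v0 : 0 <= 2 * pi * enorm v by rewrite !mulr_ge0 ?pi_ge0 ?sqrtr_ge0.
    by rewrite !lerXn2r ?nnegrE ?exprn_ge0 ?(ltW r0).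
  move=> /le_trans/(_ (ler_wpM2r (moment_sqr_ge0 _ _) rk)) Z.
  apply: (le_trans (ler_wpM2l (sqr_ge0 _) Z)).
  rewrite mulrA [leRHS]mulrAC ler_wpM2r ?moment_sqr_ge0// /tail_coef /alpha exprMn.
  rewrite le_eqVlt; apply/orP; left; apply/eqP; field.
  by rewrite pnatr_eq0 -lt0n fact_gt0 expf_neq0// gt_eqF.
apply: (@le_trans _ _ (A * \sum_(k < n) tail_coef k * moment_sqr (k + s) w)%:E); first by rewrite lee_fin.
rewrite EFinM lee_wpmul2l ?lee_fin ?(ltW A0)// -sumEFin.
rewrite /tail_majorant -(big_mkord xpredT (fun k => (tail_coef k * moment_sqr (k + s) w)%:E)).
by apply: nneseries_lim_ge => k _ _.
Qed.

End tail.

End fourier_taylor.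

(** * Norms and Voronoi cells *)

Section norms.
Context {R : realType} {d : nat}.
Variables (N : 'rV[R]_d -> R) (hN : is_norm N).
Implicit Types x y w : 'rV[R]_d.

Lemma norm_triangle x y : N (x + y) <= N x + N y. Proof. by case: hN. Qed.

Lemma normZ a x : N (a *: x) = `|a| * N x. Proof. by case: hN. Qed.

Lemma norm_zero : N 0 = 0.
Proof. by rewrite -(scale0r (0 : 'rV[R]_d)) normZ normr0 mul0r. Qed.

Lemma norm_opp x : N (- x) = N x.
Proof. by rewrite -scaleN1r normZ normrN1 mul1r. Qed.

Lemma norm_sym x y : N (x - y) = N (y - x).
Proof. by rewrite -norm_opp opprB. Qed.

Lemma norm_ge0 x : 0 <= N x.
Proof.
have := norm_triangle x (- x); rewrite subrr norm_zero norm_opp -mulr2n.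
by rewrite pmulrn_lge0.
Qed.

Lemma norm_dist_triangle x y w : N (x - w) <= N (x - y) + N (y - w).
Proof. by rewrite -(subrKA y) norm_triangle. Qed.

Lemma norm_lipschitz : exists2 C, 0 < C & forall x, N x <= C * `|x|.
Proof.
pose C := \sum_(i < d) N (delta_mx 0 i).
have C0 : 0 <= C by apply: sumr_ge0 => i _; exact: norm_ge0.
exists (C + 1); first by rewrite ltr_pwDr.
move=> x; have /(_ (index_enum 'I_d)) step : forall s : seq 'I_d,
    N (\sum_(i <- s) x ord0 i *: delta_mx 0 i) <= \sum_(i <- s) `|x| * N (delta_mx 0 i).
  elim=> [|i s IH]; first by rewrite !big_nil norm_zero.
  rewrite !big_cons (le_trans (norm_triangle _ _))// lerD// normZ.
  by rewrite ler_wpM2r ?norm_ge0// coord_le_norm.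
rewrite [in leLHS](row_sum_delta x) (le_trans step)// -mulr_sumr mulrC ler_wpM2r//.
by rewrite lerDl.
Qed.

Lemma norm_continuous : continuous N.
Proof.
have [C C0 NC] := norm_lipschitz => x; apply/(@cvgrPdist_lt _ _ _ _ (nbhs_filter x)) => e e0.
have eC : 0 < e / C by rewrite divr_gt0.
apply/nbhs_ballP; exists (e / C) => //= y; rewrite mx_norm_ball /ball_/= => xy.
have H a b : N a - N b <= N (a - b).
  by rewrite lerBlDr; have := norm_dist_triangle a b 0; rewrite !subr0.
apply: (@le_lt_trans _ _ (C * `|x - y|)); last by rewrite mulrC -ltr_pdivlMr.
rewrite (le_trans _ (NC _))// ler_norml H andbT lerNl opprB norm_sym; exact: H.
Qed.

Lemma norm_measurable : measurable_fun setT N.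
Proof. by apply: continuous_measurable_rv; exact: norm_continuous. Qed.

End norms.

(** Injecting the index set into nat turns the intersection into one over nat
    of sets that are single H i or the whole space. *)
Lemma countable_bigcap_measurable d (T : measurableType d) (I : pointedType) (D : set I)
    (H : I -> set T) :
  countable D -> (forall i, D i -> measurable (H i)) -> measurable (\bigcap_(i in D) H i).
Proof.
move=> /countable_injP[f finj] mH.
rewrite (_ : \bigcap_(i in D) H i = \bigcap_n \bigcap_(i in D `&` [set i | f i = n]) H i); last first.
  apply/seteqP; split=> y Hy; first by move=> n _ i [Di _]; exact: Hy.
  by move=> i Di; apply: (Hy (f i)).
apply: bigcapT_measurable => n.
have [[i [Di fi]]|none] := pselect (exists i, D i /\ f i = n).
  rewrite (_ : D `&` _ = [set i]) ?bigcap_set1; first exact: mH.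
  apply/seteqP; split=> [j [Dj fj]|j ->//].
  by apply: finj; [exact: mem_set|exact: mem_set|exact: (etrans fj (esym fi))].
rewrite (_ : D `&` _ = set0) ?bigcap_set0//.
by apply/seteqP; split=> // j [Dj fj]; apply: none; exists j.
Qed.

Section finite_overlap.
Context d (T : measurableType d) (R : realType) (mu : {measure set T -> \bar R}).

(** The cells of a Voronoi tessellation are not disjoint, but overlap in null
    sets. *)
Lemma ge0_integral_setU_null (A B : set T) (f : T -> \bar R) :
  measurable A -> measurable B -> measurable_fun setT f -> (forall x, (0 <= f x)%E) ->
  mu (A `&` B) = 0%E ->
  (\int[mu]_(x in A `|` B) f x = \int[mu]_(x in A) f x + \int[mu]_(x in B) f x)%E.
Proof.
move=> mA mB mf f0 AB.
have -> : A `|` B = A `|` (B `\` A).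
  apply/seteqP; split=> x [Ax|]; try by left.
    by move=> Bx; case: (pselect (A x)) => Ax; [left|right].
  by case=> Bx _; right.
have mBA : measurable (B `\` A) by exact: measurableD.
rewrite ge0_integral_setU//; last 2 first.
- exact: measurable_funTS.
- by apply/disj_setPS => x [Ax []].
congr (_ + _)%E.
have EB : (B `&` A) `|` (B `\` A) = B.
  apply/seteqP; split=> [x [[]|[]]//|x Bx].
  by case: (pselect (A x)) => Ax; [left|right].
rewrite -[in RHS]EB ge0_integral_setU//; last 3 first.
- exact: measurableI.
- exact: measurable_funTS.
- by apply/disj_setPS => x [[_ Ax] []].
rewrite [X in _ = (X + _)%E](_ : _ = 0%E) ?add0e//.
apply: null_set_integral => //; first exact: measurableI.
  exact: measurable_funTS.
by rewrite setIC.
Qed.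

Lemma ge0_integral_bigsetU_null (I : eqType) (s : seq I) (V : I -> set T) (f : T -> \bar R) :
  uniq s -> (forall i, i \in s -> measurable (V i)) ->
  measurable_fun setT f -> (forall x, (0 <= f x)%E) ->
  (forall i j, i \in s -> j \in s -> i != j -> mu (V i `&` V j) = 0%E) ->
  (\int[mu]_(x in \big[setU/set0]_(i <- s) V i) f x = \sum_(i <- s) \int[mu]_(x in V i) f x)%E.
Proof.
move=> + + mf f0; elim: s => [|i s IH]; first by rewrite !big_nil integral_set0.
move=> /= /andP[is_ us] mV nul; rewrite !big_cons.
have mVs j : j \in s -> measurable (V j) by move=> js; apply: mV; rewrite inE js orbT.
have mU : measurable (\big[setU/set0]_(j <- s) V j).
  rewrite big_seq; apply: bigsetU_measurable => j js; exact: mVs.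
rewrite ge0_integral_setU_null//; last 2 first.
- by apply: mV; rewrite inE eqxx.
- apply/eqP; rewrite eq_le measure_ge0 andbT.
  have nuls j : j \in s -> mu (V i `&` V j) = 0%E.
    move=> js; apply: nul; rewrite ?inE ?eqxx ?js ?orbT//.
    by apply: contraNneq is_ => ->.
  have mVi : measurable (V i) by apply: mV; rewrite inE eqxx.
  elim: s {IH is_ us mV nul mU} mVs nuls => [|j s IH] mVs nuls; first by rewrite big_nil setI0 measure0.
  rewrite big_cons setIUr.
  have mVj : measurable (V j) by apply: mVs; rewrite inE eqxx.
  have mVs' k : k \in s -> measurable (V k) by move=> ks; apply: mVs; rewrite inE ks orbT.
  have mU : measurable (\big[setU/set0]_(j <- s) V j).
    by rewrite big_seq; apply: bigsetU_measurable => k ks; exact: mVs'.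
  apply: (le_trans (measureU2 mu _ _)); [exact: measurableI|exact: measurableI|].
  rewrite -[leRHS]adde0; apply: leeD.
    by have /eqP := nuls j (mem_head j s); rewrite eq_le => /andP[].
  by apply: IH => // k ks; apply: nuls; rewrite inE ks orbT.
rewrite IH// => j k js ks jk; apply: nul => //; by rewrite inE ?js ?ks orbT.
Qed.

End finite_overlap.

Section voronoi_cells.
Context {R : realType} {d : nat}.
Variables (N : 'rV[R]_d -> R) (hN : is_norm N) (Om Z : set 'rV[R]_d).
Implicit Types x y w : 'rV[R]_d.

Lemma voronoi_measurable w : countable Om -> measurable Z -> measurable (voronoi N Om Z w).
Proof.
move=> fOm mZ.
rewrite (_ : voronoi N Om Z w = Z `&` \bigcap_(l in Om `&` [set l | l != w])
    [set y | N (w - y) <= N (l - y)]); last first.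
  apply/seteqP; split=> y.
    by move=> [Zy H]; split=> // l [Oml lw]; exact: H.
  by move=> [Zy H]; split=> // l Oml lw; exact: H.
apply: measurableI => //; apply: countable_bigcap_measurable.
  by apply: sub_countable fOm; apply: subset_card_le => l [].
move=> l _.
have mN z : measurable_fun setT (fun y => N (z - y)).
  apply: (measurableT_comp (norm_measurable hN)); apply: measurable_rv => i.
  rewrite (_ : (fun y => _) = (fun y => z ord0 i - y ord0 i)).
    apply: measurable_funB; first exact: measurable_cst.
    exact: measurable_rv_coord.
  by apply/funext => y; rewrite !mxE.
rewrite -[X in measurable X]setTI; exact: (measurable_fun_le measurableT (mN w) (mN l)).
Qed.

(** A finite set, so the infimum in the definition of density is attained. *)
Lemma nearest_point y : finite_set Om -> Om !=set0 ->
  exists2 w, Om w & forall l, Om l -> N (w - y) <= N (l - y).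
Proof.
move=> fOm [w0 Omw0].
have : forall s : seq 'rV[R]_d, s != [::] ->
    exists2 w, w \in s & forall l, l \in s -> N (w - y) <= N (l - y).
  elim=> // a s IH _; have [->|/IH[w ws wmin]] := eqVneq s [::].
    by exists a; rewrite ?inE// => l; rewrite inE => /eqP ->.
  have [aw|wa] := leP (N (a - y)) (N (w - y)).
    exists a; first by rewrite inE eqxx.
    by move=> l; rewrite inE => /predU1P[->//|/wmin]; exact: le_trans.
  exists w; first by rewrite inE ws orbT.
  by move=> l; rewrite inE => /predU1P[->|/wmin//]; exact: ltW.
move=> /(_ (finmap.enum_fset (fset_set Om))); have mem l : (l \in fset_set Om) = (l \in Om) by rewrite in_fset_set.
case.
  apply/eqP => s0; have : w0 \in fset_set Om by rewrite mem; exact: mem_set.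
  by move: s0 => /(congr1 (fun s => w0 \in s)); rewrite in_nil => H; rewrite -[X in X -> _]/(is_true (w0 \in finmap.enum_fset (fset_set Om))) H.
move=> w wOm wmin; exists w; first by move: wOm; rewrite mem => /set_mem.
by move=> l Oml; apply: wmin; rewrite mem mem_set.
Qed.

Lemma dense_nonempty delta : dense_in N Om Z delta -> Z !=set0 -> Om !=set0.
Proof.
move=> [_ _ supE] [y Zy]; apply/set0P/eqP => Om0.
have : (ereal_inf [set (N (w - y))%:E | w in Om] <= delta%:E)%E.
  by rewrite -supE; apply: ereal_sup_ubound; exists y.
by rewrite Om0 image_set0 ereal_inf0.
Qed.

Lemma dense_nearest delta y w : dense_in N Om Z delta -> Z y ->
  (forall l, Om l -> N (w - y) <= N (l - y)) -> N (w - y) <= delta.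
Proof.
move=> [_ _ supE] Zy wmin; rewrite -lee_fin.
apply: (@le_trans _ _ (ereal_inf [set (N (l - y))%:E | l in Om])).
  by apply: le_ereal_inf_tmp => _ [l Oml <-]; rewrite lee_fin wmin.
by rewrite -supE; apply: ereal_sup_ubound; exists y.
Qed.

Lemma voronoi_min y w l : voronoi N Om Z w y -> Om l -> N (w - y) <= N (l - y).
Proof. by move=> [_ H] Oml; have [->//|lw] := eqVneq l w; exact: H. Qed.

Lemma voronoi_dist delta y w : dense_in N Om Z delta -> voronoi N Om Z w y -> N (w - y) <= delta.
Proof.
move=> dOm Vy; have [Zy _] := Vy; apply: (dense_nearest dOm Zy) => l Oml.
exact: voronoi_min Vy Oml.
Qed.

Lemma voronoi_cover delta : finite_set Om -> dense_in N Om Z delta ->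
  \big[setU/set0]_(w <- fset_set Om) voronoi N Om Z w = Z.
Proof.
move=> fOm dOm; rewrite -bigcup_seq; apply/seteqP; split=> [y [w _ []]//|y Zy].
have [w Omw wmin] := nearest_point y fOm (dense_nonempty dOm (ex_intro _ y Zy)).
exists w; first by rewrite /= in_fset_set// mem_set.
by split=> // l Oml _; exact: wmin.
Qed.

Lemma voronoi_integral delta (f : 'rV[R]_d -> \bar R) : finite_set Om -> measurable Z ->
  dense_in N Om Z delta -> voronoi_tessellation N Om Z ->
  measurable_fun setT f -> (forall x, (0 <= f x)%E) ->
  (\sum_(w <- fset_set Om) \int[lebesgue_rv d]_(y in voronoi N Om Z w) f y =
   \int[lebesgue_rv d]_(y in Z) f y)%E.
Proof.
move=> fOm mZ dOm tess mf f0.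
have mem l : (l \in fset_set Om) = (l \in Om) by rewrite in_fset_set.
rewrite -ge0_integral_bigsetU_null//; last 2 first.
- by move=> w _; apply: voronoi_measurable => //; exact: finite_set_countable.
- by move=> w l; rewrite !mem => /set_mem Omw /set_mem Oml; exact: tess.
by rewrite (voronoi_cover fOm dOm).
Qed.

End voronoi_cells.

(** * Sampling inequalities on Voronoi cells *)

Section sampling.
Context {R : realType} {d : nat}.
Notation leb := (@lebesgue_rv R d).
Notation V := ('rV[R]_d -> Rcomplex R).
Variables (E : set 'rV[R]_d) (cE : compact E).
Variables (N : 'rV[R]_d -> R) (hN : is_norm N) (c delta : R).
Variables (Om Z : set 'rV[R]_d).
Hypotheses (c0 : 0 < c) (Nc : forall x, enorm x <= c * N x).
Hypotheses (fOm : finite_set Om) (mZ : measurable Z) (dOm : dense_in N Om Z delta)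
  (tess : voronoi_tessellation N Om Z).
Implicit Types (f g : V) (w y : 'rV[R]_d).

Let mE : measurable E. Proof. exact: compact_measurable_rv. Qed.

Let delta0 : 0 < delta. Proof. by case: dOm. Qed.

Definition sampled_energy f : \bar R :=
  (\sum_(w <- fset_set Om) voronoi_weight N Om Z w * (sqmod (fourier E f w))%:E)%E.

Definition cell_deviation f : \bar R :=
  (\sum_(w <- fset_set Om) \int[leb]_(y in voronoi N Om Z w)
     (sqmod (fourier E f y - fourier E f w))%:E)%E.

Lemma sampled_energyE f : sampled_energy f =
  (\sum_(w <- fset_set Om) \int[leb]_(y in voronoi N Om Z w) (sqmod (fourier E f w))%:E)%E.
Proof.
apply: eq_bigr => w _; rewrite muleC.
by rewrite -(integral_cst leb (voronoi_measurable hN w (finite_set_countable fOm) mZ)).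
Qed.

Section radius.
Variables (m : R) (m0 : 0 < m) (Em : forall x, E x -> enorm x <= m).

Let r := 2 * pi * c * delta.

Let r0 : 0 < r. Proof. by rewrite !mulr_gt0 ?pi_gt0. Qed.

Let re_on_supp L f : (forall x, E x -> box_indic L x = 1) -> box_supported L (re_on E f).
Proof. by move=> LE x; rewrite /re_on patchE; case: ifPn => [/set_mem/LE//|_]; rewrite eqxx. Qed.

Let im_on_supp L f : (forall x, E x -> box_indic L x = 1) -> box_supported L (im_on E f).
Proof. by move=> LE x; rewrite /im_on patchE; case: ifPn => [/set_mem/LE//|_]; rewrite eqxx. Qed.

(** The case s = 0 bounds f^(w), the case s = 1 bounds f^(w) - f^(y). On each
    cell the integrand is bounded by one function of y, the tail majorant, so
    the integrals over the cells add up to an integral over the window. *)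
Let cell_sum s A (g : 'rV[R]_d -> 'rV[R]_d -> R) f : Hspace E f -> 0 < A ->
  (forall n, \sum_(k < n) (r * m) ^+ (k + s) / (k + s)`!%:R <= A) ->
  (forall w, measurable_fun setT (g w)) ->
  (forall w y, 0 <= g w y) ->
  (forall w y, g w y = (fre (re_on E f) (im_on E f) w -
      \sum_(k < s) cr (re_on E f) (im_on E f) k (w - y) y) ^+ 2 +
    (fre (im_on E f) (\- re_on E f) w - \sum_(k < s) ci (re_on E f) (im_on E f) k (w - y) y) ^+ 2) ->
  (\sum_(w <- fset_set Om) \int[leb]_(y in voronoi N Om Z w) (g w y)%:E <=
   (A ^+ 2 * rinner f f)%:E)%E.
Proof.
move=> fH A0 Ale mg g0 gE; have [L L0 LE] := compact_sub_box cE.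
set p := re_on E f; set t := im_on E f.
have mp := measurable_re_on mE fH; have mt := measurable_im_on mE fH.
have sp := @re_on_supp L f LE; have st := @im_on_supp L f LE.
have ip := re_on_sqr mE fH; have it := im_on_sqr mE fH.
have pm x : p x != 0 -> enorm x <= m.
  by rewrite /p /re_on patchE; case: ifPn => [/set_mem/Em//|_]; rewrite eqxx.
have tm x : t x != 0 -> enorm x <= m.
  by rewrite /t /im_on patchE; case: ifPn => [/set_mem/Em//|_]; rewrite eqxx.
pose D := tail_majorant m p t r s.
have mD : measurable_fun setT D by exact: measurable_tail_majorant.
have D0 y : (0 <= D y)%E by exact: tail_majorant_ge0.
have e2E : \int[leb]_x (p x ^+ 2 + t x ^+ 2) = rinner f f.
  by rewrite rinner_sqmod /Rintegral (restrict_ae mE fH).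
have iD : (\int[leb]_y D y <= (A * rinner f f)%:E)%E.
  by rewrite -e2E; exact: (integral_tail_majorant L0 m0 mp mt sp st ip it pm tm r0 Ale).
have mAD : measurable_fun setT (fun y => A%:E * D y)%E by exact: emeasurable_funM.
apply: (@le_trans _ _ (\sum_(w <- fset_set Om) \int[leb]_(y in voronoi N Om Z w) (A%:E * D y))%E).
  apply: lee_sum => w _; apply: ge0_le_integral => //.
  - by apply: voronoi_measurable => //; exact: finite_set_countable.
  - by move=> y _; rewrite lee_fin.
  - by apply/measurable_EFinP; exact: measurable_funTS.
  - exact: measurable_funTS.
  move=> y Vy; rewrite gE.
  have vr : 2 * pi * enorm (w - y) <= r.
    rewrite /r -!mulrA ler_wpM2l// ler_wpM2l ?pi_ge0// (le_trans (Nc _))// ler_wpM2l ?(ltW c0)//.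
    exact: (voronoi_dist dOm Vy).
  have := taylor_tail_le m0 mp mt sp st ip it pm tm r0 A0 Ale y vr.
  by rewrite (_ : y + (w - y) = w)// addrC subrK.
rewrite (voronoi_integral hN fOm mZ dOm tess)//; last by move=> y; rewrite mule_ge0// lee_fin ltW.
apply: (@le_trans _ _ (\int[leb]_y (A%:E * D y))%E).
  by apply: ge0_subset_integral => // y _; rewrite mule_ge0// lee_fin ltW.
rewrite ge0_integralZl//; last by rewrite lee_fin ltW.
apply: (le_trans (lee_wpmul2l _ iD)); first by rewrite lee_fin ltW.
by rewrite -EFinM lee_fin mulrA -expr2.
Qed.

Lemma sampled_energy_radius f : Hspace E f -> (sampled_energy f <= (expR (r * m) ^+ 2 * rinner f f)%:E)%E.
Proof.
move=> fH; rewrite sampled_energyE.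
apply: (@cell_sum 0 _ (fun w _ => sqmod (fourier E f w))) => //.
- exact: expR_gt0.
- move=> n; under eq_bigr do rewrite addn0.
  by apply: exp_partial_sum_le; rewrite mulr_ge0 ?(ltW r0) ?(ltW m0).
- by move=> w y; exact: sqmod_ge0.
- by move=> w y; rewrite fourierE !big_ord0 !subr0.
Qed.

Lemma cell_deviation_radius f : Hspace E f -> (cell_deviation f <= ((expR (r * m) - 1) ^+ 2 * rinner f f)%:E)%E.
Proof.
move=> fH; apply: (@cell_sum 1 _ (fun w y => sqmod (fourier E f y - fourier E f w))) => //.
- by rewrite subr_gt0 expR_gt1 mulr_gt0.
- move=> n; under eq_bigr do rewrite addn1.
  by apply: exp_partial_tail_le; rewrite mulr_ge0 ?(ltW r0) ?(ltW m0).
- by move=> w; apply/measurable_EFinP; exact: measurable_sqmod_fourierB.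
- by move=> w y; exact: sqmod_ge0.
- move=> w y; rewrite !big_ord1.
  have [-> ->] := taylor_term0 (re_on E f) (im_on E f) (w - y) y.
  by rewrite !fourierE /sqmod /= -(sqrrN (_ - _)) opprB -[in X in _ + X](sqrrN (_ - _)) opprB.
Qed.

End radius.

Lemma sup_enorm_ub x : E x -> enorm x <= sup_enorm E.
Proof.
move=> Ex; apply: sup_ubound; last by exists x.
move: (cE) => /compact_bounded[M [_ ME]].
have M1 z : E z -> `|z| <= `|M| + 1.
  by move=> Ez; apply: ME Ez; rewrite (le_lt_trans (ler_norm M))// ltrDl.
have K0 : 0 <= `|M| + 1 by rewrite addr_ge0.
exists (Num.sqrt (\sum_(i < d) (`|M| + 1) ^+ 2)) => _ [z Ez <-].
apply: ler_wsqrtr; apply: ler_sum => i _.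
rewrite -expr2 -(real_normK (num_real (z ord0 i))) lerXn2r ?nnegrE//.
by rewrite (le_trans (coord_le_norm z i))// M1.
Qed.

Lemma sup_enorm_ge0 : 0 <= sup_enorm E.
Proof.
have [->|/set0P[x Ex]] := eqVneq E set0; first by rewrite /sup_enorm image_set0 sup0.
by rewrite (le_trans _ (sup_enorm_ub Ex))// sqrtr_ge0.
Qed.

Let q := expR (2 * pi * sup_enorm E * delta * c).

(** Taylor's bounds divide by the radius m, while m_E may vanish; so they are
    used for m > m_E, and m tends to m_E. *)
Let radius_limit (X : \bar R) (F : R -> R) : continuous F ->
  (forall m, 0 < m -> (forall x, E x -> enorm x <= m) -> (X <= (F (expR (2 * pi * c * delta * m)))%:E)%E) ->
  (X <= (F q)%:E)%E.
Proof.
move=> cF XF; pose mn n := sup_enorm E + n.+1%:R^-1.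
have mnc : mn n @[n --> \oo] --> sup_enorm E.
  by rewrite -[X in _ --> X]addr0; apply: cvgD; [exact: cvg_cst|exact: cvg_harmonic].
have argc : 2 * pi * c * delta * mn n @[n --> \oo] --> 2 * pi * sup_enorm E * delta * c.
  rewrite [X in _ --> X](_ : _ = 2 * pi * c * delta * sup_enorm E); last by ring.
  exact: cvgMr.
have expc : expR (2 * pi * c * delta * mn n) @[n --> \oo] --> q.
  apply: (@cvg_comp _ _ _ (fun n => 2 * pi * c * delta * mn n) expR _
    (nbhs (2 * pi * sup_enorm E * delta * c))); [exact: argc|exact: continuous_expR].
have Fc : (F (expR (2 * pi * c * delta * mn n)))%:E @[n --> \oo] --> (F q)%:E.
  apply: cvg_EFin; first exact: nearW.
  apply: (@cvg_comp _ _ _ (fun n => expR (2 * pi * c * delta * mn n)) F _ (nbhs q)); [exact: expc|exact: cF].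
apply: (cvge_to_ge Fc); apply: nearW => n; apply: XF.
  by rewrite ltr_wpDl ?sup_enorm_ge0// invr_gt0.
by move=> x Ex; rewrite (le_trans (sup_enorm_ub Ex))// lerDl invr_ge0.
Qed.

Lemma sampled_energy_le f : Hspace E f -> (sampled_energy f <= (q ^+ 2 * rinner f f)%:E)%E.
Proof.
move=> fH; apply: (radius_limit (F := fun z => z ^+ 2 * rinner f f)).
  by move=> z; apply: cvgMl; exact: exprn_continuous.
by move=> m m0 Em; exact: sampled_energy_radius.
Qed.

Lemma cell_deviation_le f : Hspace E f -> (cell_deviation f <= ((q - 1) ^+ 2 * rinner f f)%:E)%E.
Proof.
move=> fH; apply: (radius_limit (F := fun z => (z - 1) ^+ 2 * rinner f f)).
  move=> z; apply: cvgMl; apply: (cvg_comp (fun z => z - 1) (fun z => z ^+ 2)); last exact: exprn_continuous.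
  by apply: cvgB; [exact: cvg_id|exact: cvg_cst].
by move=> m m0 Em; exact: cell_deviation_radius.
Qed.

End sampling.

(** * Reconstruction in a finite-dimensional space *)

Section reconstruction_space.
Context {R : realType} {d : nat}.
Notation leb := (@lebesgue_rv R d).
Notation V := ('rV[R]_d -> Rcomplex R).
Notation Re := complex.Re.
Notation Im := complex.Im.
Variables (E : set 'rV[R]_d) (cE : compact E).
Implicit Types (f g h : V) (T : set V).

Definition mulI f : V := fun x => Complex (- Im (f x)) (Re (f x)).

Lemma hspace_mulI f : Hspace E f -> Hspace E (mulI f).
Proof.
move=> [mr mi fE f0]; split => /=.
- exact: measurable_funN.
- by [].
- suff -> : L2norm setT (mulI f) = L2norm setT f by [].
  by congr sqrte; apply: eq_integral => x _; rewrite /sqmod /= sqrrN addrC.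
- by apply: filterS f0 => x fx xE; rewrite /mulI fx//= oppr0.
Qed.

Section span.
Variables (m : nat) (phi : 'I_m -> V) (phiH : forall i, Hspace E (phi i)).

Let T : set V := [set g | Hspace E g /\ exists c : 'I_m -> R[i],
          {ae leb, forall x, (g x : R[i]) = \sum_(i < m) c i * phi i x}].

Lemma span_subspace : subspace T.
Proof.
have [H0 HD] := @hspace_subspace R d E.
split.
  split=> //; exists (fun=> 0); apply: aeW => x.
  by rewrite big1 // => i _; rewrite mul0r.
move=> a f g [fH [cf fE]] [gH [cg gE]]; split; first exact: HD.
exists (fun i => Complex a 0 * cf i + cg i); apply: filterS2 fE gE => x fx gx.
rewrite (_ : (a *: f + g) x = Complex a 0 * (f x : R[i]) + g x); last first.
  by rewrite -[LHS]/(a *: (f x : Rcomplex R) + g x); case: (f x) (g x) => [p q] [r s]; congr Complex => /=; ring.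
by rewrite fx gx mulr_sumr -big_split; apply: eq_bigr => i _ /=; rewrite mulrDl mulrA.
Qed.

Lemma span_mulI g : T g -> T (mulI g).
Proof.
move=> [gH [c gE]]; split; first exact: hspace_mulI.
exists (fun i => Complex 0 1 * c i); apply: filterS gE => x gx.
have -> : (mulI g x : R[i]) = Complex 0 1 * (g x : R[i]).
  by rewrite /mulI; case: (g x) => p q; congr Complex => /=; ring.
by rewrite gx mulr_sumr; apply: eq_bigr => i _; rewrite mulrA.
Qed.

Lemma span_gen i : T (phi i).
Proof.
split => //; exists (fun j => (j == i)%:R); apply: aeW => x.
rewrite (bigD1 i)//= eqxx mul1r big1 ?addr0// => j /negPf ->; by rewrite mul0r.
Qed.

(** As a real space T is spanned, up to a.e. equality, by the phi_i and their
    multiples by i; Gram-Schmidt applies to these 2m vectors, and b does not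
    see null sets. *)
Lemma span_projection_exists (b : V -> V -> R) : psd_form (hspace E) b ->
  (forall f g h, Hspace E f -> Hspace E g -> Hspace E h ->
     {ae leb, forall x, g x = h x} -> b f g = b f h) ->
  forall f, Hspace E f -> exists2 p, T p & forall g, T g -> b (f - p) g = 0.
Proof.
move=> bP bae f fH; have sH := @hspace_subspace R d E; have [H0 _] := sH.
pose gen (j : nat) : V := if insub j is Some i then phi i else 0.
(* Even indices enumerate the generators, odd ones their multiples by i. *)
pose psi (j : nat) : V := if odd j then mulI (gen j./2) else gen j./2.
have genT j : T (gen j).
  by rewrite /gen; case: insubP => [i _ _|_]; [exact: span_gen|case: span_subspace].
have psiT j : T (psi j) by rewrite /psi; case: ifP => _ //; exact: span_mulI.
have psiH j : hspace E (psi j) by case: (psiT j).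
have [c cP] := span_projection sH bP m.*2 psiH fH.
exists (\sum_(i < m.*2) c i *: psi i); first exact: subspace_sum span_subspace psiT.
move=> g [gH [a gE]].
set r := f - _; have rH : hspace E r.
  by apply: subspaceB => //; exact: subspace_sum sH psiH.
pose term i : V := Re (a i) *: phi i + Im (a i) *: mulI (phi i).
have termH i : hspace E (term i).
  apply: (subspaceD sH); apply: (subspaceZ _ sH); first exact: phiH.
  by apply: hspace_mulI; exact: phiH.
have r0 i : b r (term i) = 0.
  have gi : gen i = phi i by rewrite /gen valK.
  have e0 : b r (phi i) = 0.
    have := cP i.*2; rewrite /psi odd_double doubleK gi; apply.
    by rewrite ltn_double.
  have e1 : b r (mulI (phi i)) = 0.
    have := cP i.*2.+1; rewrite /psi /= odd_double /= uphalf_double gi; apply.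
    by rewrite ltn_Sdouble.
  have H1 : hspace E (phi i) by exact: phiH.
  have H2 : hspace E (mulI (phi i)) by apply: hspace_mulI; exact: phiH.
  rewrite (formDr sH bP)//; try exact: (subspaceZ _ sH).
  by rewrite !(formZr sH bP)// e0 e1 !mulr0 addr0.
have sumH : hspace E (\sum_(i < m) term i).
  have : forall s : seq 'I_m, hspace E (\sum_(i <- s) term i).
    by elim=> [|i s IH]; rewrite ?big_nil// big_cons; exact: subspaceD.
  exact.
rewrite (bae _ _ (\sum_(i < m) term i))//; last first.
  apply: filterS gE => x ->.
  rewrite fct_sumE; apply: eq_bigr => i _.
  rewrite -[RHS]/(Re (a i) *: (phi i x : Rcomplex R) + Im (a i) *: (mulI (phi i) x)) /mulI.
  by case: (a i) (phi i x) => [p q] [u v]; congr Complex => /=; ring.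
have : forall s : seq 'I_m, b r (\sum_(i <- s) term i) = 0.
  elim=> [|i s IH].
    by rewrite big_nil; have [_ bC _] := bP; rewrite bC//; exact: (form0l sH bP rH).
  rewrite big_cons (formDr sH bP)// ?r0 ?IH ?addr0//.
  by elim: (s) => [|j s' IH']; rewrite ?big_nil// big_cons; exact: subspaceD.
by move/(_ (index_enum 'I_m)).
Qed.

End span.
End reconstruction_space.

Section nugs.
Context {R : realType} {d : nat}.
Notation leb := (@lebesgue_rv R d).
Notation V := ('rV[R]_d -> Rcomplex R).
Notation Re := complex.Re.
Notation Im := complex.Im.
Variables (E : set 'rV[R]_d) (cE : compact E) (T : set V).
Hypothesis hT : @fin_dim_subspace R d E T.
Variables (Om : set 'rV[R]_d) (mu : 'rV[R]_d -> \bar R).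
Hypotheses (fOm : finite_set Om) (mu_fin : forall w, Om w -> (0 <= mu w < +oo)%E).
Implicit Types (f g h : V).

(** The real part of the sampling form, whose diagonal is the weighted sum of
    squares that the reconstruction minimizes. *)
Definition sform f g : R := \sum_(w <- fset_set Om) fine (mu w) *
  (Re (fourier E f w) * Re (fourier E g w) + Im (fourier E f w) * Im (fourier E g w)).

Lemma sform_psd : psd_form (hspace E) sform.
Proof.
split.
- move=> a f g h fH gH hH; rewrite /sform mulr_sumr -big_split; apply: eq_bigr => w _.
  have -> := fourier_scaleD cE a w fH gH.
  rewrite Re_scaleD Im_scaleD.
  move: (Re (fourier E f w)) (Im (fourier E f w)) (Re (fourier E g w)) (Im (fourier E g w)).
  move: (Re (fourier E h w)) (Im (fourier E h w)) => p1 p2 p3 p4 p5 p6 /=; ring.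
- by move=> f g _ _; apply: eq_bigr => w _; congr (_ * (_ + _)); rewrite mulrC.
- move=> f _; rewrite /sform big_seq; apply: sumr_ge0 => w; rewrite in_fset_set// => /set_mem/mu_fin.
  move=> /andP[mu0 _]; rewrite mulr_ge0 ?fine_ge0// addr_ge0// -expr2 sqr_ge0//.
Qed.

Lemma sformE f : ((sform f f)%:E = \sum_(w <- fset_set Om) mu w * (sqmod (fourier E f w))%:E)%E.
Proof.
rewrite /sform -sumEFin big_seq [RHS]big_seq; apply: eq_bigr => w.
rewrite in_fset_set// => /set_mem/mu_fin/andP[mu0 muy].
by rewrite EFinM fineK ?ge0_fin_numE// /sqmod !expr2.
Qed.

Lemma fourier_ae f g w : Hspace E f -> Hspace E g -> {ae leb, forall x, f x = g x} ->
  fourier E f w = fourier E g w.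
Proof.
move=> fH gH fg; rewrite !fourierE.
have mE := compact_measurable_rv cE.
have rE : {ae leb, forall x, re_on E f x = re_on E g x}.
  by apply: filterS fg => x fx; rewrite /re_on !patchE fx.
have iE : {ae leb, forall x, im_on E f x = im_on E g x}.
  by apply: filterS fg => x fx; rewrite /im_on !patchE fx.
have fre_ae (p q p' q' : 'rV[R]_d -> R) : leb.-integrable setT (EFin \o p) -> leb.-integrable setT (EFin \o q) ->
    leb.-integrable setT (EFin \o p') -> leb.-integrable setT (EFin \o q') ->
    {ae leb, forall x, p x = p' x} -> {ae leb, forall x, q x = q' x} -> fre p q w = fre p' q' w.
  move=> ip iq ip' iq' pp qq; rewrite /fre /Rintegral; congr fine.
  apply: ae_eq_integral => //.
  - by case/integrableP: (integrable_fre w ip iq).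
  - by case/integrableP: (integrable_fre w ip' iq').
  - by apply: filterS2 pp qq => x -> -> _.
have irf := integrable_re_on cE fH; have iif := integrable_im_on cE fH.
have irg := integrable_re_on cE gH; have iig := integrable_im_on cE gH.
congr Complex; apply: fre_ae => //; try exact: integrable_opp.
by apply: filterS rE => x /= ->.
Qed.

Lemma sform_ae f g h : Hspace E f -> Hspace E g -> Hspace E h ->
  {ae leb, forall x, g x = h x} -> sform f g = sform f h.
Proof.
move=> fH gH hH gh; apply: eq_bigr => w _; by rewrite (fourier_ae w gH hH gh).
Qed.

Lemma rinner_ae f g h : Hspace E f -> Hspace E g -> Hspace E h ->
  {ae leb, forall x, g x = h x} -> rinner f g = rinner f h.
Proof.
move=> fH gH hH gh; rewrite /rinner /Rintegral; congr fine; apply: ae_eq_integral => //.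
- by case/integrableP: (hspace_inner_integrable fH gH).
- by case/integrableP: (hspace_inner_integrable fH hH).
- by apply: filterS gh => x -> _.
Qed.

Lemma rinner_null f g : Hspace E f -> Hspace E g -> rinner (f - g) (f - g) = 0 ->
  {ae leb, forall x, f x = g x}.
Proof.
move=> fH gH fg0; have fgH : Hspace E (f - g) := subspaceB (@hspace_subspace R d E) fH gH.
have ms : measurable_fun setT (fun x => (sqmod ((f - g) x))%:E).
  by apply/measurable_EFinP; case: fgH => mr mi _ _; exact: measurable_sqmod.
have I0 : (\int[leb]_x `|(sqmod ((f - g) x))%:E| = 0)%E.
  under eq_integral do rewrite gee0_abs ?lee_fin ?sqmod_ge0//.
  by rewrite (integral_sqmod fgH) fg0.
move/(ae_eq_integral_abs leb measurableT ms) : I0 => I0.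
apply: filterS I0 => x /(_ I) /= [] sq0.
apply/eqP; rewrite -subr_eq0; apply/eqP; move: sq0; rewrite -[(f - g) x]/(f x - g x).
case: (f x - g x) => a b; rewrite /sqmod /= => ab.
have a0 : a = 0 by apply/eqP; rewrite -sqrf_eq0; apply/eqP; have := sqr_ge0 a; have := sqr_ge0 b; lra.
have b0 : b = 0 by apply/eqP; rewrite -sqrf_eq0; apply/eqP; have := sqr_ge0 a; have := sqr_ge0 b; lra.
by rewrite a0 b0.
Qed.

Let Tsub : T `<=` (hspace E).
Proof. by have [m [phi [_ ->]]] := hT => g []. Qed.

Let Tsubspace : subspace T.
Proof. by have [m [phi [phiH ->]]] := hT; exact: span_subspace. Qed.

Let TmulI g : T g -> T (mulI g).
Proof. by have [m [phi [phiH ->]]] := hT; exact: span_mulI. Qed.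

Let Tproj (b : V -> V -> R) : psd_form (hspace E) b ->
  (forall f g h, Hspace E f -> Hspace E g -> Hspace E h ->
     {ae leb, forall x, g x = h x} -> b f g = b f h) ->
  forall f, Hspace E f -> exists2 p, T p & forall g, T g -> b (f - p) g = 0.
Proof. by have [m [phi [phiH ->]]] := hT; exact: span_projection_exists. Qed.

Lemma Im_mul_conj (z1 z2 : R[i]) : Im (z1 * conjc z2) = - (Re z1 * Im z2) + Im z1 * Re z2.
Proof. by case: z1 z2 => [a b] [p q] /=; ring. Qed.

Lemma Re_mul_conj (z1 z2 : R[i]) : Re (z1 * conjc z2) = Re z1 * Re z2 + Im z1 * Im z2.
Proof. by case: z1 z2 => [a b] [p q] /=; ring. Qed.

(** Real orthogonality to g and to i g is complex orthogonality to g. *)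
Lemma innerE f g : inner f g = Complex (rinner f g) (rinner f (mulI g)).
Proof.
rewrite /inner /integralC; congr Complex; apply: eq_Rintegral => x _.
  exact: Re_mul_conj.
by rewrite Im_mul_conj /mulI /= mulrN.
Qed.

Lemma orth_projP f : Hspace E f -> T (orth_proj T f) /\ forall g, T g -> rinner (f - orth_proj T f) g = 0.
Proof.
move=> fH; have [p Tp pP] := Tproj (@rinner_form R d E) rinner_ae fH.
have : [set p : 'rV[R]_d -> R[i] | T p /\ forall g, T g -> inner (fun x => f x - p x) g = 0] (orth_proj T f).
  apply: (xgetPex (fun=> 0)); exists p; split => // g Tg.
  rewrite -[(fun x => _)]/(f - p : V) innerE pP// pP//; exact: TmulI.
move=> [To oP]; split => // g Tg; have := oP g Tg.
rewrite -[(fun x => _)]/(f - orth_proj T f : V) innerE.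
by case.
Qed.

Lemma fourierB f g w : Hspace E f -> Hspace E g ->
  fourier E (f - g) w = fourier E f w - fourier E g w.
Proof.
move=> fH gH; have := fourier_scaleD cE (-1) w gH fH.
rewrite scaleN1r addrC => ->.
by rewrite -[LHS]/(-1 *: (fourier E g w : Rcomplex R) + fourier E f w) scaleN1r addrC.
Qed.

Lemma nugs_residualE f g : Hspace E f -> Hspace E g ->
  nugs_residual E mu Om f g = (sform (f - g) (f - g))%:E.
Proof.
move=> fH gH; rewrite sformE /nugs_residual fsbig_finite//.
by apply: eq_bigr => w _; rewrite fourierB.
Qed.

Lemma nugs_argminE f : Hspace E f -> nugs_argmin E T mu Om f = least_squares T sform f.
Proof.
move=> fH; apply/seteqP; split=> g [Tg gmin]; split=> // g' Tg'.
  by have := gmin _ Tg'; rewrite !nugs_residualE ?lee_fin//; exact: Tsub.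
by rewrite !nugs_residualE ?lee_fin//; [exact: gmin|exact: Tsub|exact: Tsub].
Qed.

Variables (A B : R).
Hypotheses (A0 : 0 < A) (AB : A <= B)
  (sB : forall f, Hspace E f -> sform f f <= B * rinner f f)
  (sA : forall g, T g -> A * rinner g g <= sform g g).

Theorem nugs_well_posed f : Hspace E f -> exists_unique_ae (nugs_argmin E T mu Om f).
Proof.
move=> fH; have sH := @hspace_subspace R d E; have ipP := @rinner_form R d E.
have projs := Tproj sform_psd sform_ae.
rewrite nugs_argminE//; split; first exact: (least_squares_nonempty sH Tsubspace Tsub sform_psd projs fH).
move=> g g' gm g'm; have [Tg _] := gm; have [Tg' _] := g'm.
apply: rinner_null; try exact: Tsub.
exact: (least_squares_unique sH Tsubspace Tsub ipP sform_psd A0 sA projs fH gm g'm).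
Qed.

Theorem nugs_stable f h : Hspace E f -> Hspace E h ->
  (L2norm setT (fun x => f x - nugs E T mu Om (fun t => f t + h t)%R x)%R <=
   (Num.sqrt (B / A))%:E * (L2norm setT (fun x => f x - orth_proj T f x)%R + L2norm setT h))%E.
Proof.
move=> fH hH; have sH := @hspace_subspace R d E; have ipP := @rinner_form R d E.
have projs := Tproj sform_psd sform_ae.
have fhH : Hspace E (f + h) := subspaceD sH fH hH.
have gP : least_squares T sform (f + h) (nugs E T mu Om (f + h)).
  rewrite -nugs_argminE//; apply: (xgetPex (fun=> 0)).
  by have [] := nugs_well_posed fhH.
have [Tg _] := gP; have gH := Tsub Tg.
have [Tp pP] := orth_projP fH; have pH := Tsub Tp.
have := least_squares_error sH Tsubspace Tsub ipP sform_psd A0 sB sA projs AB fH hH Tp pP gP.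
rewrite -[(fun x => f x - nugs _ _ _ _ _ x)]/(f - nugs E T mu Om (f + h) : V).
rewrite -[(fun x => f x - orth_proj T f x)]/(f - orth_proj T f : V).
rewrite (L2norm_rinner (subspaceB sH fH gH)) (L2norm_rinner (subspaceB sH fH pH)) (L2norm_rinner hH).
by rewrite -EFinD -EFinM lee_fin.
Qed.

End nugs.

(** * Lower bound from the energy outside the window *)

Section bounded_windows.
Context {R : realType} {d : nat}.
Notation leb := (@lebesgue_rv R d).
Implicit Types (Y Z Om : set 'rV[R]_d) (N : 'rV[R]_d -> R).

Lemma compact_dilate K Y : closed Y -> (forall y, Y y -> `|y| <= 1) -> compact (dilate K Y).
Proof.
move=> cY Y1; apply: continuous_compact.
  by apply: continuous_subspaceT; exact: scaler_continuous.
apply: bounded_closed_compact => //; exists 1; split; first exact: num_real.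
by move=> M M1 y /Y1 /le_trans; apply; exact: ltW.
Qed.

Lemma compact_lebesgue_lty Z : compact Z -> (leb Z < +oo)%E.
Proof.
move=> cZ; have mZ := compact_measurable_rv cZ; have [L L0 ZL] := compact_sub_box cZ.
rewrite -[Z]setIT -integral_indic//.
have /integrableP[_ ] := @integrable_box_indic R L d.
apply: le_lt_trans; apply: (@le_trans _ _ (\int[leb]_(x in Z) `|(EFin \o @box_indic R L d) x|)%E).
  rewrite integral_indic// setIT -[leLHS]mul1e -integral_cst//.
  apply: ge0_le_integral => //.
  - by apply: measurableT_comp => //; apply/measurable_EFinP; apply: measurable_funTS; exact: measurable_box_indic.
  - by move=> x Zx; rewrite /= ZL// normr1.
apply: ge0_subset_integral => //.
by apply: measurableT_comp => //; apply/measurable_EFinP; exact: measurable_box_indic.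
Qed.

Lemma voronoi_weight_fin N Om Z w : is_norm N -> finite_set Om -> compact Z ->
  (0 <= voronoi_weight N Om Z w < +oo)%E.
Proof.
move=> hN fOm cZ; rewrite measure_ge0 /=; apply: le_lt_trans (compact_lebesgue_lty cZ).
have mZ := compact_measurable_rv cZ; have mV := voronoi_measurable hN w (finite_set_countable fOm) mZ.
by apply: le_measure; [exact: mem_set|exact: mem_set|move=> y []].
Qed.

End bounded_windows.

Section homogeneity.
Context {R : realType} {d : nat}.
Notation leb := (@lebesgue_rv R d).
Notation V := ('rV[R]_d -> Rcomplex R).
Variables (E : set 'rV[R]_d) (cE : compact E) (T : set V).
Hypotheses (Tsub : T `<=` (hspace E)) (sT : subspace T).
Implicit Types f g : V.

Lemma sqmodZ (a : R) (z : Rcomplex R) : sqmod (a *: z) = a ^+ 2 * sqmod z.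
Proof. by case: z => p q; rewrite /sqmod /=; ring. Qed.

Lemma fourierZ a f w : Hspace E f -> fourier E (a *: f) w = a *: (fourier E f w : Rcomplex R).
Proof.
move=> fH; have H0 : Hspace E (0 : V) by case: (@hspace_subspace R d E).
have F0 : fourier E (0 : V) w = 0.
  have := fourier_scaleD cE 1 w H0 H0; rewrite !scale1r addr0 => /eqP.
  by rewrite -[X in _ == X]/(fourier E (0 : V) w + fourier E (0 : V) w) eq_sym addrC -subr_eq0 addrK => /eqP.
by have := fourier_scaleD cE a w fH H0; rewrite addr0 F0 addr0.
Qed.

(** Residuals are suprema over unit vectors; homogeneity extends their bounds
    to T, null vectors being treated apart. *)
Lemma unit_sphere_homogeneous (Q : V -> \bar R) e :
  (forall a g, T g -> (Q (a *: g) <= (a ^+ 2)%:E * Q g)%E) ->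
  (forall g, T g -> rinner g g = 0 -> (Q g <= 0)%E) ->
  (forall g, unit_sphere T g -> (Q g <= e%:E)%E) ->
  forall g, T g -> (Q g <= (e * rinner g g)%:E)%E.
Proof.
move=> QZ Q0 Q1 g Tg; have gH := Tsub Tg.
have [g0|gN0] := eqVneq (rinner g g) 0; first by rewrite g0 mulr0; exact: Q0.
have gp : 0 < rinner g g by rewrite lt_neqAle eq_sym gN0 rinner_ge0.
pose b := Num.sqrt (rinner g g); pose u := b^-1 *: g.
have b0 : b != 0 by rewrite gt_eqF// sqrtr_gt0.
have b2 : b ^+ 2 = rinner g g by rewrite sqr_sqrtr ?rinner_ge0.
have Tu : T u by exact: subspaceZ.
have /Q1 Qu : unit_sphere T u.
  split=> //; rewrite (L2norm_rinner (Tsub Tu)).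
  by rewrite (form_sqrZ (@hspace_subspace R d E) (@rinner_form R d E) _ gH) -b2 exprVn mulVf ?expf_neq0// sqrtr1.
have gu : g = b *: u by rewrite scalerA mulfV// scale1r.
rewrite [in Q g]gu (le_trans (QZ b u Tu))// -b2 (mulrC e) [leRHS]EFinM.
by apply: (@lee_wpmul2l R) => //; rewrite lee_fin sqr_ge0.
Qed.

End homogeneity.

Section triangle.
Context {R : realType}.

(** Minkowski's inequality from its squared form, which can be summed over the
    cells. The form is sharp at s = c / b; b and c are enlarged slightly so
    that this s exists and is positive. *)
Lemma sqr_minkowski (a b c : R) : 0 <= a -> 0 <= b -> 0 <= c ->
  (forall s, 0 < s -> a ^+ 2 <= (1 + s) * b ^+ 2 + (1 + s^-1) * c ^+ 2) -> a <= b + c.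
Proof.
move=> a0 b0 c0 H; apply/ler_addgt0Pr => e e0.
pose t := e / 2; have t0 : 0 < t by rewrite divr_gt0.
have bt : 0 < b + t by rewrite ltr_wpDl.
have ct : 0 < c + t by rewrite ltr_wpDl.
have s0 : 0 < (c + t) / (b + t) by rewrite divr_gt0.
have aE := H _ s0.
suff : a <= (b + t) + (c + t) by move=> /le_trans; apply; rewrite addrACA -splitr.
rewrite -(@ler_pXn2r _ 2) ?nnegrE ?addr_ge0 ?(ltW t0)//.
apply: (le_trans aE).
have -> : (b + t + (c + t)) ^+ 2 = (1 + (c + t) / (b + t)) * (b + t) ^+ 2 + (1 + ((c + t) / (b + t))^-1) * (c + t) ^+ 2.
  by field; rewrite !gt_eqF.
apply: lerD; apply: ler_wpM2l.
- by rewrite addr_ge0// ltW.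
- by rewrite lerXn2r ?nnegrE ?(ltW bt)// lerDl ltW.
- by rewrite addr_ge0// invr_ge0 ltW.
- by rewrite lerXn2r ?nnegrE ?(ltW ct)// lerDl ltW.
Qed.

Lemma sqmod_young (x y : R[i]) (s : R) : 0 < s ->
  sqmod y <= (1 + s) * sqmod x + (1 + s^-1) * sqmod (y - x).
Proof.
case: x y => [a b] [p q] s0; rewrite /sqmod /=.
have young (u v : R) : v ^+ 2 <= (1 + s) * u ^+ 2 + (1 + s^-1) * (v - u) ^+ 2.
  rewrite -subr_ge0 (_ : _ - _ = s^-1 * (s * u - (v - u)) ^+ 2); last by field; rewrite gt_eqF.
  by rewrite mulr_ge0 ?invr_ge0 ?(ltW s0)// sqr_ge0.
by have := young a p; have := young b q; rewrite !mulrDr; lra.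
Qed.

End triangle.

Lemma frame_constant_ge1 {R : realType} {d : nat} (E : set 'rV[R]_d) (c delta : R) :
  compact E -> 0 < c -> 0 < delta -> 1 <= expR (2 * pi * sup_enorm E * delta * c).
Proof.
move=> cE c0 d0; rewrite -expR0 ler_expR.
by rewrite !mulr_ge0 ?pi_ge0 ?(ltW d0) ?(ltW c0)// sup_enorm_ge0.
Qed.

Section window.
Context {R : realType} {d : nat}.
Notation leb := (@lebesgue_rv R d).
Notation V := ('rV[R]_d -> Rcomplex R).
Variables (E : set 'rV[R]_d) (cE : compact E).
Variables (N : 'rV[R]_d -> R) (hN : is_norm N) (c delta : R).
Variables (Om Z : set 'rV[R]_d).
Hypotheses (c0 : 0 < c) (Nc : forall x, enorm x <= c * N x).
Hypotheses (fOm : finite_set Om) (cZ : compact Z) (dOm : dense_in N Om Z delta)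
  (tess : voronoi_tessellation N Om Z).
Implicit Types (f g : V) (w y : 'rV[R]_d).

Let mZ : measurable Z. Proof. exact: compact_measurable_rv. Qed.

Let mu := voronoi_weight N Om Z.

Let q := expR (2 * pi * sup_enorm E * delta * c).

Let q1 : 1 <= q.
Proof. by have [d0 _ _] := dOm; exact: frame_constant_ge1. Qed.

Let mu_fin w : Om w -> (0 <= mu w < +oo)%E.
Proof. by move=> _; exact: voronoi_weight_fin. Qed.

Lemma sform_sampled_energy f : ((sform E Om mu f f)%:E = sampled_energy E N Om Z f)%E.
Proof. by rewrite (sformE E fOm mu_fin). Qed.

Lemma sform_le f : Hspace E f -> sform E Om mu f f <= q ^+ 2 * rinner f f.
Proof.
move=> fH; rewrite -lee_fin sform_sampled_energy.
exact: (sampled_energy_le cE hN c0 Nc fOm mZ dOm tess fH).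
Qed.

Let msq f (fH : Hspace E f) := measurable_sqmod_fourier cE fH.
Let msqB f w (fH : Hspace E f) := measurable_sqmod_fourierB cE w fH.

Let sq0 f y : (0 <= (sqmod (fourier E f y))%:E)%E.
Proof. by rewrite lee_fin sqmod_ge0. Qed.

Lemma window_energy_young f s : Hspace E f -> 0 < s ->
  (\int[leb]_(y in Z) (sqmod (fourier E f y))%:E <=
   ((1 + s) * sform E Om mu f f + (1 + s^-1) * ((q - 1) ^+ 2 * rinner f f))%:E)%E.
Proof.
move=> fH s0.
have s1 : 0 <= 1 + s by rewrite addr_ge0// ltW.
have s2 : 0 <= 1 + s^-1 by rewrite addr_ge0// invr_ge0 ltW.
rewrite -(voronoi_integral hN fOm mZ dOm tess (msq fH) (sq0 f)).
apply: (@le_trans _ _ ((1 + s)%:E * sampled_energy E N Om Z f + (1 + s^-1)%:E * cell_deviation E N Om Z f)%E).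
  rewrite (sampled_energyE E hN fOm mZ) /cell_deviation !ge0_sume_distrr; last 2 first.
  - by move=> w _; apply: integral_ge0 => y _; rewrite lee_fin sqmod_ge0.
  - by move=> w _; apply: integral_ge0 => y _; rewrite lee_fin sqmod_ge0.
  rewrite -big_split /=; apply: lee_sum => w _.
  have mV := voronoi_measurable hN w (finite_set_countable fOm) mZ.
  rewrite -!ge0_integralZl ?lee_fin//; last 3 first.
  - by apply: measurable_funTS; exact: msqB.
  - by move=> y _; rewrite lee_fin sqmod_ge0.
  - by move=> y _; exact: sqmod_ge0.
  have mB : measurable_fun (voronoi N Om Z w) (fun y => (1 + s^-1)%:E * (sqmod (fourier E f y - fourier E f w))%:E)%E.
    by apply: emeasurable_funM => //; apply: measurable_funTS; exact: msqB.
  apply: (@le_trans _ _ (\int[leb]_(y in voronoi N Om Z w) ((1 + s)%:E * (sqmod (fourier E f w))%:E +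
      (1 + s^-1)%:E * (sqmod (fourier E f y - fourier E f w))%:E))%E); last first.
    rewrite ge0_integralD//.
    - by move=> y _; rewrite -EFinM lee_fin mulr_ge0// sqmod_ge0.
    - by move=> y _; rewrite -EFinM lee_fin mulr_ge0// sqmod_ge0.
  apply: ge0_le_integral => //.
  - by apply: measurable_funTS; exact: msq.
  - by apply: emeasurable_funD => //; exact: emeasurable_funM.
  - by move=> y _; rewrite lee_fin; exact: sqmod_young.
apply: (@le_trans _ _ ((1 + s)%:E * (sform E Om mu f f)%:E +
    (1 + s^-1)%:E * ((q - 1) ^+ 2 * rinner f f)%:E)%E); last by rewrite -!EFinM -EFinD.
rewrite sform_sampled_energy; apply: leeD => //; apply: lee_wpmul2l; first by rewrite lee_fin.
exact: (cell_deviation_le cE hN c0 Nc fOm mZ dOm tess fH).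
Qed.

Lemma sqrt_window_energy f x : Hspace E f -> 0 <= x ->
  ((x ^+ 2)%:E <= \int[leb]_(y in Z) (sqmod (fourier E f y))%:E)%E ->
  x <= Num.sqrt (sform E Om mu f f) + (q - 1) * Num.sqrt (rinner f f).
Proof.
move=> fH x0 xZ; have r0 := rinner_ge0 f.
have S0 : 0 <= sform E Om mu f f by have [_ _ H] := sform_psd cE fOm mu_fin; exact: H.
apply: sqr_minkowski => //; first by rewrite mulr_ge0// subr_ge0.
move=> s s0; rewrite exprMn !sqr_sqrtr// -lee_fin.
exact: (le_trans xZ (window_energy_young fH s0)).
Qed.

(** Plancherel splits |f|^2 into the energies inside and outside the window;
    the outside part is small by hypothesis, and the inside part is controlled
    by the samples. *)
Lemma sform_ge f eps : Hspace E f -> 0 <= eps <= 1 ->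
  q - 1 <= Num.sqrt (1 - eps ^+ 2) ->
  (\int[leb]_(y in ~` Z) (sqmod (fourier E f y))%:E <= (eps ^+ 2 * rinner f f)%:E)%E ->
  (Num.sqrt (1 - eps ^+ 2) + 1 - q) ^+ 2 * rinner f f <= sform E Om mu f f.
Proof.
move=> fH /andP[e0 e1] qe tail; have r0 := rinner_ge0 f.
have e2 : 0 <= 1 - eps ^+ 2 by rewrite subr_ge0 expr_le1.
have S0 : 0 <= sform E Om mu f f by have [_ _ H] := sform_psd cE fOm mu_fin; exact: H.
have : Num.sqrt (1 - eps ^+ 2) * Num.sqrt (rinner f f) <=
    Num.sqrt (sform E Om mu f f) + (q - 1) * Num.sqrt (rinner f f).
  apply: sqrt_window_energy => //.
  rewrite exprMn !sqr_sqrtr// -(@leeD2rE _ (eps ^+ 2 * rinner f f)%:E)// -EFinD.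
  rewrite -mulrDl subrK mul1r -(plancherel cE fH) -[X in (\int[_]_(_ in X) _ <= _)%E](setUv Z).
  rewrite ge0_integral_setU//; last 3 first.
  - exact: measurableC.
  - by rewrite setUv; exact: msq.
  - by apply/disj_setPS; rewrite setICr.
  exact: leeD2l.
rewrite -lerBlDr -mulrBl => H.
rewrite -[leRHS]sqr_sqrtr// -[in leLHS](sqr_sqrtr r0) -exprMn.
have a0 : 0 <= (Num.sqrt (1 - eps ^+ 2) + 1 - q) * Num.sqrt (rinner f f).
  by rewrite mulr_ge0//; lra.
rewrite lerXn2r ?nnegrE//; apply: le_trans H; rewrite le_eqVlt; apply/orP; left; apply/eqP; ring.
Qed.

End window.

Section residuals.
Context {R : realType} {d : nat}.
Notation leb := (@lebesgue_rv R d).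
Notation V := ('rV[R]_d -> Rcomplex R).
Variables (E : set 'rV[R]_d) (cE : compact E) (T : set V).
Hypotheses (Tsub : T `<=` (hspace E)) (sT : subspace T).
Implicit Types f g : V.

Lemma sqrte_sup_le (Q : V -> \bar R) e : 0 <= e -> (forall g, (0 <= Q g)%E) ->
  (ereal_sup [set sqrte (Q g) | g in unit_sphere T] <= e%:E)%E ->
  forall g, unit_sphere T g -> (Q g <= (e ^+ 2)%:E)%E.
Proof.
move=> e0 Q0 He g Tg; rewrite -(@lee_sqrt _ (Q g)) ?lee_fin ?sqr_ge0//=.
rewrite sqrtr_sqr ger0_norm//; apply: le_trans He.
by apply: ereal_sup_ubound; exists g.
Qed.

Lemma residual_tail Y K e g : 0 <= e -> measurable (dilate K Y) -> (residual E T Y K <= e%:E)%E -> T g ->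
  (\int[leb]_(y in ~` dilate K Y) (sqmod (fourier E g y))%:E <= (e ^+ 2 * rinner g g)%:E)%E.
Proof.
move=> e0 mZ res; set Z := dilate K Y in mZ res *.
pose Q f := (\int[leb]_(y in ~` Z) (sqmod (fourier E f y))%:E)%E.
have mZC : measurable (~` Z) by exact: measurableC.
have msq f : Hspace E f -> measurable_fun (~` Z) (fun y => (sqmod (fourier E f y))%:E).
  by move=> fH; apply: measurable_funTS; exact: measurable_sqmod_fourier.
apply: (unit_sphere_homogeneous Tsub sT (Q := Q)).
- move=> a f Tf; rewrite (_ : Q (a *: f) = ((a ^+ 2)%:E * Q f)%E)// /Q -ge0_integralZl//; last 3 first.
  + by apply: msq; exact: Tsub.
  + by move=> y _; rewrite lee_fin sqmod_ge0.
  + by rewrite lee_fin sqr_ge0.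
  by apply: eq_integral => y _; rewrite -EFinM -sqmodZ -(fourierZ cE)//; exact: Tsub.
- move=> f Tf f0; have fH := Tsub Tf; apply: (@le_trans _ _ (rinner f f)%:E); last by rewrite f0.
  rewrite -(plancherel cE fH).
  apply: ge0_subset_integral => //; last by move=> y _; rewrite lee_fin sqmod_ge0.
  exact: measurable_sqmod_fourier.
- apply: sqrte_sup_le => //.
  by move=> f; apply: integral_ge0 => y _; rewrite lee_fin sqmod_ge0.
Qed.

End residuals.

Section margin.
Context {R : realType}.

(** The bound on eps is the one for which eps^2 + (q - 1)^2 < 1, because q (2 -
    q) = 1 - (q - 1)^2. *)
Lemma frame_margin (q eps : R) : 1 <= q < 2 -> 0 < eps -> eps < Num.sqrt (q * (2 - q)) ->
  eps <= 1 /\ q - 1 < Num.sqrt (1 - eps ^+ 2).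
Proof.
move=> /andP[q1 q2] e0 eq_.
have qq : 0 <= q * (2 - q) by apply: mulr_ge0; lra.
have e2 : eps ^+ 2 < q * (2 - q).
  by rewrite -(sqr_sqrtr qq) ltrXn2r// ?nnegrE ltW.
have q1e : (q - 1) ^+ 2 < 1 - eps ^+ 2 by rewrite (_ : (q - 1) ^+ 2 = 1 - q * (2 - q)); [lra|ring].
split.
  rewrite -(@ler_pXn2r _ 2) ?nnegrE ?(ltW e0)// expr1n.
  by have := sqr_ge0 (q - 1); lra.
rewrite -[ltLHS]ger0_norm; last by rewrite subr_ge0.
by rewrite -sqrtr_sqr ltr_sqrt// (le_lt_trans _ q1e)// sqr_ge0.
Qed.

End margin.

Section bandwidth_and_density.
Context {R : realType} {d : nat}.
Notation V := ('rV[R]_d -> Rcomplex R).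
Variables (E : set 'rV[R]_d) (cE : compact E) (T : set V).
Hypothesis hT : @fin_dim_subspace R d E T.
Implicit Types f g h : V.

Lemma fin_dim_sub : T `<=` (hspace E).
Proof. by have [m [phi [_ ->]]] := hT => g []. Qed.

Lemma fin_dim_is_subspace : subspace T.
Proof. by have [m [phi [phiH ->]]] := hT; exact: span_subspace. Qed.

Theorem nugs_window_residual (Om Y : set 'rV[R]_d) (N : 'rV[R]_d -> R) (c delta K eps : R) :
  finite_set Om -> is_norm N -> 0 < c -> (forall x, enorm x <= c * N x) ->
  K_dense N Om Y K delta -> voronoi_tessellation N Om (dilate K Y) ->
  let q := expR (2 * pi * sup_enorm E * delta * c) in
  q < 2 -> 0 < eps -> eps < Num.sqrt (q * (2 - q)) ->
  (residual E T Y K <= eps%:E)%E ->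
  let mu := voronoi_weight N Om (dilate K Y) in
  (forall f, Hspace E f -> exists_unique_ae (nugs_argmin E T mu Om f)) /\
  forall f h, Hspace E f -> Hspace E h ->
    (L2norm setT (fun x => f x - nugs E T mu Om (fun t => f t + h t)%R x)%R <=
     (q / (Num.sqrt (1 - eps ^+ 2) + 1 - q))%:E *
     (L2norm setT (fun x => f x - orth_proj T f x)%R + L2norm setT h))%E.
Proof.
move=> fOm hN c0 Nc [K0 [cY _ _] [Y1 _] dOm] tess q q2 e0 eq_ res mu.
have cZ := compact_dilate (K := K) cY Y1.
have [d0 _ _] := dOm.
have q1 : 1 <= q by exact: (frame_constant_ge1 cE c0 d0).
have [|e1 qs] := frame_margin _ e0 eq_; first by rewrite q1.
have s1 : Num.sqrt (1 - eps ^+ 2) <= 1.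
  by rewrite -[leRHS]sqrtr1 ler_wsqrtr// gerBl sqr_ge0.
set s := Num.sqrt (1 - eps ^+ 2) in qs s1 *.
have s0 : 0 < s + 1 - q by lra.
pose A := (s + 1 - q) ^+ 2.
have A0 : 0 < A by rewrite exprn_gt0.
have AB : A <= q ^+ 2 by rewrite lerXn2r ?nnegrE//; lra.
have mu_fin w : Om w -> (0 <= mu w < +oo)%E by move=> _; exact: voronoi_weight_fin.
have sB f : Hspace E f -> sform E Om mu f f <= q ^+ 2 * rinner f f.
  exact: (sform_le cE hN c0 Nc fOm cZ dOm tess).
have sA g : T g -> A * rinner g g <= sform E Om mu g g.
  move=> Tg; apply: (sform_ge cE hN c0 Nc fOm cZ dOm tess (fin_dim_sub Tg)).
  - by rewrite (ltW e0).
  - exact: ltW.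
  - apply: (residual_tail cE fin_dim_sub fin_dim_is_subspace (ltW e0) _ res Tg).
    exact: compact_measurable_rv.
have CE : Num.sqrt (q ^+ 2 / A) = q / (s + 1 - q).
  by rewrite /A -expr_div_n sqrtr_sqr ger0_norm// divr_ge0 ?(ltW s0)// expR_ge0.
split=> [f fH|f h fH hH].
  exact: (nugs_well_posed cE hT fOm mu_fin A0 sA).
rewrite -CE; exact: (nugs_stable cE hT fOm mu_fin A0 AB sB sA).
Qed.

End bandwidth_and_density.

(** * The polar gauge as a norm *)

Section polar_norm.
Context {R : realType} {d : nat}.
Implicit Types (x y z w : 'rV[R]_d).
Variable E : set 'rV[R]_d.

Lemma dotDr x y z : dot x (y + z) = dot x y + dot x z.
Proof. by rewrite /dot -big_split; apply: eq_bigr => i _; rewrite !mxE mulrDr. Qed.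

Lemma dotZr x (a : R) y : dot x (a *: y) = a * dot x y.
Proof. by rewrite /dot mulr_sumr; apply: eq_bigr => i _; rewrite !mxE mulrCA. Qed.

Lemma dotZl (a : R) x y : dot (a *: x) y = a * dot x y.
Proof. by rewrite /dot mulr_sumr; apply: eq_bigr => i _; rewrite !mxE mulrA. Qed.

Lemma dilate_polar (a : R) y : 0 < a -> dilate a (polar E) y <-> forall x, E x -> dot x y <= a.
Proof.
move=> a0; split=> [[z Ez <-] x Ex|H].
  by rewrite dotZr -[leRHS]mulr1 ler_wpM2l ?(ltW a0)// Ez.
exists (a^-1 *: y); last by rewrite scalerA divff ?gt_eqF// scale1r.
by move=> x Ex; rewrite dotZr mulrC ler_pdivrMr// mul1r H.
Qed.

Section bounded.
Hypothesis cE : compact E.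

Let N := gauge (polar E).

Let S y := [set a : R | 0 < a /\ dilate a (polar E) y].

Let S_nonempty y : S y !=set0.
Proof.
have a0 : 0 < sup_enorm E * enorm y + 1.
  by rewrite ltr_wpDl// mulr_ge0 ?sup_enorm_ge0 ?sqrtr_ge0.
exists (sup_enorm E * enorm y + 1); split=> //; apply/dilate_polar => // x Ex.
apply: (le_trans (ler_norm _)); apply: (le_trans (dot_cauchy_schwarz x y)).
apply: ler_wpDr => //; rewrite ler_wpM2r ?sqrtr_ge0//; exact: sup_enorm_ub.
Qed.

Lemma gauge_polar_ge0 y : 0 <= N y.
Proof. by apply: lb_le_inf; [exact: S_nonempty|move=> a [/ltW]]. Qed.

(** The gauge of the polar set is the support function of E. The infimum in the
    gauge runs over positive numbers, whence the separate condition 0 <= a. *)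
Lemma gauge_polar_le a y : N y <= a <-> 0 <= a /\ forall x, E x -> dot x y <= a.
Proof.
split=> [Na|[a0 H]].
  split=> [|x Ex]; first exact: (le_trans (gauge_polar_ge0 y)).
  apply: le_trans Na; apply: lb_le_inf; [exact: S_nonempty|]; move=> b [b0 /(dilate_polar _ b0)]; exact.
apply/ler_addgt0Pr => e e0; apply: ge_inf; first by exists 0 => b [/ltW].
have ae : 0 < a + e by rewrite ltr_wpDl.
by split=> //; apply/dilate_polar => // x Ex; rewrite ler_wpDr ?(ltW e0)// H.
Qed.

Lemma dot_le_gauge_polar x y : E x -> dot x y <= N y.
Proof. by move=> Ex; have /gauge_polar_le[_] := lexx (N y); exact. Qed.

Hypotheses (convE : convex_set E) (symE : symmetric_set E) (iE : E° !=set0).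

Let midpoint x y : E x -> E y -> E (2^-1 *: (x + y)).
Proof.
move=> Ex Ey; have h0 : (0 : R) <= 2^-1 by rewrite invr_ge0.
have h1 : (2^-1 : R) <= 1 by rewrite invf_le1 ?ler1n.
have := convE (x := x) (y := y) (Itv01 h0 h1) (mem_set Ex) (mem_set Ey).
move=> /set_mem; rewrite -[conv _ _ _]/(2^-1 *: x + (1 - 2^-1) *: y).
by rewrite scalerDr (_ : 1 - 2^-1 = 2^-1)//; field.
Qed.

(** If x0 is interior and x small, then x is the midpoint of x0 + 2x and - x0,
    both in E. *)
Lemma symmetric_convex_ball0 : exists2 r : R, 0 < r & forall x, `|x| < r -> E x.
Proof.
have [x0 /nbhs_ballP[r r0 rE]] := iE; exists (r / 2); first by rewrite divr_gt0.
move=> x xr; have -> : x = 2^-1 *: ((x0 + 2 *: x) + - x0).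
  by rewrite addrC addKr scalerA mulVf// scale1r.
apply: midpoint.
  apply: rE; rewrite mx_norm_ball /ball_/= opprD addNKr normrN normrZ ger0_norm//.
  by rewrite mulrC -ltr_pdivlMr.
apply: symE; apply: rE; exact: ballxx.
Qed.

Lemma is_norm_gauge_polar : is_norm N.
Proof.
split.
- move=> x y; apply/gauge_polar_le; split; first by rewrite addr_ge0 ?gauge_polar_ge0.
  by move=> z Ez; rewrite dotDr lerD// dot_le_gauge_polar.
- have half (a : R) x : N (a *: x) <= `|a| * N x.
    apply/gauge_polar_le; split; first by rewrite mulr_ge0 ?gauge_polar_ge0.
    move=> z Ez; rewrite dotZr; have [a0|a0] := leP 0 a.
      by rewrite ger0_norm// ler_wpM2l// dot_le_gauge_polar.
    rewrite ltr0_norm// -[leLHS]mulrNN ler_wpM2l ?oppr_ge0 ?(ltW a0)//.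
    rewrite -mulN1r -dotZl scaleN1r dot_le_gauge_polar//; exact: symE.
  move=> a x; apply/eqP; rewrite eq_le half /=.
  have [->|a0] := eqVneq a 0; first by rewrite normr0 mul0r gauge_polar_ge0.
  rewrite -ler_pdivlMl ?normr_gt0// -normfV (le_trans _ (half _ _))//.
  by rewrite scalerA mulVf// scale1r.
- move=> y N0; have [r r0 rE] := symmetric_convex_ball0.
  have [//|yN0] := eqVneq y 0.
  have y0 : 0 < `|y| by rewrite normr_gt0.
  pose t := r / 2 / `|y|; have t0 : 0 < t by rewrite !divr_gt0.
  have Ety : E (t *: y).
    apply: rE; rewrite normrZ gtr0_norm// divfK ?gt_eqF//.
    by rewrite ltr_pdivrMr// ltr_pMr// ltr1n.
  have := dot_le_gauge_polar y Ety; rewrite N0 dotZl pmulr_rle0// => dy.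
  have d0 : dot y y = 0 by apply/eqP; rewrite eq_le dy dot_ge0.
  apply/rowP => i; rewrite mxE; apply/eqP; rewrite -sqrf_eq0 expr2.
  have /eqP := d0; rewrite psumr_eq0; last by move=> j _; rewrite -expr2 sqr_ge0.
  by move=> /allP/(_ i (mem_index_enum _)).
Qed.

End bounded.

End polar_norm.

(** * Lower bound from an infinite weighted frame *)

Section near_cells.
Context {R : realType} {d : nat}.
Variables (N : 'rV[R]_d -> R) (hN : is_norm N).
Implicit Types (Om Omg Z : set 'rV[R]_d) (x y z w : 'rV[R]_d).

(** The supremum need not be attained, so only the open ball is obtained; when
    no radius is admissible the supremum is 0 and the hypothesis is absurd. *)
Lemma inradius_ball Z z : N z < inradius N Z -> Z z.
Proof.
move=> zr; have [Z0|/set0P nZ] := eqVneq [set r : R | 0 <= r /\ norm_ball N r `<=` Z] set0.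
  by move: zr; rewrite /inradius Z0 sup0 ltNge (norm_ge0 hN).
by have [r [_ +] /ltW zr'] := sup_gt nZ zr; apply.
Qed.

(** Suppose y is in the large cell of w but outside the window. The point z at
    distance 1/4 from w on the segment from w to y is in the window, so a
    sample l is within delta < 1/4 of z; then l is closer to y than w is, a
    contradiction. *)
Lemma near_cell_subset Om Omg Z delta w : finite_set Om -> Om `<=` Omg -> Z !=set0 ->
  dense_in N Om Z delta -> delta < 4^-1 -> Om w -> N w <= inradius N Z - 2^-1 ->
  voronoi N Omg setT w `<=` voronoi N Om Z w.
Proof.
move=> fOm OmOm Z0 dOm d4 Omw Nw y Vy; have [_ ymin] := Vy.
split; last by move=> l Oml lw; apply: ymin => //; exact: OmOm.
apply: contrapT => Zy.
have Ny : inradius N Z <= N y by rewrite leNgt; apply/negP => /inradius_ball.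
have wy : 2^-1 <= N (w - y).
  by have := norm_dist_triangle hN y w 0; rewrite !subr0 (norm_sym hN y w); lra.
have wy0 : 0 < N (w - y) by lra.
pose t := 4^-1 / N (w - y); pose z := w + t *: (y - w).
have t0 : 0 < t by rewrite divr_gt0.
have t1 : t <= 1 by rewrite ler_pdivrMr// mul1r; lra.
have wz : N (w - z) = 4^-1.
  rewrite /z opprD addNKr (norm_opp hN) (normZ hN) gtr0_norm// (norm_sym hN).
  by rewrite divfK ?gt_eqF.
have zy : N (z - y) = N (w - y) - 4^-1.
  rewrite (_ : z - y = (1 - t) *: (w - y)).
    rewrite (normZ hN) ger0_norm ?subr_ge0// mulrBl mul1r divfK ?gt_eqF//.
  by rewrite /z scalerBl scale1r -scalerN opprB addrAC.
have Zz : Z z.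
  apply: inradius_ball.
  have := norm_dist_triangle hN z w 0; rewrite !subr0 (norm_sym hN z w) wz; lra.
have [l Oml lmin] := nearest_point N z fOm (dense_nonempty dOm Z0).
have lz := dense_nearest dOm Zz lmin.
have ly := voronoi_min Vy (OmOm _ Oml).
have := norm_dist_triangle hN l z y; lra.
Qed.

End near_cells.

Section frame_tail.
Context {R : realType} {d : nat}.
Notation leb := (@lebesgue_rv R d).
Notation V := ('rV[R]_d -> Rcomplex R).
Variables (E : set 'rV[R]_d) (cE : compact E) (T : set V).
Hypothesis hT : @fin_dim_subspace R d E T.
Implicit Types f g h : V.

Lemma ge0_esumZ_le (I : choiceType) (D : set I) (a : I -> \bar R) (b : R) : 0 <= b ->
  (forall i, D i -> (0 <= a i)%E) ->
  (\esum_(i in D) (b%:E * a i) <= b%:E * \esum_(i in D) a i)%E.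
Proof.
move=> b0 a0; apply: ge_ereal_sup => _ [F [fF FD] <-].
rewrite fsbig_finite//= big_seq -ge0_sume_distrr; last first.
  move=> i; rewrite in_fset_set// => /set_mem Fi; apply: a0; exact: FD.
rewrite -big_seq.
apply: lee_wpmul2l; first by rewrite lee_fin.
by apply: esum_ge; exists F => //; rewrite fsbig_finite.
Qed.

Lemma discrete_residual_tail (mu : 'rV[R]_d -> \bar R) (Om S : set 'rV[R]_d) e B g :
  (forall w, Om w -> (0 <= mu w)%E) ->
  (forall f, Hspace E f -> (weighted_energy E mu Om f <= B%:E * L2norm setT f ^+ 2)%E) ->
  0 <= e -> (discrete_residual E T mu Om S <= e%:E)%E -> T g ->
  (weighted_energy E mu (Om `&` S) g <= (e ^+ 2 * rinner g g)%:E)%E.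
Proof.
move=> mu0 frame e0 res.
have Tsub := fin_dim_sub hT; have sT := fin_dim_is_subspace hT.
have term0 f w : Om w -> (0 <= mu w * (sqmod (fourier E f w))%:E)%E.
  by move=> Omw; rewrite mule_ge0 ?mu0// lee_fin sqmod_ge0.
apply: (unit_sphere_homogeneous Tsub sT (Q := weighted_energy E mu (Om `&` S))).
- move=> a f Tf; rewrite /weighted_energy.
  apply: le_trans (ge0_esumZ_le _ _); first last.
  + by move=> w [Omw _]; exact: term0.
  + exact: sqr_ge0.
  apply: le_esum => w [Omw _]; rewrite (fourierZ cE)//; last exact: Tsub.
  by rewrite sqmodZ EFinM muleCA.
- move=> f Tf f0; have fH := Tsub _ Tf; have := frame f fH.
  rewrite (L2norm_rinner fH) f0 sqrtr0 expe2 !mule0; apply: le_trans.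
  rewrite /weighted_energy (esumID S Om)//; last by move=> w; exact: term0.
  rewrite leeDl// esum_ge0// => w [Omw _]; exact: term0.
- apply: sqrte_sup_le => // f; apply: esum_ge0 => w [Omw _]; exact: term0.
Qed.

End frame_tail.

Section frame_residual.
Context {R : realType} {d : nat}.
Notation leb := (@lebesgue_rv R d).
Notation V := ('rV[R]_d -> Rcomplex R).
Variables (E : set 'rV[R]_d) (cE : compact E) (T : set V).
Hypothesis hT : @fin_dim_subspace R d E T.
Implicit Types f g h : V.

(** All samples that are not far belong to Om, and near_cell_subset compares
    their weights. *)
Lemma near_energy_le (N : 'rV[R]_d -> R) (Om Omg Y : set 'rV[R]_d) (K delta : R) g :
  is_norm N -> finite_set Om -> countable Omg -> Om `<=` Omg ->
  compact (dilate K Y) -> dilate K Y !=set0 -> dense_in N Om (dilate K Y) delta -> delta < 4^-1 ->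
  let F := ~` norm_ball N (inradius N (dilate K Y) - 2^-1) in
  Omg `\` Om `<=` F ->
  (weighted_energy E (voronoi_weight N Omg setT) (Omg `&` ~` F) g <=
   \sum_(w \in Om) (voronoi_weight N Om (dilate K Y) w * (sqmod (fourier E g w))%:E))%E.
Proof.
move=> hN fOm cOm OmOm cZ Z0 dOm d4 F far; set Z := dilate K Y in cZ Z0 dOm F far *.
have mZ := compact_measurable_rv cZ.
have near w : Omg w -> ~ F w -> Om w by move=> ow nf; apply: contrapT => now; apply: nf; exact: far.
have nearE : (Omg `&` ~` F) `<=` Om by move=> w [ow nf]; exact: near.
rewrite /weighted_energy esum_fset; last 2 first.
- exact: sub_finite_set nearE fOm.
- by move=> w _; rewrite mule_ge0 ?lee_fin ?sqmod_ge0.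
apply: (@le_trans _ _ (\sum_(w \in Omg `&` ~` F) (voronoi_weight N Om Z w * (sqmod (fourier E g w))%:E))%E).
  apply: lee_fsum; first exact: sub_finite_set nearE fOm.
  move=> w [ow /contrapT Nw]; apply: lee_wpmul2r; first by rewrite lee_fin sqmod_ge0.
  apply: le_measure; [apply: mem_set|apply: mem_set|].
  - exact: voronoi_measurable.
  - by apply: voronoi_measurable => //; exact: finite_set_countable.
  - by apply: (near_cell_subset hN fOm OmOm Z0 dOm d4 _ Nw); apply: near => //; exact.
apply: lee_fsum_nneg_subset => //.
- exact: sub_finite_set nearE fOm.
- exact/subsetP.
- by move=> w _; rewrite mule_ge0 ?lee_fin ?sqmod_ge0.
Qed.

Theorem nugs_frame_residual (Om Omg Y : set 'rV[R]_d) (c delta K eps A B : R) :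
  finite_set Om -> convex_set E -> symmetric_set E -> E° !=set0 ->
  let N := gauge (polar E) in
  0 < c -> (forall x, enorm x <= c * N x) ->
  K_dense N Om Y K delta -> voronoi_tessellation N Om (dilate K Y) ->
  delta < 4^-1 -> unit_sphere T !=set0 -> countable Omg -> Om `<=` Omg ->
  Omg `\` Om `<=` far_region E Y K ->
  let muOm := voronoi_weight N Omg setT in
  weighted_fourier_frame E muOm Omg A B ->
  0 < eps -> eps < Num.sqrt A ->
  (discrete_residual E T muOm Omg (far_region E Y K) <= eps%:E)%E ->
  let mu := voronoi_weight N Om (dilate K Y) in
  (forall f, Hspace E f -> exists_unique_ae (nugs_argmin E T mu Om f)) /\
  forall f h, Hspace E f -> Hspace E h ->
    (L2norm setT (fun x => f x - nugs E T mu Om (fun t => f t + h t)%R x)%R <=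
     (expR (2^-1 * pi * sup_enorm E * c) / Num.sqrt (A - eps ^+ 2))%:E *
     (L2norm setT (fun x => f x - orth_proj T f x)%R + L2norm setT h))%E.
Proof.
move=> fOm convE symE iE N c0 Nc [K0 [cY _ Y0] [Y1 _] dOm] tess d4 T1 cOm OmOm far muOm
  [mup A0 B0 frame] e0 eA res mu.
have hN : is_norm N by exact: is_norm_gauge_polar.
have cZ := compact_dilate (K := K) cY Y1.
have Z0 : dilate K Y !=set0 by exists (K *: 0); exists 0 => //; exact: interior_subset Y0.
have Tsub := fin_dim_sub hT.
have e2 : 0 < A - eps ^+ 2.
  by rewrite subr_gt0 -[ltRHS](sqr_sqrtr (ltW A0)) ltrXn2r// ?nnegrE ltW.
pose b := expR (2^-1 * pi * sup_enorm E * c).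
have mu_fin w : Om w -> (0 <= mu w < +oo)%E by move=> _; exact: voronoi_weight_fin.
have sB f : Hspace E f -> sform E Om mu f f <= b ^+ 2 * rinner f f.
  move=> fH; apply: (le_trans (sform_le cE hN c0 Nc fOm cZ dOm tess fH)).
  rewrite ler_wpM2r ?rinner_ge0// lerXn2r ?nnegrE ?expR_ge0// ler_expR.
  rewrite ler_wpM2r ?(ltW c0)//.
  have := @pi_ge0 R; have := sup_enorm_ge0 cE => m0 p0; have mp := mulr_ge0 m0 p0; nra.
have sA g : T g -> (A - eps ^+ 2) * rinner g g <= sform E Om mu g g.
  move=> Tg; have gH := Tsub _ Tg.
  rewrite mulrBl lerBlDr -lee_fin EFinD (sformE E fOm mu_fin).
  have frameB f : Hspace E f -> (weighted_energy E muOm Omg f <= B%:E * L2norm setT f ^+ 2)%E.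
    by move=> /frame/andP[].
  have mu0 w : Omg w -> (0 <= muOm w)%E by move=> /mup/andP[/ltW].
  have := discrete_residual_tail cE hT mu0 frameB (ltW e0) res Tg.
  have := near_energy_le g hN fOm cOm OmOm cZ Z0 dOm d4 far.
  have /andP[+ _] := frame g gH; rewrite (L2norm_rinner gH) expe2 -EFinM -expr2 sqr_sqrtr ?rinner_ge0//.
  rewrite {1}/weighted_energy (esumID (far_region E Y K) Omg); last first.
    by move=> w ow; rewrite mule_ge0 ?mu0// lee_fin sqmod_ge0.
  rewrite fsbig_finite// => H1 H2 H3; rewrite EFinM (le_trans H1)// addeC.
  by apply: leeD.
(* Both constants bound the form at a unit vector of T. *)
have AB : A - eps ^+ 2 <= b ^+ 2.
  have [g [Tg g1]] := T1; have gH := Tsub _ Tg.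
  have g2 : rinner g g = 1.
    move: g1; rewrite (L2norm_rinner gH) => -[g1].
    by rewrite -(sqr_sqrtr (rinner_ge0 g)) g1 expr1n.
  by have := le_trans (sA g Tg) (sB g gH); rewrite g2 !mulr1.
have CE : Num.sqrt (b ^+ 2 / (A - eps ^+ 2)) = b / Num.sqrt (A - eps ^+ 2).
  by rewrite sqrtrM ?sqr_ge0// sqrtr_sqr sqrtrV ?(ltW e2)// ger0_norm ?expR_ge0.
split=> [f fH|f h fH hH].
  exact: (nugs_well_posed cE hT fOm mu_fin e2 sA).
rewrite -/b -CE; exact: (nugs_stable cE hT fOm mu_fin e2 AB sB sA).
Qed.

End frame_residual.

(** * Stability of the reconstruction *)

Unset Implicit Arguments.

Theorem theorem3p3 (R : realType) (d : nat) (E : set 'rV[R]_d)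
    (T : set ('rV[R]_d -> R[i])) (OmN : set 'rV[R]_d)
    (hE : compact E) (hT : fin_dim_subspace E T) (hOmN : finite_set OmN) :
  (forall (N : 'rV[R]_d -> R) (c delta K eps : R) (Y : set 'rV[R]_d),
     is_norm N ->
     smallest_const N c ->
     K_dense N OmN Y K delta ->
     voronoi_tessellation N OmN (dilate K Y) ->
     2 * pi * sup_enorm E * c * delta < ln 2 ->
     let q := expR (2 * pi * sup_enorm E * delta * c) in
     0 < eps -> eps < Num.sqrt (q * (2 - q)) ->
     (residual E T Y K <= eps%:E)%E ->
     let mu := voronoi_weight N OmN (dilate K Y) in
     let F := nugs E T mu OmN in
     (forall f, Hspace E f -> exists_unique_ae (nugs_argmin E T mu OmN f)) /\
     exists C : R,
       C <= 2 / (Num.sqrt (1 - eps ^+ 2) + 1 - q) /\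
       forall f h, Hspace E f -> Hspace E h ->
         (L2norm setT (fun x => f x - F (fun t => f t + h t)%R x)%R <=
          C%:E * (L2norm setT (fun x => f x - orth_proj T f x)%R +
                  L2norm setT h))%E)
  /\
  (forall (c delta K eps A B : R) (Y Om : set 'rV[R]_d),
     convex_set E ->
     symmetric_set E ->
     E° !=set0 ->
     let N := gauge (polar E) in
     smallest_const N c ->
     K_dense N OmN Y K delta ->
     voronoi_tessellation N OmN (dilate K Y) ->
     delta < 4^-1 ->
     unit_sphere T !=set0 ->
     countable Om ->
     OmN `<=` Om ->
     Om `\` OmN `<=` far_region E Y K ->
     let muOm := voronoi_weight N Om setT in
     weighted_fourier_frame E muOm Om A B ->
     0 < eps -> eps < Num.sqrt A ->
     (discrete_residual E T muOm Om (far_region E Y K) <= eps%:E)%E ->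
     let mu := voronoi_weight N OmN (dilate K Y) in
     let F := nugs E T mu OmN in
     (forall f, Hspace E f -> exists_unique_ae (nugs_argmin E T mu OmN f)) /\
     exists C : R,
       C <= expR (2^-1 * pi * sup_enorm E * c) / Num.sqrt (A - eps ^+ 2) /\
       forall f h, Hspace E f -> Hspace E h ->
         (L2norm setT (fun x => f x - F (fun t => f t + h t)%R x)%R <=
          C%:E * (L2norm setT (fun x => f x - orth_proj T f x)%R +
                  L2norm setT h))%E).

Proof.
split=> [N c delta K eps Y hN [c0 Nc _] dense tess small q e0 eq_ res mu F|].
  have [_ _ _ [d0 _ _]] := dense.
  have q1 : 1 <= q by exact: frame_constant_ge1.
  have q2 : q < 2.
    rewrite /q (_ : 2 * pi * sup_enorm E * delta * c = 2 * pi * sup_enorm E * c * delta); last by ring.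
    by rewrite -[ltRHS]lnK ?posrE// ltr_expR.
  have [wp st] := nugs_window_residual hE hT hOmN hN c0 Nc dense tess q2 e0 eq_ res.
  split=> //; exists (q / (Num.sqrt (1 - eps ^+ 2) + 1 - q)); split=> //.
  have [|_ qs] := frame_margin _ e0 eq_; first by rewrite q1.
  by rewrite ler_wpM2r ?(ltW q2)// invr_ge0; lra.
move=> c delta K eps A B Y Om convE symE iE N [c0 Nc _] dense tess d4 T1 cOm OmOm far muOm
  frame e0 eA res mu F.
have [wp st] := nugs_frame_residual hE hT hOmN convE symE iE c0 Nc dense tess d4 T1 cOm OmOm
  far frame e0 eA res.
by split=> //; exists (expR (2^-1 * pi * sup_enorm E * c) / Num.sqrt (A - eps ^+ 2)).
Qed.
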